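(* Let $k\in\mathbb{N}$, let $p(\cdot)\in P^{\log}(\mathbb{R}^n)$ with $1<p^-\le p^+<\infty$, and let $\vartheta\in A_{p(\cdot)}$ be a weight on $\mathbb{R}^n$ with $\vartheta^{-\frac1{p(\cdot)-1}}\in L^1_{loc}(\mathbb{R}^n)$. Let $\varphi_\varepsilon$, $\varepsilon>0$, be a mollifier on $\mathbb{R}^n$. Then a subset $\mathcal{F}\subset W_\vartheta^{k,p(\cdot)}(\mathbb{R}^n)$ is totally bounded if and only if the following three conditions hold: (i) $\mathcal{F}$ is bounded in $W_\vartheta^{k,p(\cdot)}(\mathbb{R}^n)$, i.e. there is a $C>0$ such that for all $f\in\mathcal{F}$ and all multi-indices $0\le|\alpha|\le k$, $\int_{\mathbb{R}^n}|D^\alpha f(x)|^{p(x)}\vartheta(x)\,dx<C$; (ii) for every $\varepsilon>0$ there is a $\gamma>0$ such that for all $f\in\mathcal{F}$ and $0\le|\alpha|\le k$, $\|(D^\alpha f)\chi_{\{|x|>\gamma\}}\|_{L_\vartheta^{p(\cdot)}(\mathbb{R}^n)}<\varepsilon$ (or equivalently, for every $\varepsilon>0$ there is a $\gamma>0$ such that for all such $f,\alpha$, $\int_{|x|>\gamma}|D^\alpha f(x)|^{p(x)}\vartheta(x)\,dx<\varepsilon$); (iii) $\lim_{\varepsilon\to0^+}\|D^\alpha(f*\varphi_\varepsilon)-D^\alpha f\|_{L_\vartheta^{p(\cdot)}(\mathbb{R}^n)}=0$ uniformly for $f\in\mathcal{F}$ and $0\le|\alpha|\le k$.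
   Context: A variable exponent is a measurable $p(\cdot):\mathbb{R}^n\to[1,\infty)$; $p^-=\operatorname{ess\,inf}p$, $p^+=\operatorname{ess\,sup}p$. $P^{\log}(\mathbb{R}^n)$ is the class of exponents for which there are $C>0$ and $p_\infty>1$ with $|p(x)-p(y)|\le C/\log(e+1/|x-y|)$ and $|p(x)-p_\infty|\le C/\log(e+|x|)$ for all $x,y$. A weight is a measurable, locally integrable function $\vartheta:\mathbb{R}^n\to(0,\infty)$. For a measurable function $f$, $\|f\|_{p(\cdot)}=\inf\{\lambda>0:\int_{\mathbb{R}^n}|f(x)/\lambda|^{p(x)}dx\le1\}$, and $L_\vartheta^{p(\cdot)}(\mathbb{R}^n)$ is the space of measurable $f$ with $\|f\|_{L_\vartheta^{p(\cdot)}(\mathbb{R}^n)}=\|f\vartheta^{1/p(\cdot)}\|_{p(\cdot)}<\infty$. $\vartheta\in A_{p(\cdot)}$ means $\sup_{B}|B|^{-p_B}\|\vartheta\|_{L^1(B)}\left\|\frac1\vartheta\right\|_{L^{p'(\cdot)/p(\cdot)}(B)}<\infty$, the supremum over all balls $B\subset\mathbb{R}^n$, where $p_B=\left(\frac1{|B|}\int_B\frac{dx}{p(x)}\right)^{-1}$, $\frac1{p(\cdot)}+\frac1{p'(\cdot)}=1$, and $\|\cdot\|_{L^{s(\cdot)}(B)}$ denotes the expression $\inf\{\lambda>0:\int_B|f/\lambda|^{s(x)}dx\le1\}$ (also when $s$ takes values below $1$). Sobolev space: $W_\vartheta^{k,p(\cdot)}(\mathbb{R}^n)=\{f\in L_\vartheta^{p(\cdot)}(\mathbb{R}^n):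 D^\alpha f\in L_\vartheta^{p(\cdot)}(\mathbb{R}^n),\ 0\le|\alpha|\le k\}$, with norm $\sum_{0\le|\alpha|\le k}\|D^\alpha f\|_{L_\vartheta^{p(\cdot)}(\mathbb{R}^n)}$, where $D^\alpha$ are distributional derivatives and $\alpha\in\mathbb{N}_0^n$ multi-indices (the condition $\vartheta^{-1/(p(\cdot)-1)}\in L^1_{loc}$ gives $L_\vartheta^{p(\cdot)}\hookrightarrow L^1_{loc}$). Mollifier: $\varphi:\mathbb{R}^n\to\mathbb{R}$ is a nonnegative, radial, (radially) decreasing $C_0^\infty$ function with $\varphi(x)=0$ for $|x|\ge1$ and $\int\varphi=1$; $\varphi_\varepsilon(x)=\varepsilon^{-n}\varphi(x/\varepsilon)$, and $\varphi_\varepsilon*f(x)=\int\varphi_\varepsilon(x-y)f(y)dy$. A set is totally bounded if for every $\varepsilon>0$ it has a finite $\varepsilon$-net. *)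

(* Defs.v *)
From HB Require Import structures.
From mathcomp Require Import all_boot all_order all_algebra.
From mathcomp Require Import all_classical all_reals all_analysis ess_sup_inf.
Set Implicit Arguments.
Unset Strict Implicit.
Unset Printing Implicit Defensive.
Import Order.TTheory GRing.Theory Num.Theory.
Import numFieldNormedType.Exports.
Local Open Scope classical_set_scope.
Local Open Scope ring_scope.

(* R^n is 'rV[R]_n; its sigma-algebra is the product one, i.e. the Borel sets. *)
Section measurable_rV.
Context {R : realType}.
Variable n : nat.

Let coord (i : 'I_n) (x : 'rV[R]_n) : R := x ord0 i.

Let rV_set0 : g_sigma_preimage coord set0.
Proof. exact: sigma_algebra0. Qed.

Let rV_setC A : g_sigma_preimage coord A -> g_sigma_preimage coord (~` A).
Proof. exact: sigma_algebraC. Qed.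

Let rV_bigcup (F : _^nat) : (forall i, g_sigma_preimage coord (F i)) ->
  g_sigma_preimage coord (\bigcup_i (F i)).
Proof. exact: sigma_algebra_bigcup. Qed.

HB.instance Definition _ := @isMeasurable.Build default_measure_display
  'rV[R]_n (g_sigma_preimage coord) rV_set0 rV_setC rV_bigcup.

End measurable_rV.

Section lebesgue_measure_rV.
Context {R : realType}.

Definition cons_rV n (p : measurableTypeR R * 'rV[R]_n) : 'rV[R]_n.+1 :=
  \row_i if unlift ord0 i is Some j then p.2 ord0 j else p.1.

Definition uncons_rV n (x : 'rV[R]_n.+1) : measurableTypeR R * 'rV[R]_n :=
  (x ord0 ord0, \row_i x ord0 (lift ord0 i)).

Lemma cons_rVK n : cancel (@cons_rV n) (@uncons_rV n).
Proof.
move=> [t x]; congr pair; first by rewrite mxE unlift_none.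
by apply/rowP => i; rewrite !mxE liftK.
Qed.

Lemma measurable_coord_rV n (i : 'I_n) :
  measurable_fun [set: 'rV[R]_n] (fun x : 'rV[R]_n => x ord0 i).
Proof.
move=> _ Y mY; rewrite setTI; apply: sub_sigma_algebra => /=.
rewrite -bigcup_seq/=; exists i => /=; first by rewrite mem_index_enum.
by exists Y => //; rewrite setTI.
Qed.


Lemma measurable_fun_rV d (T : measurableType d) n (f : T -> 'rV[R]_n) :
  (forall i, measurable_fun [set: T] (fun t => f t ord0 i)) ->
  measurable_fun [set: T] f.
Proof.
move=> mf.
suff prefS : g_sigma_preimage (fun i => (fun x : 'rV[R]_n => x ord0 i) \o f)
    `<=` measurable.
  move=> _ A mA; rewrite setTI; apply: prefS.
  by rewrite g_sigma_preimage_comp; exists A => //; rewrite setTI.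
apply: smallest_sub; first exact: sigma_algebra_measurable.
case: n => [|n] in f mf *; first by rewrite big_ord0.
rewrite -bigcup_mkord_ord; apply: bigcup_sub => i Ii.
by move=> A [B mB <-]; exact: mf.
Qed.

Lemma measurable_cons_rV n : measurable_fun setT (@cons_rV n).
Proof.
apply: measurable_fun_rV => i; case: (unliftP ord0 i) => [j|] ->.
  rewrite (_ : (fun t => _) = (fun x : 'rV[R]_n => x ord0 j) \o snd).
    apply: measurableT_comp => //; exact: measurable_coord_rV.
  by apply/funext => t; rewrite mxE liftK.
rewrite (_ : (fun t => _) = fst) //.
by apply/funext => t; rewrite mxE unlift_none.
Qed.

Lemma measurable_uncons_rV n : measurable_fun setT (@uncons_rV n).
Proof.
apply/measurable_fun_pairP; split; first exact: measurable_coord_rV.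
apply: measurable_fun_rV => i.
rewrite (_ : (fun t => _) = (fun x : 'rV[R]_n.+1 => x ord0 (lift ord0 i))).
  exact: measurable_coord_rV.
by apply/funext => t /=; rewrite mxE.
Qed.

Definition cons_measure n (m : {sigma_finite_measure set 'rV[R]_n -> \bar R}) :
    set 'rV[R]_n.+1 -> \bar R :=
  pushforward (lebesgue_measure \x m)%E (@cons_rV n).

Section cons_measure.
Variables (n : nat) (m : {sigma_finite_measure set 'rV[R]_n -> \bar R}).

Let cons_measure0 : cons_measure m set0 = 0%E.
Proof. by rewrite /cons_measure /pushforward preimage_set0 measure0. Qed.

Let cons_measure_ge0 A : (0 <= cons_measure m A)%E.
Proof. exact: (measure_ge0 (lebesgue_measure \x m)%E). Qed.

Let cons_measure_sigma_additive : semi_sigma_additive (cons_measure m).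
Proof.
have h := @measure_semi_sigma_additive _ _ _
  (measure_function_pushforward__canonical__measure_function_Measure
  (lebesgue_measure \x m)%E (@measurable_cons_rV n)).
exact: h.
Qed.

HB.instance Definition _ := isMeasure.Build _ _ _ (cons_measure m)
  cons_measure0 cons_measure_ge0 cons_measure_sigma_additive.

Let cons_measure_sigma_finite : sigma_finite setT (cons_measure m).
Proof.
have /sigma_finiteP[F [TF ndF Foo]] := sigma_finiteT (@lebesgue_measure R).
have /sigma_finiteP[G [TG ndG Goo]] := sigma_finiteT m.
exists (fun k => @uncons_rV n @^-1` (F k `*` G k)).
  apply/seteqP; split => // x _.
  have [k _ Fk] : (\bigcup_k F k) (uncons_rV x).1 by rewrite -TF.
  have [l _ Gl] : (\bigcup_k G k) (uncons_rV x).2 by rewrite -TG.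
  exists (maxn k l) => //; split.
    by move: Fk; exact/subsetPset/ndF/leq_maxl.
  by move: Gl; exact/subsetPset/ndG/leq_maxr.
move=> k; have [mF Fk] := Foo k; have [mG Gk] := Goo k.
split.
  rewrite -[X in measurable X]setTI; apply: measurable_uncons_rV => //.
  exact: measurableX.
rewrite /cons_measure /pushforward -comp_preimage.
rewrite (_ : _ \o _ = id); last by apply/funext => p; rewrite /= cons_rVK.
by rewrite preimage_id product_measure1E// lte_mul_pinfty// ge0_fin_numE.
Qed.

HB.instance Definition _ := Measure_isSigmaFinite.Build _ _ _ (cons_measure m)
  cons_measure_sigma_finite.

End cons_measure.

(* n-dimensional Lebesgue measure, as the iterated product of [lebesgue_measure]
   (characterized by its value on boxes, see [lebesgue_rV_box]). *)
Fixpoint lebesgue_rV n : {sigma_finite_measure set 'rV[R]_n -> \bar R} :=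
  if n is n'.+1 then cons_measure (lebesgue_rV n') else \d_(0 : 'rV[R]_0).

Lemma measurable_box n (a b : 'rV[R]_n) :
  measurable [set x : 'rV[R]_n | forall i, a ord0 i < x ord0 i <= b ord0 i].
Proof.
rewrite (_ : mkset _ = \bigcap_(i in [set: 'I_n])
    ((fun x : 'rV[R]_n => x ord0 i) @^-1` `]a ord0 i, b ord0 i]%classic)).
  apply: fin_bigcap_measurable => // i _.
  by rewrite -[X in measurable X]setTI; exact: measurable_coord_rV.
by apply/seteqP; split => x /= h i; [move=> _|]; have /= := h i; rewrite ?in_itv//=; apply.
Qed.

Lemma lebesgue_rV_box n (a b : 'rV[R]_n) : (forall i, a ord0 i <= b ord0 i) ->
  lebesgue_rV n [set x | forall i, a ord0 i < x ord0 i <= b ord0 i] =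
  (\prod_(i < n) (b ord0 i - a ord0 i))%:E.
Proof.
elim: n a b => [|n IH] a b ab.
  by rewrite big_ord0 /= diracE mem_set//= => -[].
rewrite big_ord_recl EFinM.
have -> : \prod_(i < n) (b ord0 (lift ord0 i) - a ord0 (lift ord0 i)) =
    \prod_(i < n) ((uncons_rV b).2 ord0 i - (uncons_rV a).2 ord0 i).
  by apply: eq_bigr => i _; rewrite !mxE.
rewrite -IH; last by move=> i; rewrite !mxE.
have -> : (b ord0 ord0 - a ord0 ord0)%:E =
    lebesgue_measure `]a ord0 ord0, b ord0 ord0]%classic.
  rewrite lebesgue_measure_itv/= lte_fin; case: ltP => // h.
  by rewrite (le_anti (introT andP (conj h (ab ord0)))) subrr.
rewrite -product_measure1E//=; last exact: measurable_box.
rewrite /cons_measure /pushforward; congr (_ _ _ _).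
apply/seteqP; split => -[t x] /= => [h|[h1 h2] i].
  split=> [|i]; first by have := h ord0; rewrite mxE unlift_none in_itv.
  by have := h (lift ord0 i); rewrite !mxE liftK.
by rewrite mxE; case: (unliftP ord0 i) => [j|] ->; [have := h2 j; rewrite !mxE|].
Qed.

End lebesgue_measure_rV.

Section euclidean_space.
Context {R : realType} {n : nat}.
Implicit Types (f g phi p th : 'rV[R]_n -> R) (x y c : 'rV[R]_n).
Implicit Types (a : 'I_n -> nat) (i : 'I_n).
Local Notation mu := (lebesgue_rV n : {measure set 'rV[R]_n -> \bar R}).

(* The norm carried by 'rV[R]_n is the sup norm (same topology). *)
Definition enorm x : R := Num.sqrt (\sum_(i < n) x ord0 i ^+ 2).

Definition eball c (r : R) : set 'rV[R]_n := [set x | enorm (x - c) < r].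

(* Measurability with respect to the completed (Lebesgue) sigma-algebra.
   The integral of a nonnegative function is the supremum of the integrals of
   the simple Borel functions below it, so that [\int[mu]_x f x] is the Lebesgue
   integral also when f is measurable only in this sense. *)
Definition lebesgue_measurable f : Prop :=
  exists2 g, measurable_fun [set: 'rV[R]_n] g & f = g %[ae mu].

Definition locally_integrable_rV f : Prop :=
  lebesgue_measurable f /\
  forall K, compact K -> (\int[mu]_(x in K) `|f x|%:E < +oo)%E.

(* [multi_partial a] is the classical D^a, for a multi-index a. *)
Definition multi_order a : nat := (\sum_(i < n) a i)%N.

Definition partial i f : 'rV[R]_n -> R := fun x => 'D_(delta_mx ord0 i) f x.

Definition multi_partial a f : 'rV[R]_n -> R :=
  foldr (fun i => iter (a i) (partial i)) f (enum 'I_n).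

Definition smooth f : Prop := forall s : seq 'I_n,
  continuous (foldr partial f s) /\
  forall i x, derivable (foldr partial f s) x (delta_mx ord0 i).

Definition test_function phi : Prop :=
  smooth phi /\ compact (closure [set x | phi x != 0]).

Definition weak_derivative a f g : Prop :=
  [/\ locally_integrable_rV f, locally_integrable_rV g &
      forall phi, test_function phi ->
        \int[mu]_x (f x * multi_partial a phi x) =
        (-1) ^+ multi_order a * \int[mu]_x (g x * phi x)].

(* A version of the distributional derivative D^a f; it is a junk value when
   D^a f is not a locally integrable function. *)
Definition weakD a f : 'rV[R]_n -> R :=
  xget (cst 0) [set g | weak_derivative a f g].

Definition variable_exponent p : Prop :=
  lebesgue_measurable p /\ forall x, 1 <= p x.

(* For x = y the first bound reads 0 <= C / ln (expR 1), because 0^-1 = 0. *)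
Definition P_log p : Prop :=
  variable_exponent p /\
  exists C pinf : R, [/\ 0 < C, 1 < pinf,
    forall x y, `|p x - p y| <= C / ln (expR 1 + (enorm (x - y))^-1) &
    forall x, `|p x - pinf| <= C / ln (expR 1 + enorm x)].

Definition weight th : Prop :=
  locally_integrable_rV th /\ forall x, 0 < th x.

(* ||f||_{L^{s(.)}(D)}, with values in [0, +oo] *)
Definition vnorm (D : set 'rV[R]_n) (s : 'rV[R]_n -> R) f : \bar R :=
  ereal_inf [set l%:E | l in [set l : R | 0 < l /\
    (\int[mu]_(x in D) (`|f x / l| `^ s x)%:E <= 1)%E]].

Definition wnorm p th f : \bar R :=
  vnorm [set: 'rV[R]_n] p (fun x => f x * th x `^ (p x)^-1).

Definition weighted_Lp p th : set ('rV[R]_n -> R) :=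
  [set f | lebesgue_measurable f /\ (wnorm p th f < +oo)%E].

(* p' is junk where p = 1, which is excluded when p^- > 1. *)
Definition conj_exponent p : 'rV[R]_n -> R := fun x => (1 - (p x)^-1)^-1.

Definition mean_exponent p (B : set 'rV[R]_n) : R :=
  ((fine (mu B))^-1 * \int[mu]_(x in B) (p x)^-1)^-1.

Definition muckenhoupt p th : Prop :=
  (ereal_sup [set E | exists c (r : R), (0 < r)%R /\
     let B := eball c r in
     E = (fine (mu B) `^ (- mean_exponent p B))%:E *
         (\int[mu]_(x in B) `|th x|%:E) *
         vnorm B (fun x => conj_exponent p x / p x)%R (fun x => (th x)^-1)%R]
   < +oo)%E.

Definition sobolev (k : nat) p th : set ('rV[R]_n -> R) :=
  [set f | weighted_Lp p th f /\
     forall a, (multi_order a <= k)%N ->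
       exists2 g, weak_derivative a f g & weighted_Lp p th g].

(* Every multi-index of order at most k has entries in 'I_k.+1. *)
Definition sobolev_norm (k : nat) p th f : \bar R :=
  (\sum_(a : {ffun 'I_n -> 'I_k.+1} | (multi_order (fun i => a i) <= k)%N)
     wnorm p th (weakD (fun i => a i) f))%E.

Definition sobolev_totally_bounded (k : nat) p th
    (F : set ('rV[R]_n -> R)) : Prop :=
  forall e : R, 0 < e -> exists N : set ('rV[R]_n -> R),
    [/\ finite_set N, N `<=` sobolev k p th &
        forall f, F f -> exists2 g, N g & (sobolev_norm k p th (f \- g)%R < e%:E)%E].

Definition mollifier phi : Prop :=
  [/\ test_function phi,
      [/\ forall x, 0 <= phi x,
          forall x y, enorm x = enorm y -> phi x = phi y &
          forall x y, enorm x <= enorm y -> phi y <= phi x],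
      forall x, 1 <= enorm x -> phi x = 0 &
      \int[mu]_x phi x = 1].

Definition dilation (e : R) phi : 'rV[R]_n -> R :=
  fun x => e ^- n * phi (e^-1 *: x).

Definition convolution phi f : 'rV[R]_n -> R :=
  fun x => \int[mu]_y (phi (x - y) * f y).

Definition sobolev_bounded (k : nat) p th (F : set ('rV[R]_n -> R)) : Prop :=
  exists2 C : R, 0 < C & forall f a, F f -> (multi_order a <= k)%N ->
    (\int[mu]_x (`|weakD a f x| `^ p x * th x)%:E < C%:E)%E.

Definition norm_tails (k : nat) p th (F : set ('rV[R]_n -> R)) : Prop :=
  forall e : R, 0 < e -> exists2 ga : R, 0 < ga &
    forall f a, F f -> (multi_order a <= k)%N ->
      (wnorm p th (fun x => weakD a f x * \1_[set y | ga < enorm y] x)%R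
         < e%:E)%E.

Definition modular_tails (k : nat) p th (F : set ('rV[R]_n -> R)) : Prop :=
  forall e : R, 0 < e -> exists2 ga : R, 0 < ga &
    forall f a, F f -> (multi_order a <= k)%N ->
      (\int[mu]_(x in [set y | (ga < enorm y)%R])
         (`|weakD a f x| `^ p x * th x)%:E < e%:E)%E.

Definition mollified_uniformly (k : nat) p th phi
    (F : set ('rV[R]_n -> R)) : Prop :=
  forall eta : R, 0 < eta -> exists2 delta : R, 0 < delta &
    forall e : R, 0 < e < delta ->
    forall f a, F f -> (multi_order a <= k)%N ->
      (wnorm p th (weakD a (convolution (dilation e phi) f) \- weakD a f)%R
         < eta%:E)%E.

End euclidean_space.

(* Main.v *)
Require Import Defs.
From HB Require Import structures.
From mathcomp Require Import all_boot all_order all_algebra.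
From mathcomp Require Import all_classical all_reals all_analysis ess_sup_inf.
From mathcomp Require Import measurable_realfun.
From mathcomp Require Import ring lra.
Set Implicit Arguments.
Unset Strict Implicit.
Unset Printing Implicit Defensive.
Import Order.TTheory GRing.Theory Num.Theory.
Import numFieldNormedType.Exports.
Local Open Scope classical_set_scope.
Local Open Scope ring_scope.

(** The proof works with the modular [rho f = \int |f| ^ p * th] instead of the
    Luxemburg norm; since [p] is bounded, both define the same small sets
    ([wnorm_lt_of_modular], [modular_lt_of_wnorm]), and the modular is
    quasi-subadditive with a constant depending on the upper bound of [p] only.
    The weight is replaced by a Borel version, and the hypotheses are collected
    in [regular_weight].

    The analytic core is that mollification is bounded, uniformly in the scale:
    if [rho f <= 1], then [rho (phi_e * f) <= C] for all [0 < e <= 1]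
    ([mollify_modular_bound]). As [phi_e * |f|] is at most a multiple of the
    average of [|f|] over the cube of half-side [e], it is enough to treat cube
    averages ([cube_average_bound]).
    On one cube [B] around [x], the Muckenhoupt condition and Young's inequality
    compare the average to the power [p x] with [\int_B f ^ p * th / th (B)],
    up to an integrable error ([cube_average_pointwise]); log-Hoelder continuity
    allows [p y] to be replaced by [p x] because the average lies between two
    powers of [(2 + |x|) / e]. Integrating in [x] against [th] and
    exchanging the integrals leaves [\int_{|x - y| < e} th x / th (B x) dx], which
    is at most [2 ^ n] since a cube centred in an orthant of [B y] contains that
    orthant ([weight_ratio_integral]).

    Consequently [rho (phi_e * f - f) -> 0] for every [f] of finite modular: this
    holds for indicators of boxes, where [phi_e * f] and [f] differ only near the
    faces, and the set of such [f] is a vector space closed under dominated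
    limits, because of the uniform bound ([mollify_converges]).

    Weak derivatives are unique and commute with mollification
    ([weak_derivative_unique], [weak_derivative_convolution]), so everything reduces
    to the finitely many functions [D^a f]. If the family is totally bounded, then
    each of the three conditions passes from the finite net to the family: it
    holds for single functions, and mollifications are equicontinuous in the modular
    ([mollify_error_transfer]). Conversely, under the three conditions the
    mollifications at a small fixed scale are uniformly bounded and equicontinuous
    on a large cube, by Young's inequality and local integrability of the dual
    weight. Recording their values, rounded, at finitely many points splits the
    family into finitely many classes, and two members of one class are close:
    on the cube through their mollifications, off the cube by smallness of the tails
    ([family_finite_net]). *)

(** * Integrals of functions that are measurable up to a null set *)

Section ae_integral.
Context d (T : measurableType d) (R : realType) (mu : {measure set T -> \bar R}).
Import HBNNSimple.

(** The integral of a nonnegative function is a supremum over simple functions,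
    and cutting a simple function off a null set does not change its integral;
    hence arbitrary functions may be compared off a null set, in particular
    functions that are measurable only for the completed sigma-algebra. *)
Lemma ae_ge0_le_integralT (f g : T -> \bar R) :
  (forall x, 0 <= f x)%E -> (forall x, 0 <= g x)%E ->
  {ae mu, forall x, (f x <= g x)%E} ->
  (\int[mu]_x f x <= \int[mu]_x g x)%E.
Proof.
move=> f0 g0 [N [mN N0 subN]].
rewrite !ge0_integralTE//; apply: ge_ereal_sup => _ [h /= hf <-].
pose h' := mul_nnsfun h (indic_nnsfun R (measurableC mN)).
apply: (@le_trans _ _ (sintegral mu h')); last first.
  apply: ereal_sup_ubound; exists h' => // x; rewrite (_ : h' x = h x * \1_(~` N) x)// indicE.
  case: (pselect (N x)) => Nx.
    by rewrite memNset ?mulr0//= => /(_ Nx).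
  rewrite mem_set ?mulr1//=; apply: (le_trans (hf x)).
  by apply: contrapT => nfg; apply: Nx; apply: subN.
rewrite -!integralT_nnsfun.
apply: ae_ge0_le_integral => //.
- by move=> x _; rewrite lee_fin.
- by apply/measurable_EFinP.
- by move=> x _; rewrite lee_fin.
- by apply/measurable_EFinP.
- exists N; split => // x /= nx; apply: contrapT => Nx; apply: nx => _.
  by rewrite lee_fin -[leRHS]/(h x * \1_(~` N) x) indicE mem_set ?mulr1.
Qed.

Lemma ae_ge0_le_integral_dom (D : set T) (f g : T -> \bar R) :
  (forall x, D x -> 0 <= f x)%E -> (forall x, D x -> 0 <= g x)%E ->
  {ae mu, forall x, D x -> (f x <= g x)%E} ->
  (\int[mu]_(x in D) f x <= \int[mu]_(x in D) g x)%E.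
Proof.
move=> f0 g0 fg; rewrite integral_mkcond [leRHS]integral_mkcond.
apply: ae_ge0_le_integralT.
- by move=> x; rewrite patchE; case: ifPn => // /set_mem; exact: f0.
- by move=> x; rewrite patchE; case: ifPn => // /set_mem; exact: g0.
- apply: filterS fg => x h; rewrite !patchE; case: ifPn => // /set_mem; exact: h.
Qed.

Lemma ge0_le_integral_nomeas (D : set T) (f g : T -> \bar R) :
  (forall x, D x -> 0 <= f x)%E -> (forall x, D x -> f x <= g x)%E ->
  (\int[mu]_(x in D) f x <= \int[mu]_(x in D) g x)%E.
Proof.
move=> f0 fg; apply: ae_ge0_le_integral_dom => //; last exact: aeW.
by move=> x Dx; apply: le_trans (fg _ Dx); exact: f0.
Qed.

Lemma ae_ge0_eq_integral_dom (D : set T) (f g : T -> \bar R) :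
  (forall x, D x -> 0 <= f x)%E -> (forall x, D x -> 0 <= g x)%E ->
  {ae mu, forall x, D x -> (f x = g x)%E} ->
  (\int[mu]_(x in D) f x = \int[mu]_(x in D) g x)%E.
Proof.
move=> f0 g0 fg; apply/eqP; rewrite eq_le; apply/andP; split;
  by apply: ae_ge0_le_integral_dom => //; apply: filterS fg => x h Dx; rewrite h.
Qed.

Lemma ae_eq_integral_dom (D : set T) (f g : T -> \bar R) :
  {ae mu, forall x, D x -> (f x = g x)%E} ->
  (\int[mu]_(x in D) f x = \int[mu]_(x in D) g x)%E.
Proof.
move=> /ae_eq_funeposneg[fgp fgn]; rewrite integralE [RHS]integralE.
by congr (_ - _)%E; apply: ae_ge0_eq_integral_dom.
Qed.

Lemma ae_eq_Rintegral_dom (D : set T) (f g : T -> R) :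
  {ae mu, forall x, D x -> f x = g x} ->
  \int[mu]_(x in D) f x = \int[mu]_(x in D) g x.
Proof.
move=> fg; rewrite /Rintegral; congr fine; apply: ae_eq_integral_dom.
by apply: filterS fg => x h Dx; rewrite h.
Qed.

End ae_integral.

(** * Boxes, Borel sets and Lebesgue measure on the space of row vectors *)

Section boxes.
Context {R : realType} {n : nat}.
Implicit Types (x y a b : 'rV[R]_n) (A : set 'rV[R]_n).
Local Notation mu := (lebesgue_rV n : {measure set 'rV[R]_n -> \bar R}).

Definition box a b : set 'rV[R]_n :=
  [set x | forall i, a ord0 i < x ord0 i <= b ord0 i].

Definition boxes : set (set 'rV[R]_n) := [set A | exists a b, A = box a b].

Lemma boxI a b a' b' : box a b `&` box a' b' =
  box (\row_i Num.max (a ord0 i) (a' ord0 i))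
      (\row_i Num.min (b ord0 i) (b' ord0 i)).
Proof.
apply/seteqP; split => x /=.
  move=> [h h'] i; rewrite !mxE gt_max le_min.
  by have /andP[-> ->] := h i; have /andP[-> ->] := h' i.
by move=> h; split=> i; have := h i; rewrite !mxE gt_max le_min;
  case/andP => /andP[? ?] /andP[? ?]; apply/andP.
Qed.

Lemma setI_closed_boxes : setI_closed boxes.
Proof. by move=> _ _ [a [b ->]] [a' [b' ->]]; rewrite boxI; do 2 eexists. Qed.

Lemma measurable_box_rV a b : measurable (box a b).
Proof. exact: measurable_box. Qed.

Definition cbox (k : nat) : set 'rV[R]_n := box (const_mx (- k%:R)) (const_mx k%:R).

Lemma bigcup_cbox : \bigcup_k cbox k = setT.
Proof.
apply/seteqP; split => // x _.
pose m := \max_(i < n) (Num.truncn `|x ord0 i|).+1.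
exists m => // i; rewrite !mxE.
have : `|x ord0 i| < m%:R.
  apply: lt_le_trans (truncnS_gt _) _.
  by rewrite ler_nat; apply: (leq_bigmax i).
by rewrite ltr_norml => /andP[-> /ltW].
Qed.

Lemma cbox_nd : {homo cbox : k m / (k <= m)%N >-> k `<=` m}.
Proof.
move=> k m km x h i; have := h i; rewrite !mxE => /andP[h1 h2].
rewrite (le_lt_trans _ h1) ?lerN2 ?ler_nat//=.
by rewrite (le_trans h2)// ler_nat.
Qed.

(** A strip bounded in one coordinate is the increasing union of boxes. *)
Lemma measurable_rV_boxes : @measurable _ 'rV[R]_n = <<s boxes >>.
Proof.
apply/seteqP; split; last first.
  apply: smallest_sub; first exact: sigma_algebra_measurable.
  by move=> _ [a [b ->]]; exact: measurable_box_rV.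
pose T := g_sigma_algebraType boxes.
have mid : measurable_fun [set: T] (fun t : T => (t : 'rV[R]_n)).
  apply: measurable_fun_rV => i; apply: (measurability (@ocitv R)) => //.
  move=> _ [_ [[u v] _ <-] <-]; rewrite setTI.
  have -> : (fun t : T => (t : 'rV[R]_n) ord0 i) @^-1` `]u, v]%classic =
    \bigcup_k (box (\row_j if j == i then u else - k%:R)
                   (\row_j if j == i then v else k%:R) : set T).
    apply/seteqP; split => x /=; last first.
      by move=> [k _ /(_ i)]; rewrite !mxE eqxx in_itv.
    rewrite in_itv/= => xuv; have [k _ hk] : (\bigcup_k cbox k) (x : 'rV[R]_n).
      by rewrite bigcup_cbox.
    exists k => // j; have := hk j; rewrite !mxE.
    by case: eqP => // ->.
  apply: bigcupT_measurable => k; apply: sub_sigma_algebra.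
  by do 2 eexists.
by move=> A mA; have := mid measurableT A mA; rewrite setTI.
Qed.

Lemma mu_box a b : (forall i, a ord0 i <= b ord0 i) ->
  mu (box a b) = (\prod_(i < n) (b ord0 i - a ord0 i))%:E.
Proof. exact: lebesgue_rV_box. Qed.

Lemma measure_box_fin a b : (mu (box a b) < +oo)%E.
Proof.
have [ab|/existsNP[i /negP]] := pselect (forall i, a ord0 i <= b ord0 i).
  by rewrite mu_box// ltry.
rewrite -ltNge => ba; rewrite (_ : box a b = set0) ?measure0//.
by apply/seteqP; split => // x /(_ i) /andP[h1 h2]; move: (lt_le_trans h1 h2); rewrite ltNge (ltW ba).
Qed.

(** Boxes are stable under intersection, generate, and exhaust the space. *)
Lemma measure_eq_boxes (m1 m2 : {measure set 'rV[R]_n -> \bar R}) :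
  (forall a b, m1 (box a b) < +oo)%E ->
  (forall a b, m1 (box a b) = m2 (box a b)) ->
  forall A, measurable A -> m1 A = m2 A.
Proof.
move=> m1f m12 A mA.
have bc i : boxes (cbox i) by do 2 eexists.
apply: (@measure_unique _ R _ boxes cbox measurable_rV_boxes setI_closed_boxes bc bigcup_cbox m1 m2) => //.
- by move=> _ [a [b ->]]; exact: m12.
- by move=> k; exact: m1f.
Qed.

(** The open cubes of the sup norm form a basis, and those with rational centre
    and radius are countably many. *)
Lemma open_measurable_rV A : open A -> measurable A.
Proof.
move=> oA.
pose QI := ('rV[rat]_n * rat)%type.
pose Q (q : QI) : set 'rV[R]_n := 
  [set x | forall i, `|x ord0 i - ratr (q.1 ord0 i)| < ratr q.2].
have mQ q : measurable (Q q).
  have -> : Q q = \bigcap_(i in [set: 'I_n])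
    ((fun x : 'rV[R]_n => x ord0 i) @^-1`
       `](ratr (q.1 ord0 i) - ratr q.2), (ratr (q.1 ord0 i) + ratr q.2)[%classic).
    apply/seteqP; split => x /= h i => [_|].
      by rewrite /= in_itv/=; have := h i; rewrite ltr_distl => /andP[-> ->].
    by have := h i I; rewrite /= in_itv/= ltr_distl.
  apply: fin_bigcap_measurable => // i _.
  by rewrite -[X in measurable X]setTI; exact: measurable_coord_rV.
have -> : A = \bigcup_(q in [set q | Q q `<=` A]) Q q.
  apply/seteqP; split => x; last by case=> q qA; exact: qA.
  move=> Ax; have /nbhs_ballP[e /= e0 eA] := open_nbhs_nbhs (conj oA Ax).
  have [r /=] : exists r : rat, (ratr r : R) \in `]0, (e / 2)[.
    by apply: rat_in_itvoo; rewrite divr_gt0.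
  rewrite in_itv/= => /andP[r0 re].
  have hq i : exists q : rat, (ratr q : R) \in `](x ord0 i - ratr r), (x ord0 i + ratr r)[.
    by apply: rat_in_itvoo; rewrite ltrD2l gt0_cp.
  pose q := (\row_i xchoose (hq i), r) : QI.
  have qE i : `|x ord0 i - ratr (q.1 ord0 i)| < ratr r.
    rewrite mxE; have := xchooseP (hq i).
    by rewrite in_itv/= ltr_distlC.
  exists q => //= y Qy; apply: eA; split => // i j; rewrite ord1.
  rewrite /ball/=; have := Qy j; have := qE j => /= h1 h2.
  rewrite -(subrKA (ratr (q.1 ord0 j))) (le_lt_trans (ler_normD _ _))//.
  rewrite [X in X < _](_ : _ = `|x ord0 j - ratr (q.1 ord0 j)| + `|y ord0 j - ratr (q.1 ord0 j)|); last first.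
    by rewrite (distrC (y ord0 j)).
  by rewrite [ltRHS](splitr e) ltrD// (lt_trans _ re).
have [f] : exists f : nat -> QI, forall q, exists k, f k = q.
  exists (fun k => odflt (0, 0) (unpickle k)) => q; exists (pickle q).
  by rewrite pickleK.
move=> fP.
have -> : \bigcup_(q in [set q | Q q `<=` A]) Q q =
  \bigcup_k (if pselect (Q (f k) `<=` A) then Q (f k) else set0).
  apply/seteqP; split => x.
    move=> [q qA Qx]; have [k kq] := fP q; exists k => //.
    by case: pselect => //; rewrite kq.
  by move=> [k _]; case: pselect => // qA Qx; exists (f k).
apply: bigcupT_measurable => k.
by case: (pselect _) => h; [exact: mQ|exact: measurable0].
Qed.

Lemma continuous_measurable_rV (f : 'rV[R]_n -> R) :
  continuous f -> measurable_fun setT f.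
Proof.
move=> /continuousP cf; apply: (measurability (@RGenOpens.G R)).
  exact: RGenOpens.measurableE.
move=> _ [_ [a [b ->] <-]]; rewrite setTI.
by apply: open_measurable_rV; apply: cf; exact: interval_open.
Qed.

End boxes.

(** * Sup-norm cubes, Euclidean balls and affine changes of variables *)

Section geometry.
Context {R : realType} {n : nat}.
Implicit Types (x y c : 'rV[R]_n) (A : set 'rV[R]_n).
Local Notation mu := (lebesgue_rV n : {measure set 'rV[R]_n -> \bar R}).

Lemma coord_le_norm x i : `|x ord0 i| <= `|x|.
Proof.
rewrite [leRHS]/Num.norm/= mx_normrE; apply/bigmax_geP; right.
by exists (ord0, i).
Qed.

Lemma rV_norm_lt x e : 0 < e -> (`|x| < e) <-> (forall i, `|x ord0 i| < e).
Proof.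
move=> e0; split=> [xe i|xe]; first exact: le_lt_trans (coord_le_norm _ _) xe.
rewrite [ltLHS]/Num.norm/= mx_normrE; apply/bigmax_ltP; split => // -[i j] _ /=.
by rewrite ord1.
Qed.

Lemma rV_norm_le x e : 0 <= e -> (`|x| <= e) <-> (forall i, `|x ord0 i| <= e).
Proof.
move=> e0; split=> [xe i|xe]; first exact: le_trans (coord_le_norm _ _) xe.
rewrite [leLHS]/Num.norm/= mx_normrE; apply/bigmax_leP; split => // -[i j] _ /=.
by rewrite ord1.
Qed.

Lemma ball_rV x e y : ball x e y <-> `|x - y| < e.
Proof. by rewrite -ball_normE. Qed.

Lemma enorm_ge0 x : 0 <= enorm x.
Proof. exact: sqrtr_ge0. Qed.

Lemma norm_le_enorm x : `|x| <= enorm x.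
Proof.
apply/rV_norm_le; first exact: enorm_ge0.
move=> i; rewrite -sqrtr_sqr ler_wsqrtr// (bigD1 i)//= lerDl.
by apply: sumr_ge0 => j _; exact: sqr_ge0.
Qed.

Lemma enorm_le_norm x : enorm x <= n%:R * `|x|.
Proof.
rewrite -[leRHS]ger0_norm ?mulr_ge0// -sqrtr_sqr ler_wsqrtr//.
apply: (@le_trans _ _ (\sum_(i < n) `|x| ^+ 2)).
  apply: ler_sum => i _; rewrite -real_normK ?num_real// ler_sqr ?nnegrE//.
  exact: coord_le_norm.
rewrite sumr_const card_ord exprMn -[leLHS]mulr_natl ler_wpM2r ?sqr_ge0//.
by rewrite -natrX ler_nat -mulnn; case: (n) => // m; exact: leq_pmull.
Qed.

Lemma enormZ a x : enorm (a *: x) = `|a| * enorm x.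
Proof.
rewrite /enorm -sqrtr_sqr -sqrtrM ?sqr_ge0// mulr_sumr; congr Num.sqrt.
by apply: eq_bigr => i _; rewrite mxE exprMn.
Qed.

Lemma enormN x : enorm (- x) = enorm x.
Proof. by rewrite -scaleN1r enormZ normrN1 mul1r. Qed.

Lemma enorm0 : enorm (0 : 'rV[R]_n) = 0.
Proof. by rewrite -(scale0r 0) enormZ normr0 mul0r. Qed.

Lemma measurable_enorm : measurable_fun setT (@enorm R n).
Proof.
rewrite /enorm; apply: (measurableT_comp (continuous_measurable_fun (@sqrt_continuous R))).
apply: measurable_sum => i; apply: measurable_funX.
exact: measurable_coord_rV.
Qed.

Lemma measurable_ball_rV x (e : R) : measurable (ball x e).
Proof. by apply: open_measurable_rV; exact: ball_open. Qed.

Lemma measurable_affine (e : R) c : measurable_fun setT (fun x => e *: x + c).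
Proof.
apply: measurable_fun_rV => i.
rewrite (_ : (fun t => _) = fun t : 'rV[R]_n => e * t ord0 i + c ord0 i); last first.
  by apply/funext => t; rewrite !mxE.
by apply: measurable_funD => //; apply: measurable_funM => //; exact: measurable_coord_rV.
Qed.

Lemma measurable_subr_rV :
  measurable_fun setT (fun z : 'rV[R]_n * 'rV[R]_n => z.1 - z.2).
Proof.
apply: measurable_fun_rV => i.
rewrite (_ : (fun t => _) = fun t : 'rV[R]_n * 'rV[R]_n => t.1 ord0 i - t.2 ord0 i); last first.
  by apply/funext => t; rewrite !mxE.
by apply: measurable_funB => //;
   apply: (measurableT_comp (measurable_coord_rV i)).
Qed.

Lemma measurable_eball c (r : R) : measurable (eball c r).
Proof.
have -> : eball c r = (enorm \o (fun x => 1 *: x + - c)) @^-1` `]-oo, r[%classic.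
  by apply/seteqP; split => x; rewrite /eball /= in_itv/= scale1r.
rewrite -[X in measurable X]setTI.
apply: (measurableT_comp measurable_enorm (measurable_affine 1 (- c))) => //.
Qed.

Lemma affine_preimage_box (e : R) c a b : 0 < e ->
  (fun x => e *: x + c) @^-1` (box a b) = box (e^-1 *: (a - c)) (e^-1 *: (b - c)).
Proof.
move=> e0; apply/seteqP; split => x /= h i; have := h i; rewrite !mxE;
  by rewrite ltr_pdivrMl// ler_pdivlMl// ltrBlDr lerBrDr.
Qed.

Lemma mu_affine_box (e : R) c a b : 0 < e ->
  ((e ^+ n)%:E * mu ((fun x => (e *: x + c)%R) @^-1` (box a b)))%E = mu (box a b).
Proof.
move=> e0; rewrite affine_preimage_box//.
have [ab|/existsNP[i /negP]] := pselect (forall i, a ord0 i <= b ord0 i).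
  rewrite !mu_box//; last first.
    by move=> i; rewrite !mxE ler_pM2l ?invr_gt0// lerD2r.
  rewrite -EFinM -[in e ^+ n](card_ord n) -prodr_const -big_split/=.
  congr (_%:E); apply: eq_bigr => i _; rewrite !mxE -mulrBr mulrA divff ?gt_eqF//.
  by rewrite mul1r opprD addrACA subrr addr0.
rewrite -ltNge => ba.
have box0 (u v : 'rV[R]_n) : v ord0 i < u ord0 i -> box u v = set0.
  move=> vu; apply/seteqP; split => // x /(_ i) /andP[h1 h2].
  by move: (lt_le_trans h1 h2); rewrite ltNge (ltW vu).
rewrite !box0 ?measure0 ?mule0//.
by rewrite !mxE ltr_pM2l ?invr_gt0// ltrD2r.
Qed.

(** Both sides are measures that agree on boxes. *)
Lemma mu_affine (e : R) c A : 0 < e -> measurable A ->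
  ((e ^+ n)%:E * mu ((fun x => (e *: x + c)%R) @^-1` A))%E = mu A.
Proof.
move=> e0 mA.
have en0 : 0 <= e ^+ n by rewrite exprn_ge0// ltW.
pose m' := mscale (NngNum en0)
  (pushforward mu (fun x => e *: x + c)).
pose mP := (measure_function_pushforward__canonical__measure_function_Measure
  mu (measurable_affine e c)).
have h := @measure_eq_boxes R n mu (mscale (NngNum en0) mP).
rewrite [RHS](h _ _ A mA).
- by [].
- by move=> a b; exact: measure_box_fin.
- by move=> a b; rewrite -(mu_affine_box c a b e0).
Qed.

Lemma ge0_integral_affine (e : R) c (f : 'rV[R]_n -> \bar R) : 0 < e ->
  measurable_fun setT f -> (forall x, 0 <= f x)%E ->
  (\int[mu]_x f x = (e ^+ n)%:E * \int[mu]_x f (e *: x + c)%R)%E.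
Proof.
move=> e0 mf f0.
have en0 : 0 <= e ^+ n by rewrite exprn_ge0// ltW.
pose mP := (measure_function_pushforward__canonical__measure_function_Measure
  mu (measurable_affine e c)).
rewrite (eq_measure_integral (mscale (NngNum en0) mP)); last first.
  by move=> A mA _; rewrite -(mu_affine c e0 mA).
rewrite ge0_integral_mscale//=.
by rewrite (ge0_integral_pushforward (measurable_affine e c))// preimage_setT.
Qed.

Lemma integral_shift c (f : 'rV[R]_n -> \bar R) :
  measurable_fun setT f ->
  (\int[mu]_x f x = \int[mu]_x f (x + c)%R)%E.
Proof.
move=> mf; rewrite integralE [RHS]integralE.
rewrite (ge0_integral_affine c (@ltr01 R))//; last exact: measurable_funepos.
rewrite [X in (_ - X)%E](ge0_integral_affine c (@ltr01 R))//; last exact: measurable_funeneg.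
rewrite expr1n !mul1e.
congr (_ - _)%E; apply: eq_integral => x _.
  by rewrite !funeposE scale1r.
by rewrite !funenegE scale1r.
Qed.

Lemma Rintegral_shift c (f : 'rV[R]_n -> R) : measurable_fun setT f ->
  \int[mu]_x f x = \int[mu]_x f (x + c).
Proof.
move=> mf; rewrite /Rintegral; congr fine.
by rewrite (integral_shift c)//; exact/measurable_EFinP.
Qed.

Lemma ball_sub_box x (r : R) : ball x r `<=` box (x - const_mx r) (x + const_mx r).
Proof.
move=> y /ball_rV xy i; rewrite !mxE.
have := le_lt_trans (coord_le_norm _ i) xy; rewrite !mxE ltr_norml => /andP[].
by lra.
Qed.

Lemma mu_ball_le x (r : R) : 0 <= r -> (mu (ball x r) <= ((2 * r) ^+ n)%:E)%E.
Proof.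
move=> r0.
apply: (@le_trans _ _ (mu (box (x - const_mx r) (x + const_mx r)))).
  apply: le_measure; rewrite ?inE//; first exact: measurable_ball_rV.
    exact: measurable_box_rV.
  exact: ball_sub_box.
rewrite mu_box; last by move=> i; rewrite !mxE; lra.
rewrite lee_fin -[X in _ <= _ ^+ X](card_ord n) -prodr_const.
by apply: ler_prod => i _; rewrite !mxE; lra.
Qed.

Lemma ball_fin x (r : R) : (mu (ball x r) < +oo)%E.
Proof.
have [r0|r0] := leP 0 r; first by rewrite (le_lt_trans (mu_ball_le _ r0))// ltry.
rewrite (_ : ball x r = set0) ?measure0//.
by apply/seteqP; split => // y /ball_rV; rewrite ltNge (le_trans (ltW r0)).
Qed.

Lemma eball_sub_ball c (r : R) : eball c r `<=` ball c r.
Proof.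
move=> y; rewrite /eball/= => h; apply/ball_rV; rewrite distrC.
exact: le_lt_trans (norm_le_enorm _) h.
Qed.

Lemma mu_eball_le c (r : R) : 0 <= r -> (mu (eball c r) <= ((2 * r) ^+ n)%:E)%E.
Proof.
move=> r0; apply: le_trans (mu_ball_le c r0).
apply: le_measure; rewrite ?inE; [exact: measurable_eball|exact: measurable_ball_rV|].
exact: eball_sub_ball.
Qed.

Lemma ball_sub_eball c (r s : R) : 0 < s -> n%:R * r <= s ->
  ball c r `<=` eball c s.
Proof.
move=> s0 rs y /ball_rV yr; rewrite /eball/=.
apply: (le_lt_trans (enorm_le_norm (y - c))); rewrite distrC.
have [n0|n0] := posnP n; first by rewrite [X in X%:R * _]n0 mul0r.
by apply: lt_le_trans rs; rewrite ltr_pM2l// ltr0n.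
Qed.

Lemma mu_eball_gt0 c (r : R) : 0 < r -> (0 < mu (eball c r))%E.
Proof.
move=> r0; pose s := r / (n.+1)%:R.
have s0 : 0 < s by rewrite divr_gt0.
pose h := s / 2.
have h0 : 0 < h by rewrite divr_gt0.
apply: (@lt_le_trans _ _ (mu (box (c - const_mx h) (c + const_mx h)))).
  rewrite mu_box; last by move=> i; rewrite !mxE; lra.
  by rewrite lte_fin prodr_gt0// => i _; rewrite !mxE; lra.
apply: le_measure; rewrite ?inE; [exact: measurable_box_rV|exact: measurable_eball|].
apply: (subset_trans _ (@ball_sub_eball c s r r0 _)).
  move=> y hy; apply/ball_rV; apply/rV_norm_lt => // i.
  by have := hy i; rewrite !mxE ltr_norml /h; lra.
by rewrite /s mulrCA ger_pMr// ler_pdivrMr// mul1r ler_nat.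
Qed.

Lemma compact_sub_ball A : compact A -> exists2 r : R, 0 < r & A `<=` ball 0 r.
Proof.
move=> /compact_bounded [M [_ hM]]; exists (`|M| + 2); first by rewrite ltr_wpDl.
move=> x Ax; apply/ball_rV; rewrite sub0r normrN.
apply: (@le_lt_trans _ _ (`|M| + 1)); last by rewrite ltrD2l ltr1n.
by apply: hM => //; rewrite (le_lt_trans (ler_norm _))// ltrDl.
Qed.

Lemma compact_closed_ball0 (r : R) : compact [set x : 'rV[R]_n | `|x| <= r].
Proof.
apply: bounded_closed_compact.
  by exists r; split; [exact: num_real|move=> M rM x /= xr; rewrite (le_trans xr)// ltW].
have -> : [set x : 'rV[R]_n | `|x| <= r] = (fun x : 'rV[R]_n => `|x|) @^-1` [set y | y <= r] by [].
by apply: closed_comp; [move=> x _; exact: norm_continuous|exact: closed_le].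
Qed.

(** Inside a bounded box a hyperplane is covered by arbitrarily thin boxes. *)
Lemma mu_hyperplane i (s : R) : mu [set x | x ord0 i = s] = 0%E.
Proof.
pose H k := [set x : 'rV[R]_n | x ord0 i = s] `&` cbox k.
have mH k : measurable (H k).
  apply: measurableI; last exact: measurable_box_rV.
  rewrite [X in measurable X](_ : _ = (fun x : 'rV[R]_n => x ord0 i) @^-1` [set s])//.
  by rewrite -[X in measurable X]setTI; apply: measurable_coord_rV.
suff : mu (\bigcup_k H k) = 0%E by rewrite /H -setI_bigcupr bigcup_cbox setIT.
apply: measure_negligible; first exact: bigcupT_measurable.
apply: negligible_bigcup => k; exists (H k); split => //.
apply/eqP; rewrite eq_le measure_ge0 andbT.
pose K := \prod_(j < n | j != i) (2 * k%:R : R).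
have K0 : 0 <= K by apply: prodr_ge0 => j _; rewrite mulr_ge0.
suff h (d : R) : 0 < d -> (mu (H k) <= (d * K)%:E)%E.
  apply/lee_addgt0Pr => e e0; rewrite add0e.
  apply: (le_trans (h (e / (K + 1)) _)); first by rewrite divr_gt0// ltr_wpDl.
  by rewrite lee_fin mulrAC ler_pdivrMr ?ltr_wpDl// ler_pM2l// lerDl.
move=> d0.
pose a := \row_j (if j == i then s - d else - k%:R) : 'rV[R]_n.
pose b := \row_j (if j == i then s else k%:R) : 'rV[R]_n.
apply: (@le_trans _ _ (mu (box a b))).
  apply: le_measure; rewrite ?inE//; first exact: measurable_box_rV.
  move=> x [/= xs xk] j; rewrite !mxE; case: eqP => [->|_].
    by rewrite xs lexx andbT gtrBl.
  by have := xk j; rewrite !mxE.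
rewrite mu_box; last first.
  move=> j; rewrite !mxE; case: eqP => _; first by rewrite gerBl ltW.
  by apply: (@le_trans _ _ 0); rewrite ?oppr_le0.
rewrite lee_fin (bigD1 i)//= !mxE eqxx opprB addrCA subrr addr0.
rewrite (eq_bigr (fun=> 2 * k%:R)) => [//|j ji]; rewrite !mxE (negbTE ji).
by rewrite opprK mulr_natl mulr2n.
Qed.

End geometry.

(** * Consequences of log-Hoelder continuity *)

Section real_powers.
Context {R : realType}.
Implicit Types (a b c t w q x y z : R).

(** Young's inequality without the sharp constant: compare [a] with the value
    at which the two terms on the right balance. *)
Lemma le_powR_weight a w q : 0 <= a -> 0 < w -> 1 < q ->
  a <= a `^ q * w + w `^ (- (q - 1)^-1).
Proof.
move=> a0 w0 q1; have q10 : 0 < q - 1 by rewrite subr_gt0.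
have [ale|agt] := leP a (w `^ (- (q - 1)^-1)).
  by rewrite (le_trans ale)// lerDr mulr_ge0 ?powR_ge0 ?ltW.
have apos : 0 < a by apply: le_lt_trans agt; exact: powR_ge0.
suff h : 1 <= a `^ (q - 1) * w.
  rewrite -(mulr_powRB1 a0 (lt_trans ltr01 q1)) -mulrA.
  by apply: (@le_trans _ _ (a * (a `^ (q - 1) * w))); rewrite ?ler_peMr// lerDl powR_ge0.
have /(ge0_ler_powR (ltW q10)) : w `^ (- (q - 1)^-1) <= a by exact: ltW.
rewrite !nnegrE powR_ge0 => /(_ isT a0).
rewrite -powRrM mulNr mulVf ?gt_eqF// powR_inv1; last exact: ltW.
move=> h.
by rewrite -(@ler_pdivrMr _ w)// div1r.
Qed.

Lemma powR_le_expR t z x c : 0 < t -> `|x| * `|ln t| <= c -> t `^ x <= expR c.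
Proof.
move=> t0 h; rewrite /powR gt_eqF// ler_expR (le_trans _ h)//.
by rewrite -normrM ler_norm.
Qed.

Lemma ln_norm_le t a c w : 0 <= a -> 1 <= c -> 1 <= w ->
  (c * w `^ a)^-1 <= t -> t <= c * w `^ a -> `|ln t| <= ln c + a * ln w.
Proof.
move=> a0 c1 w1 h1 h2.
have c0 : 0 < c by exact: lt_le_trans c1.
have w0 : 0 < w by exact: lt_le_trans w1.
have cw0 : 0 < c * w `^ a by rewrite mulr_gt0// powR_gt0.
have t0 : 0 < t by rewrite (lt_le_trans _ h1)// invr_gt0.
have lE : ln (c * w `^ a) = ln c + a * ln w.
  by rewrite lnM ?posrE ?powR_gt0// ln_powR.
rewrite -lE ler_norml; apply/andP; split.
  by rewrite -lnV ?posrE// ler_ln ?posrE ?invr_gt0.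
by rewrite ler_ln ?posrE.
Qed.

Lemma powR_add_le (a b q P : R) : 0 <= a -> 0 <= b -> 0 <= q -> q <= P ->
  (a + b) `^ q <= 2 `^ P * (a `^ q + b `^ q).
Proof.
move=> a0 b0 q0 qP.
wlog ab : a b a0 b0 / a <= b.
  move=> H; have [ab|/ltW ba] := leP a b; first exact: H.
  by rewrite addrC [X in _ * X]addrC; exact: H.
apply: (@le_trans _ _ ((2 * b) `^ q)).
  by rewrite ge0_ler_powR ?nnegrE ?addr_ge0 ?mulr_ge0//; lra.
rewrite powRM//; apply: ler_pM; rewrite ?powR_ge0//.
  by rewrite ler_powR// ler1n.
by rewrite lerDr powR_ge0.
Qed.

End real_powers.

Lemma continuous_rVP {R : realType} {n : nat} (f : 'rV[R]_n -> R) :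
  (forall x e, 0 < e -> exists2 d, 0 < d &
     forall y, `|x - y| < d -> `|f x - f y| < e) <-> continuous f.
Proof.
split=> [h x V /nbhs_ballP[e /= e0 eV]|h x e e0].
  have [d d0 hd] := h x e e0; apply/nbhs_ballP; exists d => // y /ball_rV xy.
  by apply: eV; rewrite -ball_normE; exact: hd.
have /nbhs_ballP[d /= d0 hd] := h x _ (nbhsx_ballx (f x) e e0).
exists d => // y xy; have : ball (f x) e (f y) by apply: hd; apply/ball_rV.
by rewrite -ball_normE.
Qed.

Section log_holder.
Context {R : realType} {n : nat} (p : 'rV[R]_n -> R) (C pinf : R).
Hypothesis C0 : 0 < C.
Hypothesis hp1 : forall x y, `|p x - p y| <= C / ln (expR 1 + (enorm (x - y))^-1).
Hypothesis hp2 : forall x, `|p x - pinf| <= C / ln (expR 1 + enorm x).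

Lemma expR1_ge2 : 2 <= expR 1 :> R.
Proof. by have := expR_ge1Dx (1 : R); lra. Qed.

Lemma ln_expR1D_ge1 (t : R) : 0 <= t -> 1 <= ln (expR 1 + t).
Proof.
move=> t0; rewrite -[leLHS](expRK 1) ler_ln ?posrE ?expR_gt0//.
  by rewrite lerDl.
by rewrite ltr_wpDr// expR_gt0.
Qed.

Lemma log_holder_bounded x : p x <= pinf + C.
Proof.
rewrite -lerBlDl (le_trans (ler_norm _))// (le_trans (hp2 x))//.
have L1 := ln_expR1D_ge1 (enorm_ge0 x).
by rewrite ler_pdivrMr ?(lt_le_trans _ L1)// ler_peMr// ltW.
Qed.

Lemma log_holder_continuous : continuous p.
Proof.
apply/continuous_rVP => x e e0.
pose d := expR (- (C / e)) / (n.+1)%:R.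
have d0 : 0 < d by rewrite divr_gt0 ?expR_gt0.
exists d => // y xy.
have [->|xny] := eqVneq x y; first by rewrite subrr normr0.
have q0 : 0 < enorm (x - y).
  by rewrite (lt_le_trans _ (norm_le_enorm _))// normr_gt0 subr_eq0.
have qd : enorm (x - y) < expR (- (C / e)).
  apply: (le_lt_trans (enorm_le_norm _)).
  apply: (@le_lt_trans _ _ ((n.+1)%:R * `|x - y|)).
    by rewrite ler_wpM2r// ler_nat.
  by rewrite mulrC -ltr_pdivlMr.
apply: (le_lt_trans (hp1 x y)).
set L := ln _.
have L1 : 1 <= L by rewrite ln_expR1D_ge1// invr_ge0 ltW.
rewrite ltr_pdivrMr; last exact: lt_le_trans L1.
rewrite mulrC -ltr_pdivrMr// -(expRK (C / e)) ltr_ln ?posrE ?expR_gt0//.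
  rewrite ltr_pwDl ?expR_gt0// -[leLHS]invrK -expRN.
  by rewrite lef_pV2 ?posrE ?expR_gt0// ltW.
by rewrite ltr_wpDr ?expR_gt0// invr_ge0 ltW.
Qed.

(** Inside a cube of side at most comparable with [e], the oscillation of [p]
    beats the logarithm of every power of [(2 + |x|) / e]: the local condition
    handles [1 / e] and the decay condition handles [2 + |x|]. *)
Lemma log_holder_osc : exists2 K0 : R, 0 <= K0 &
  forall x y e, 0 < e -> e <= 1 -> `|x - y| <= n%:R * e ->
    `|p x - p y| * ln ((2 + `|x|) / e) <= K0.
Proof.
pose K1 := C * (2 + n%:R); pose K2 := C * (1 + n%:R * n%:R).
have n0 : 0 <= n%:R :> R by [].
have nn : 0 <= n%:R * n%:R :> R by exact: mulr_ge0.
have K10 : 0 <= K1 by rewrite mulr_ge0 ?(ltW C0)//; lra.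
have K20 : 0 <= K2 by rewrite mulr_ge0 ?(ltW C0)//; lra.
exists (K1 + K2); first exact: addr_ge0.
move=> x y e e0 e1 xy.
have x20 : 0 < 2 + `|x| by rewrite ltr_wpDr.
rewrite lnM ?posrE ?invr_gt0// mulrDr; apply: lerD.
  have L0 (z : 'rV[R]_n) : 0 < ln (expR 1 + enorm z).
    exact: lt_le_trans (ln_expR1D_ge1 (enorm_ge0 z)).
  have lx0 : 0 <= ln (2 + `|x|) by rewrite ln_ge0//; have := normr_ge0 x; lra.
  have h1 : ln (2 + `|x|) <= ln (expR 1 + enorm x).
    rewrite ler_ln ?posrE//; first by rewrite lerD ?expR1_ge2 ?norm_le_enorm.
    by rewrite ltr_wpDr ?enorm_ge0 ?expR_gt0.
  have h2 : ln (2 + `|x|) <= (1 + n%:R) * ln (expR 1 + enorm y).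
    have xy' : `|x| <= `|y| + n%:R.
      rewrite -[X in `|X|](subrK y) addrC (le_trans (ler_normD _ _))// lerD2l.
      by rewrite (le_trans xy)// ler_piMr.
    have ey : 0 < expR 1 + enorm y by rewrite ltr_wpDr ?enorm_ge0 ?expR_gt0.
    have n10 : 0 < 1 + n%:R :> R by rewrite ltr_wpDr.
    apply: (@le_trans _ _ (ln ((1 + n%:R) * (expR 1 + enorm y)))).
      rewrite ler_ln ?posrE ?mulr_gt0//.
      have := expR1_ge2; have := norm_le_enorm y; have := enorm_ge0 y => hy0 hy hE.
      rewrite mulrDl mul1r.
      have : n%:R * 1 <= n%:R * (expR 1 + enorm y) by rewrite ler_wpM2l//; lra.
      by lra.
    rewrite lnM ?posrE// mulrDl mul1r addrC lerD2l.
    have hn : ln (1 + n%:R) <= n%:R :> R by rewrite le_ln1Dx// (lt_le_trans _ n0)// ltrN10.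
    by rewrite (le_trans hn)// ler_peMr// ln_expR1D_ge1// enorm_ge0.
  apply: (@le_trans _ _ ((C / ln (expR 1 + enorm x) + C / ln (expR 1 + enorm y)) * ln (2 + `|x|))).
    rewrite ler_wpM2r// (le_trans _ (lerD (hp2 x) (hp2 y)))//.
    by rewrite (distrC (p y)) -(subrKA pinf) ler_normD.
  rewrite mulrDl /K1 [X in _ <= C * X](_ : _ = 1 + (1 + n%:R)); last by lra.
  rewrite mulrDr; apply: lerD; rewrite -mulrA ler_pM2l//.
    by rewrite mulrC ler_pdivrMr// mul1r.
  by rewrite mulrC ler_pdivrMr.
have le0 : 0 <= ln e^-1 by rewrite ln_ge0// invf_ge1.
have [xy0|xyn] := eqVneq x y.
  by rewrite xy0 subrr normr0 mul0r.
have d0 : 0 < enorm (x - y).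
  by rewrite (lt_le_trans _ (norm_le_enorm _))// normr_gt0 subr_eq0.
set d := enorm (x - y) in d0 *.
have L0 : 1 <= ln (expR 1 + d^-1) by rewrite ln_expR1D_ge1// invr_ge0 ltW.
have h : ln e^-1 <= (1 + n%:R * n%:R) * ln (expR 1 + d^-1).
  have hd : d <= n%:R * n%:R * e.
    by rewrite (le_trans (enorm_le_norm _))// -mulrA ler_wpM2l.
  have E0 : 0 < expR 1 + d^-1 by rewrite ltr_wpDr ?expR_gt0// invr_ge0 ltW.
  have nn0 : 0 < 1 + n%:R * n%:R :> R by rewrite ltr_wpDr// mulr_ge0.
  apply: (@le_trans _ _ (ln ((1 + n%:R * n%:R) * (expR 1 + d^-1)))).
    rewrite ler_ln ?posrE ?invr_gt0 ?mulr_gt0//.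
    apply: (@le_trans _ _ ((1 + n%:R * n%:R) * d^-1)).
      rewrite ler_pdivlMr// mulrC ler_pdivrMr// (le_trans hd)//.
      by rewrite ler_pM2r// lerDr.
    by rewrite ler_pM2l// lerDr expR_ge0.
  rewrite lnM ?posrE// mulrDl mul1r addrC lerD2l.
  have hn : ln (1 + n%:R * n%:R) <= n%:R * n%:R :> R.
    by rewrite le_ln1Dx// (lt_le_trans _ nn)// ltrN10.
  by rewrite (le_trans hn)// ler_peMr// mulr_ge0.
apply: (@le_trans _ _ (C / ln (expR 1 + d^-1) * ln e^-1)).
  by rewrite ler_wpM2r// hp1.
rewrite -mulrA /K2 ler_pM2l// mulrC ler_pdivrMr//.
exact: lt_le_trans L0.
Qed.

End log_holder.

(** * Variable powers and mean exponents *)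

Section measurable_powers.
Context d (T : measurableType d) (R : realType).
Implicit Types f g : T -> R.

Lemma measurable_fun_powR2 f g : measurable_fun setT f -> measurable_fun setT g ->
  measurable_fun setT (fun x => f x `^ g x).
Proof.
move=> mf mg; rewrite /powR.
apply: measurable_fun_ifT.
- by apply: measurable_fun_eqr => //; exact: measurable_cst.
- rewrite (_ : (fun _ => _) = fun x => if g x == 0 then 1 else 0 : R); last first.
    by apply/funext => x; case: (g x == 0).
  apply: measurable_fun_ifT; [|exact: measurable_cst|exact: measurable_cst].
  by apply: measurable_fun_eqr => //; exact: measurable_cst.
- apply: measurableT_comp => //; apply: measurable_funM => //.
  by apply: measurableT_comp => //; exact: measurable_ln.
Qed.

Lemma measurable_fun_inv_pos f : (forall x, 0 <= f x) ->
  measurable_fun setT f -> measurable_fun setT (fun x => (f x)^-1).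
Proof.
move=> f0 mf; rewrite (_ : (fun _ => _) = fun x => f x `^ (cst (-1) x)).
  by apply: measurable_fun_powR2 => //; exact: measurable_cst.
by apply/funext => x; rewrite powR_inv1.
Qed.

End measurable_powers.

Section mean_exponent.
Context {R : realType} {n : nat} (p : 'rV[R]_n -> R).
Local Notation mu := (lebesgue_rV n : {measure set 'rV[R]_n -> \bar R}).

Lemma mean_exponent_bounds (B : set 'rV[R]_n) (a b : R) : measurable B ->
  (0 < mu B)%E -> (mu B < +oo)%E -> 0 < a ->
  (forall x, B x -> a <= p x <= b) -> a <= mean_exponent p B <= b.
Proof.
move=> mB B0 Boo a0 pab.
have [x0 Bx0] : B !=set0.
  apply/set0P/negP => /eqP B00; move: B0; rewrite B00 measure0 ltxx//.
have b0 : 0 < b by have /andP[h1 h2] := pab _ Bx0; lra.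
have muE : mu B = (fine (mu B))%:E by rewrite fineK// ge0_fin_numE.
set m := fine (mu B) in muE.
have m0 : 0 < m by rewrite -lte_fin -muE.
rewrite /mean_exponent -/m /Rintegral.
set J := (\int[mu]_(x in B) _)%E.
have J1 : (J <= (a^-1 * m)%:E)%E.
  rewrite EFinM -muE -(integral_cst mu mB).
  apply: ge0_le_integral_nomeas => x Bx; have /andP[h1 h2] := pab _ Bx.
    by rewrite lee_fin invr_ge0; lra.
  by rewrite lee_fin lef_pV2 ?posrE//; lra.
have J2 : ((b^-1 * m)%:E <= J)%E.
  rewrite EFinM -muE -(integral_cst mu mB).
  apply: ge0_le_integral_nomeas => x Bx; have /andP[h1 h2] := pab _ Bx.
    by rewrite lee_fin invr_ge0; lra.
  by rewrite lee_fin lef_pV2 ?posrE//; lra.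
have Jfin : J \is a fin_num.
  rewrite ge0_fin_numE; first by rewrite (le_lt_trans J1)// ltry.
  by rewrite (le_trans _ J2)// lee_fin mulr_ge0 ?invr_ge0 ?ltW.
move: J1 J2; rewrite -(fineK Jfin) !lee_fin => J1 J2.
have J0 : 0 < fine J by rewrite (lt_le_trans _ J2)// mulr_gt0// invr_gt0.
apply/andP; split.
  rewrite -[leLHS]invrK lef_pV2 ?posrE ?invr_gt0// ?mulr_gt0 ?invr_gt0//.
  by rewrite ler_pdivrMl// mulrC.
rewrite -[leRHS]invrK lef_pV2 ?posrE ?invr_gt0// ?mulr_gt0 ?invr_gt0//.
by rewrite ler_pdivlMl// mulrC.
Qed.

End mean_exponent.

(** * Consequences of the Muckenhoupt condition *)

(** The standing assumptions on the exponent and on a Borel version of the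
    weight. The constant [K0] is the one of [log_holder_osc]. *)
Record regular_weight {R : realType} {n : nat} (p th : 'rV[R]_n -> R)
    (pm pp K0 : R) : Prop := RegularWeight {
  rw_n0 : (0 < n)%N;
  rw_pm1 : 1 < pm;
  rw_p_ge : forall x, pm <= p x;
  rw_p_le : forall x, p x <= pp;
  rw_mp : measurable_fun setT p;
  rw_mth : measurable_fun setT th;
  rw_th0 : forall x, 0 < th x;
  rw_th_loc : forall r, (\int[lebesgue_rV n]_(x in ball 0%R r) (th x)%:E < +oo)%E;
  rw_sig_loc : forall r,
    (\int[lebesgue_rV n]_(x in ball 0%R r) (th x `^ (- (p x - 1)^-1))%:E < +oo)%E;
  rw_K00 : 0 <= K0;
  rw_hosc : forall x y e, 0 < e -> e <= 1 -> `|x - y| <= n%:R * e ->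
    `|p x - p y| * ln ((2 + `|x|) / e) <= K0;
  rw_hA : muckenhoupt p th
}.

Section muckenhoupt_growth.
Context {R : realType} {n : nat} (p th : 'rV[R]_n -> R) (pm pp K0 : R).
Local Notation mu := (lebesgue_rV n : {measure set 'rV[R]_n -> \bar R}).
Hypothesis hw : regular_weight p th pm pp K0.
Let n0 := rw_n0 hw.
Let pm1 := rw_pm1 hw.
Let p_ge := rw_p_ge hw.
Let p_le := rw_p_le hw.
Let mp := rw_mp hw.
Let mth := rw_mth hw.
Let th0 := rw_th0 hw.
Let th_loc := rw_th_loc hw.
Let sig_loc := rw_sig_loc hw.
Let K00 := rw_K00 hw.
Let hA := rw_hA hw.

Let pp1 : 1 < pp. Proof. by rewrite (lt_le_trans pm1)// (le_trans (p_ge 0)). Qed.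
Let p1 x : 1 < p x. Proof. exact: lt_le_trans (p_ge x). Qed.

(** [admissible B l] says that [l] is at least the norm of [1 / th] in the
    exponent [p' / p] on [B]. *)
Definition admissible (B : set 'rV[R]_n) (l : R) : Prop :=
  0 < l /\ (\int[mu]_(x in B) ((l * th x) `^ (- (p x - 1)^-1))%:E <= 1)%E.

Lemma measurable_neg_exponent :
  measurable_fun setT (fun x => - (p x - 1)^-1).
Proof.
apply: measurableT_comp => //; apply: measurable_fun_inv_pos.
  by move=> x; rewrite subr_ge0 ltW.
by apply: measurable_funB => //; exact: measurable_cst.
Qed.

Lemma measurable_dual_weight l :
  measurable_fun setT (fun x => (l * th x) `^ (- (p x - 1)^-1)).
Proof.
apply: measurable_fun_powR2; last exact: measurable_neg_exponent.
by apply: measurable_funM => //; exact: measurable_cst.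
Qed.

Lemma admissible_sub B B' l : measurable B -> measurable B' -> B `<=` B' ->
  admissible B' l -> admissible B l.
Proof.
move=> mB mB' BB' [l0 h]; split=> //; apply: le_trans h.
apply: ge0_subset_integral => //.
- by apply/measurable_EFinP; apply: measurable_funTS; exact: measurable_dual_weight.
- by move=> x _; rewrite lee_fin powR_ge0.
Qed.

Lemma ball_sub_ball0 (x : 'rV[R]_n) (r : R) : ball x r `<=` ball 0 (`|x| + r).
Proof.
move=> y /ball_rV xy; apply/ball_rV; rewrite sub0r normrN.
rewrite -(subrK x y) addrC (le_lt_trans (ler_normD _ _))// ltrD2l//.
by rewrite distrC.
Qed.

Lemma th_bounded (B : set 'rV[R]_n) r : measurable B -> B `<=` ball 0 r ->
  (\int[mu]_(x in B) (th x)%:E < +oo)%E.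
Proof.
move=> mB Br; apply: le_lt_trans (th_loc r).
apply: ge0_subset_integral => //.
- exact: measurable_ball_rV.
- by apply/measurable_EFinP; exact: measurable_funTS.
- by move=> x _; rewrite lee_fin ltW.
Qed.

Lemma th_pos (B : set 'rV[R]_n) : measurable B -> (0 < mu B)%E ->
  (0 < \int[mu]_(x in B) (th x)%:E)%E.
Proof.
move=> mB B0; rewrite lt0e integral_ge0 ?andbT; last first.
  by move=> x _; rewrite lee_fin ltW.
apply/negP => /eqP I0.
have mthB : measurable_fun B (EFin \o th).
  by apply/measurable_EFinP; exact: measurable_funTS.
have : (\int[mu]_(x in B) `|(EFin \o th) x| = 0)%E.
  by rewrite -[RHS]I0; apply: eq_integral => x _ /=; rewrite ger0_norm// ltW.
move/(ae_eq_integral_abs mu mB mthB) => [N [mN N0 hN]].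
move: B0; rewrite (@subset_measure0 _ _ _ mu B N) ?ltxx// => x Bx.
apply: hN => /= /(_ Bx) /eqP; rewrite eqe => /eqP h; have := th0 x.
by rewrite h ltxx.
Qed.

(** The condition bounds an infimum of admissible constants; one that almost
    attains it is chosen on every ball. *)
Lemma muckenhoupt_admissible : exists2 A0 : R, 0 < A0 &
  forall c r, 0 < r -> exists2 l, admissible (eball c r) l &
    l * fine (\int[mu]_(x in eball c r) (th x)%:E) <=
      A0 * fine (mu (eball c r)) `^ mean_exponent p (eball c r).
Proof.
move: hA; rewrite /muckenhoupt; set S := ereal_sup _ => Soo.
have Sub c r : 0 < r -> ((fine (mu (eball c r)) `^ (- mean_exponent p (eball c r)))%:E *
         (\int[mu]_(x in (eball c r)) `|th x|%:E) *
         vnorm (eball c r) (fun x => conj_exponent p x / p x)%R (fun x => (th x)^-1)%R <= S)%E.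
  by move=> r0; apply: ereal_sup_ubound; exists c, r.
have S0 : (0 <= S)%E.
  apply: le_trans (Sub 0 1 ltr01); rewrite mule_ge0//.
    rewrite mule_ge0 ?lee_fin ?powR_ge0//.
    by apply: integral_ge0 => x _; rewrite lee_fin.
  by apply: le_ereal_inf_tmp => _ [l [l0 _] <-]; rewrite lee_fin ltW.
have SE : S = (fine S)%:E by rewrite fineK// ge0_fin_numE.
exists (fine S + 1); first by rewrite ltr_wpDl// fine_ge0.
move=> c r r0; have := Sub c r r0; set B := eball c r.
have mB : measurable B by exact: measurable_eball.
have B0 : (0 < mu B)%E by exact: mu_eball_gt0.
have Boo : (mu B < +oo)%E.
  by apply: le_lt_trans (mu_eball_le c (ltW r0)) _; rewrite ltry.
have Bsub : B `<=` ball 0 (`|c| + r).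
  by apply: subset_trans (@ball_sub_ball0 c r); exact: eball_sub_ball.
have muE : mu B = (fine (mu B))%:E by rewrite fineK// ge0_fin_numE.
set m := fine (mu B) in muE *.
have m0 : 0 < m by rewrite -lte_fin -muE.
rewrite (eq_integral (fun x => (th x)%:E)); last first.
  by move=> x _; rewrite ger0_norm// ltW.
have tE : (\int[mu]_(x in B) (th x)%:E = (fine (\int[mu]_(x in B) (th x)%:E))%:E)%E.
  rewrite fineK// ge0_fin_numE; first exact: th_bounded Bsub.
  by apply: integral_ge0 => x _; rewrite lee_fin ltW.
set t := fine (\int[mu]_(x in B) (th x)%:E) in tE *.
have t0 : 0 < t by rewrite -lte_fin -tE; exact: th_pos.
rewrite tE -EFinM SE; set q := mean_exponent p B; set V := vnorm _ _ _ => VS.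
have k0 : 0 < m `^ (- q) * t by rewrite mulr_gt0// powR_gt0.
have /ereal_inf_lt [_ [l [l0 hl] <-]] : (V < ((fine S + 1) / (m `^ (- q) * t))%:E)%E.
  rewrite EFinM lte_pdivlMr// muleC (le_lt_trans VS)// lte_fin ltrDl//.
rewrite lte_fin ltr_pdivlMr// => hlt; exists l.
  split=> //; apply: le_trans hl; apply: ge0_le_integral_nomeas => x _.
    by rewrite lee_fin powR_ge0.
  rewrite lee_fin /conj_exponent ger0_norm; last by rewrite divr_ge0 ?invr_ge0 ?ltW.
  rewrite -invfM -[(_ * _)^-1]powR_inv1 ?mulr_ge0 ?(ltW l0) ?(ltW (th0 x))//.
  rewrite -powRrM mulN1r mulrC.
  rewrite (_ : (1 - (p x)^-1)^-1 / p x = (p x - 1)^-1)//.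
  have px : p x != 0 by rewrite gt_eqF// (lt_trans ltr01).
  by rewrite -invfM mulrBl mul1r mulVf.
rewrite -ler_pdivrMr ?powR_gt0// -powRN ltW//.
by rewrite -mulrA [t * _]mulrC.
Qed.

Let M := n%:R * pp.

(** Testing the condition on the balls [eball 0 r], where both factors are
    bounded below by their values for [r = 1]. *)
Lemma muckenhoupt_growth : exists2 C : R, 1 <= C & forall r, 1 <= r ->
  (exists2 l, admissible (eball 0 r) l & l <= C * r `^ M) /\
  (\int[mu]_(x in eball 0%R r) (th x)%:E <= (C * r `^ M)%:E)%E.
Proof.
have [A0 A00 hA0] := muckenhoupt_admissible.
have msub (r : R) : eball (0 : 'rV[R]_n) r `<=` ball 0 r by exact: eball_sub_ball.
have tfin r : (\int[mu]_(x in eball 0%R r) (th x)%:E \is a fin_num)%E.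
  rewrite ge0_fin_numE; first exact: th_bounded (measurable_eball _ _) (msub r).
  by apply: integral_ge0 => x _; rewrite lee_fin ltW.
pose t1 := fine (\int[mu]_(x in eball 0%R 1%R) (th x)%:E)%E.
have t10 : 0 < t1.
  rewrite -lte_fin fineK//; apply: th_pos; first exact: measurable_eball.
  exact: mu_eball_gt0.
pose sg x := th x `^ (- (p x - 1)^-1).
have msg : measurable_fun setT sg.
  by apply: measurable_fun_powR2 => //; exact: measurable_neg_exponent.
pose S1 := (\int[mu]_(x in eball 0%R 1%R) (sg x)%:E)%E.
have S1fin : S1 \is a fin_num.
  rewrite ge0_fin_numE; last by apply: integral_ge0 => x _; rewrite lee_fin powR_ge0.
  apply: le_lt_trans (sig_loc 1); apply: ge0_subset_integral => //.
  - exact: measurable_eball.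
  - exact: measurable_ball_rV.
  - by apply/measurable_EFinP; exact: measurable_funTS.
  - by move=> x _; rewrite lee_fin powR_ge0.
pose s1 := fine S1.
have s10 : 0 <= s1 by rewrite fine_ge0//; apply: integral_ge0 => x _; rewrite lee_fin powR_ge0.
have s1pos : 0 < s1.
  rewrite lt_neqAle s10 andbT eq_sym; apply/negP => /eqP s1E.
  have S1E : S1 = 0%E by rewrite -(fineK S1fin) -/s1 s1E.
  have mB := measurable_eball (0 : 'rV[R]_n) 1.
  have msB : measurable_fun (eball (0 : 'rV[R]_n) 1) (EFin \o sg).
    by apply/measurable_EFinP; exact: measurable_funTS.
  have : (\int[mu]_(x in eball 0%R 1%R) `|(EFin \o sg) x| = 0)%E.
    by rewrite -[RHS]S1E; apply: eq_integral => x _ /=; rewrite ger0_norm// powR_ge0.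
  move/(ae_eq_integral_abs mu mB msB) => [N [mN N0 hN]].
  have := mu_eball_gt0 (0 : 'rV[R]_n) (@ltr01 R).
  rewrite (@subset_measure0 _ _ _ mu _ N) ?ltxx// => x Bx.
  apply: hN => /= /(_ Bx) /eqP; rewrite eqe => /eqP h.
  by have := powR_gt0 (- (p x - 1)^-1) (th0 x); rewrite -/(sg x) h ltxx.
(* Every constant admissible on the unit ball is at least [l0]. *)
pose l0 := Num.min 1 (s1 `^ (pp - 1)).
have l00 : 0 < l0 by rewrite lt_min ltr01/= powR_gt0.
have hl0 l : admissible (eball 0 1) l -> l0 <= l.
  move=> [lpos hl]; rewrite ge_min; have [//|l1] := leP 1 l.
  have pp10 : 0 < pp - 1 by rewrite subr_gt0.
  have h : l `^ (- (pp - 1)^-1) * s1 <= 1.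
    rewrite -lee_fin EFinM fineK//; apply: le_trans hl.
    rewrite /S1 -ge0_integralZl//; last 4 first.
    - exact: measurable_eball.
    - by apply/measurable_EFinP; exact: measurable_funTS.
    - by move=> x _; rewrite lee_fin powR_ge0.
    - by rewrite lee_fin powR_ge0.
    apply: ge0_le_integral_nomeas => x _.
      by rewrite mule_ge0 ?lee_fin ?powR_ge0.
    rewrite -EFinM lee_fin powRM ?(ltW lpos) ?(ltW (th0 x))// ler_wpM2r ?powR_ge0//.
    apply: ger_powR; first by rewrite lpos ltW.
    by rewrite lerN2 lef_pV2 ?posrE ?subr_gt0// lerD2r.
  apply/orP; right.
  have : s1 <= l `^ ((pp - 1)^-1).
    by rewrite -[leRHS]invrK -powRN -div1r ler_pdivlMr ?powR_gt0// mulrC.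
  move/(ge0_ler_powR (ltW pp10)); rewrite !nnegrE powR_ge0 s10 => /(_ isT isT).
  by rewrite -powRrM mulVf ?gt_eqF// powRr1 ?(ltW lpos).
pose D := A0 * (2 `^ M).
have D0 : 0 < D by rewrite mulr_gt0// powR_gt0.
exists (1 + D / t1 + D / l0).
  by rewrite -addrA lerDl addr_ge0// divr_ge0// ltW.
move=> r r1; have r0 : 0 < r by exact: lt_le_trans r1.
have [l hl] := hA0 0 r r0; set t := fine _ => lt.
have l0l : l0 <= l.
  apply: hl0; apply: admissible_sub hl; [exact: measurable_eball|exact: measurable_eball|].
  by move=> x; rewrite /eball/= => h; exact: lt_le_trans r1.
have t1t : t1 <= t.
  rewrite -lee_fin !fineK//; apply: ge0_subset_integral => //; try exact: measurable_eball.
  - by apply/measurable_EFinP; exact: measurable_funTS.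
  - by move=> x _; rewrite lee_fin ltW.
  - by move=> x; rewrite /eball/= => h; exact: lt_le_trans r1.
have hD : l * t <= D * r `^ M.
  apply: (le_trans lt); rewrite /D -mulrA ler_pM2l// -powRM ?(ltW r0)//.
  have B0 := mu_eball_gt0 (0 : 'rV[R]_n) r0.
  have Bu := mu_eball_le (0 : 'rV[R]_n) (ltW r0).
  have Boo : (mu (eball (0 : 'rV[R]_n) r) < +oo)%E by rewrite (le_lt_trans Bu)// ltry.
  have muE : mu (eball (0 : 'rV[R]_n) r) = (fine (mu (eball (0 : 'rV[R]_n) r)))%:E.
    by rewrite fineK// ge0_fin_numE.
  have /andP[q1 q2] : 1 <= mean_exponent p (eball 0 r) <= pp.
    apply: mean_exponent_bounds => //; first exact: measurable_eball.
    by move=> x _; rewrite p_le (ltW (p1 x)).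
  move: B0 Bu; rewrite muE lte_fin lee_fin; set m := fine _ => m0 mu2.
  apply: (@le_trans _ _ (((2 * r) ^+ n) `^ mean_exponent p (eball 0 r))).
    by apply: ge0_ler_powR; rewrite ?nnegrE ?(ltW m0) ?exprn_ge0 ?mulr_ge0 ?(ltW r0)//; lra.
  rewrite -powR_mulrn ?mulr_ge0 ?(ltW r0)// -powRrM; apply: ler_powR; first lra.
  by rewrite ler_wpM2l.
have rM0 : 0 <= r `^ M by exact: powR_ge0.
have l_0 : 0 < l by exact: lt_le_trans l0l.
have t_0 : 0 < t by exact: lt_le_trans t1t.
split.
  exists l => //; apply: (@le_trans _ _ (D / t1 * r `^ M)); last first.
    rewrite ler_wpM2r//; have := divr_ge0 (ltW D0) (ltW l00); lra.
  rewrite mulrAC ler_pdivlMr// (le_trans _ hD)// ler_pM2l//.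
rewrite -[leLHS]fineK// lee_fin -/t.
apply: (@le_trans _ _ (D / l0 * r `^ M)); last first.
  rewrite ler_wpM2r//; have := divr_ge0 (ltW D0) (ltW t10); lra.
by rewrite mulrAC ler_pdivlMr// (le_trans _ hD)// mulrC ler_pM2r.
Qed.

End muckenhoupt_growth.

(** * Averages over small cubes are uniformly bounded *)

Section ball_integrals.
Context {R : realType} {n : nat}.
Local Notation mu := (lebesgue_rV n : {measure set 'rV[R]_n -> \bar R}).

Lemma integral_ballE (g : 'rV[R]_n -> R) (x : 'rV[R]_n) (e : R) :
  (\int[mu]_(y in ball x e) (g y)%:E =
   \int[mu]_y (\1_(ball (0 : 'rV[R]_n) e) (x - y)%R * g y)%:E)%E.
Proof.
rewrite integral_mkcond; apply: eq_integral => y _; rewrite patchE indicE.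
have -> : (x - y \in (ball (0 : 'rV[R]_n) e : set 'rV[R]_n)) = (y \in (ball x e : set 'rV[R]_n)).
  apply/idP/idP => /set_mem /ball_rV h; apply/mem_set/ball_rV.
    by move: h; rewrite sub0r normrN.
  by rewrite sub0r normrN.
by case: ifPn => _; rewrite ?mul1r ?mul0r.
Qed.

Lemma measurable_ball_kernel (g : 'rV[R]_n -> R) (e : R) : measurable_fun setT g ->
  measurable_fun setT (fun z : 'rV[R]_n * 'rV[R]_n =>
    \1_(ball (0 : 'rV[R]_n) e) (z.1 - z.2) * g z.2).
Proof.
move=> mg; apply: measurable_funM; last exact: measurableT_comp.
apply: (measurableT_comp (f := \1_(ball (0 : 'rV[R]_n) e) : 'rV[R]_n -> R)).
  by apply: measurable_indic; exact: measurable_ball_rV.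
exact: measurable_subr_rV.
Qed.

Lemma measurable_ball_integral (g : 'rV[R]_n -> R) (e : R) : measurable_fun setT g ->
  (forall x, 0 <= g x) ->
  measurable_fun setT (fun x : 'rV[R]_n => \int[mu]_(y in ball x e) (g y)%:E)%E.
Proof.
move=> mg g0; have -> : (fun x : 'rV[R]_n => \int[mu]_(y in ball x e) (g y)%:E)%E = fubini_F mu (fun z : 'rV[R]_n * 'rV[R]_n =>
    (\1_(ball (0 : 'rV[R]_n) e) (z.1 - z.2)%R * g z.2)%:E)%E.
  by apply/funext => x; rewrite integral_ballE.
apply: measurable_fun_fubini_tonelli_F.
  by apply/measurable_EFinP; exact: measurable_ball_kernel.
by move=> z; rewrite lee_fin mulr_ge0// indicE.
Qed.

End ball_integrals.

Section cube_averages.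
Context {R : realType} {n : nat} (p th : 'rV[R]_n -> R) (pm pp K0 : R).
Local Notation mu := (lebesgue_rV n : {measure set 'rV[R]_n -> \bar R}).
Hypothesis hw : regular_weight p th pm pp K0.
Let n0 := rw_n0 hw.
Let pm1 := rw_pm1 hw.
Let p_ge := rw_p_ge hw.
Let p_le := rw_p_le hw.
Let mp := rw_mp hw.
Let mth := rw_mth hw.
Let th0 := rw_th0 hw.
Let th_loc := rw_th_loc hw.
Let sig_loc := rw_sig_loc hw.
Let K00 := rw_K00 hw.
Let hosc := rw_hosc hw.
Let pp1 : 1 < pp. Proof. by rewrite (lt_le_trans pm1)// (le_trans (p_ge 0)). Qed.
Let p1 x : 1 < p x. Proof. exact: lt_le_trans (p_ge x). Qed.
Let M := n%:R * pp.
Let M0 : 0 <= M. Proof. by rewrite mulr_ge0// ltW// (lt_trans ltr01). Qed.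

(** Two constants are admissible on a small cube: the one of a large centred ball,
    which is bounded by a power of [(2 + |x|) / e], and the one of a ball
    circumscribed to the cube, for which [mean_exponent] may be replaced by [p x]
    at the cost of a constant. Their minimum has both properties. *)
Lemma local_admissible : exists2 C : R, 1 <= C & forall (x : 'rV[R]_n) (e : R), 0 < e -> e <= 1 ->
  exists l : R, [/\ admissible p th (ball x e) l, l <= C * ((2 + `|x|) / e) `^ M &
    l * fine (\int[mu]_(y in ball x e) (th y)%:E) <= C * e `^ (n%:R * p x)].
Proof.
have [C1 C11 growth] := muckenhoupt_growth hw.
have [A0 A00 hA0] := muckenhoupt_admissible hw.
have nR1 : 1 <= n%:R :> R by rewrite ler1n.
have nR0 : 0 < n%:R :> R by exact: lt_le_trans nR1.
pose c1 : R := n%:R * n%:R.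
have c11 : 1 <= c1 by rewrite /c1 -[leLHS]mulr1 ler_pM.
pose c2 : R := (2 * n%:R) ^+ n.
have c20 : 0 <= c2 by rewrite exprn_ge0// mulr_ge0// ltW.
have c21 : 1 <= c2 by rewrite exprn_ege1//; lra.
pose D1 := C1 * c1 `^ M.
pose D2 := A0 * (c2 `^ pp * expR (n%:R * K0)).
have D10 : 0 <= D1 by rewrite mulr_ge0 ?powR_ge0//; lra.
have D20 : 0 <= D2 by rewrite mulr_ge0 ?(ltW A00)// mulr_ge0 ?powR_ge0 ?expR_ge0.
have hD1 : D1 <= 1 + D1 + D2 by lra.
have hD2 : D2 <= 1 + D1 + D2 by lra.
have C10 : 0 <= C1 by lra.
exists (1 + D1 + D2); first lra.
move=> x e e0 e1.
pose W := (2 + `|x|) / e.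
have W2 : 2 <= W.
  by rewrite ler_pdivlMr//; have := normr_ge0 x; nra.
have lW0 : 0 < ln W by rewrite ln_gt0//; lra.
(* The ball of radius [r] contains the ball of radius [n * e] around [x]. *)
pose r := n%:R * (`|x| + n%:R).
have r1 : 1 <= r by rewrite /r; have := normr_ge0 x; nra.
have x0 := normr_ge0 x.
have r0 : 0 <= r by lra.
have W0 : 0 <= W by lra.
have W0' : 0 < W by lra.
have c10 : 0 <= c1 by lra.
have ex : e^-1 <= W by rewrite /W ler_peMl ?invr_ge0 ?(ltW e0)//; lra.
have rW : r <= c1 * W.
  rewrite /r /c1 -mulrA ler_pM2l//.
  apply: (@le_trans _ _ (n%:R * (2 + `|x|))); first by nra.
  by rewrite ler_pM2l// /W ler_peMr ?invf_ge1//; lra.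
have [[l1 hl1 l1C] _] := growth r r1.
have ne0 : 0 < n%:R * e by rewrite mulr_gt0.
have [l2 hl2 l2A] := hA0 x _ ne0.
set B := eball x (n%:R * e) in hl2 l2A.
have mB : measurable B by exact: measurable_eball.
have mb : measurable (ball x e) by exact: measurable_ball_rV.
have bB : ball x e `<=` B by exact: ball_sub_eball.
have Bb : B `<=` ball x (n%:R * e) by exact: eball_sub_ball.
have Br : B `<=` eball 0 r.
  apply: (subset_trans Bb); apply: (subset_trans (@ball_sub_ball0 _ _ x _)).
  apply: ball_sub_eball; first by lra.
  by rewrite /r ler_pM2l// lerD2l ler_piMr// ltW.
have hl1b : admissible p th (ball x e) l1.
  by apply: (admissible_sub hw _ _ (subset_trans bB Br) hl1) => //; exact: measurable_eball.
have hl2b : admissible p th (ball x e) l2 by exact: (admissible_sub hw mb mB bB hl2).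
have tb0 : 0 <= fine (\int[mu]_(y in ball x e) (th y)%:E)%E.
  by apply: fine_ge0; apply: integral_ge0 => y _; rewrite lee_fin ltW.
have tbB : fine (\int[mu]_(y in ball x e) (th y)%:E)%E <= fine (\int[mu]_(y in B) (th y)%:E)%E.
  apply: fine_le.
  - rewrite ge0_fin_numE; first exact: (th_bounded hw mb (@ball_sub_ball0 _ _ x e)).
    by apply: integral_ge0 => y _; rewrite lee_fin ltW.
  - rewrite ge0_fin_numE; first exact: (th_bounded hw mB (subset_trans Bb (@ball_sub_ball0 _ _ x _))).
    by apply: integral_ge0 => y _; rewrite lee_fin ltW.
  - apply: ge0_subset_integral => //.
    + by apply/measurable_EFinP; exact: measurable_funTS.
    + by move=> y _; rewrite lee_fin ltW.
have [l10 _] := hl1; have [l20 _] := hl2.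
exists (Num.min l1 l2); split.
- by case: (leP l1 l2).
- apply: (@le_trans _ _ (D1 * W `^ M)); last by rewrite ler_wpM2r ?powR_ge0.
  apply: (@le_trans _ _ l1); first by rewrite ge_min lexx.
  apply: (le_trans l1C); rewrite /D1 -mulrA; apply: ler_pM => //; rewrite ?powR_ge0//.
  rewrite -powRM//; apply: (@ge0_ler_powR _ M) => //; rewrite nnegrE//.
  exact: mulr_ge0.
apply: (@le_trans _ _ (D2 * e `^ (n%:R * p x))); last by rewrite ler_wpM2r ?powR_ge0.
apply: (@le_trans _ _ (l2 * fine (\int[mu]_(y in B) (th y)%:E)%E)).
  apply: ler_pM => //; first by rewrite le_min (ltW l10) (ltW l20).
  by rewrite ge_min lexx orbT.
apply: (le_trans l2A); rewrite /D2 -mulrA ler_pM2l//.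
have B0 : (0 < mu B)%E by exact: mu_eball_gt0.
have Bu := mu_eball_le x (ltW ne0).
have Boo : (mu B < +oo)%E by rewrite (le_lt_trans Bu)// ltry.
have muE : mu B = (fine (mu B))%:E by rewrite fineK// ge0_fin_numE.
pose d := K0 / ln W.
have d0 : 0 <= d by rewrite divr_ge0// ltW.
have pB y : B y -> `|p x - p y| <= d.
  move=> By; rewrite ler_pdivlMr//; apply: hosc => //.
  by move/Bb : By => /ball_rV /ltW.
have /andP[q1 q2] : Num.max 1 (p x - d) <= mean_exponent p B <= Num.min pp (p x + d).
  apply: mean_exponent_bounds => //; first by rewrite lt_max ltr01.
  move=> y By; rewrite ge_max le_min p_le (ltW (p1 y))/=.
  by have := pB y By; rewrite ler_norml; lra.
move: q1 q2; rewrite ge_max le_min => /andP[q1 q1'] /andP[q2 q2'].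
set q := mean_exponent p B in q1 q1' q2 q2' *.
move: B0 Bu; rewrite muE lte_fin lee_fin; set m := fine _ => m0 mu2.
apply: (@le_trans _ _ ((c2 * e ^+ n) `^ q)).
  apply: ge0_ler_powR; rewrite ?nnegrE ?(ltW m0)//; first exact: le_trans q1.
    by rewrite mulr_ge0// exprn_ge0// ltW.
  by rewrite (le_trans mu2)// /c2 -exprMn mulrA.
rewrite powRM// ?exprn_ge0 ?(ltW e0)// -mulrA; apply: ler_pM; rewrite ?powR_ge0//.
  by apply: ler_powR.
rewrite -powR_mulrn ?(ltW e0)// -powRrM.
have -> : n%:R * q = n%:R * p x + n%:R * (q - p x) by ring.
rewrite powRD; last by rewrite (gt_eqF e0) implybT.
rewrite mulrC ler_pM2r ?powR_gt0//; apply: powR_le_expR => //.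
rewrite normrM ger0_norm ?(ltW nR0)// -mulrA ler_pM2l//.
have le0 : ln e <= 0 by rewrite ln_le0.
rewrite (ler0_norm le0) -lnV ?posrE//.
apply: (@le_trans _ _ (d * ln W)); last by rewrite /d divfK ?gt_eqF.
apply: ler_pM => //; first by rewrite ln_ge0// invf_ge1.
  by rewrite ler_norml; lra.
by rewrite ler_ln ?posrE ?invr_gt0.
Qed.

End cube_averages.

Lemma dist_le_bound {R : realType} (u v P : R) :
  1 < u -> 1 < v -> u <= P -> v <= P -> `|u - v| <= P.
Proof. by move=> ? ? ? ?; rewrite ler_norml; lra. Qed.

(** Collects the bounds on the average into powers of the single quantity
    [s / e], the form in which log-Hoelder continuity applies. *)
Lemma scale_bounds {R : realType} (n : nat) (C1 M a s e t : R) :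
  1 <= C1 -> 0 <= M -> 0 <= a -> 1 <= s -> 0 < e -> e <= 1 ->
  e ^+ n * s `^ (- a) / 2 <= t -> t <= C1 * (s / e) `^ M + 1 ->
  (2 * C1 * (s / e) `^ (M + n%:R + a))^-1 <= t <= 2 * C1 * (s / e) `^ (M + n%:R + a).
Proof.
move=> C11 M0 a0 s1 e0 e1 tbig tl.
have s0 : 0 < s by exact: lt_le_trans s1.
have C10 : 0 < C1 by exact: lt_le_trans C11.
have W1 : 1 <= s / e by rewrite ler_pdivlMr// mul1r (le_trans e1).
have esW : s <= s / e by rewrite ler_peMr ?(ltW s0)// invf_ge1.
have eW : (s / e)^-1 <= e by rewrite invfM invrK ler_piMl ?(ltW e0)// invf_le1.
set W := s / e in tl W1 esW eW *.
have W0 : 0 < W by exact: lt_le_trans W1.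
have n0 : 0 <= n%:R :> R by [].
apply/andP; split.
  apply: le_trans tbig.
  have h1 : W `^ (- n%:R) <= e ^+ n.
    rewrite powRN powR_mulrn ?(ltW W0)// -exprVn lerXn2r ?nnegrE ?invr_ge0 ?(ltW W0) ?(ltW e0)//.
  have h2 : W `^ (- a) <= s `^ (- a).
    rewrite !powRN lef_pV2 ?posrE ?powR_gt0//.
    by apply: ge0_ler_powR; rewrite ?nnegrE ?(ltW W0) ?(ltW s0).
  have h3 : W `^ (- M) <= 1.
    by rewrite powRN invf_le1 ?powR_gt0// -(powRr0 W); exact: ler_powR.
  have -> : (2 * C1 * W `^ (M + n%:R + a))^-1 = C1^-1 * W `^ (-M) * W `^ (- n%:R) * W `^ (-a) / 2.
    rewrite !powRD ?(gt_eqF W0) ?implybT// !powRN.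
    have := powR_gt0 M W0; have := powR_gt0 n%:R W0; have := powR_gt0 a W0 => z1 z2 z3.
    by field; rewrite !gt_eqF.
  rewrite ler_pM2r ?invr_gt0//; apply: ler_pM; rewrite ?powR_ge0 ?mulr_ge0 ?powR_ge0 ?invr_ge0 ?(ltW C10)//.
  rewrite -[leRHS]mul1r; apply: ler_pM; rewrite ?powR_ge0 ?mulr_ge0 ?powR_ge0 ?invr_ge0 ?(ltW C10)//.
  rewrite -[leRHS]mul1r; apply: ler_pM; rewrite ?powR_ge0 ?mulr_ge0 ?powR_ge0 ?invr_ge0 ?(ltW C10)//.
  by rewrite invf_le1.
apply: (le_trans tl).
have WM1 : 1 <= W `^ M by rewrite -(powRr0 W); exact: ler_powR.
have WA : W `^ M <= W `^ (M + n%:R + a) by apply: ler_powR => //; rewrite -addrA lerDl addr_ge0.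
apply: (@le_trans _ _ (2 * C1 * W `^ M)); last by rewrite ler_pM2l// mulr_gt0.
rewrite -mulrA mulr_natl mulr2n lerD2l -[leLHS]mulr1.
exact: ler_pM.
Qed.

Section cube_averages.
Context {R : realType} {n : nat} (p th : 'rV[R]_n -> R) (pm pp K0 : R).
Local Notation mu := (lebesgue_rV n : {measure set 'rV[R]_n -> \bar R}).
Hypothesis hw : regular_weight p th pm pp K0.
Let n0 := rw_n0 hw.
Let pm1 := rw_pm1 hw.
Let p_ge := rw_p_ge hw.
Let p_le := rw_p_le hw.
Let mp := rw_mp hw.
Let mth := rw_mth hw.
Let th0 := rw_th0 hw.
Let th_loc := rw_th_loc hw.
Let sig_loc := rw_sig_loc hw.
Let K00 := rw_K00 hw.
Let hosc := rw_hosc hw.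
Let pp1 : 1 < pp. Proof. by rewrite (lt_le_trans pm1)// (le_trans (p_ge 0)). Qed.
Let p1 x : 1 < p x. Proof. exact: lt_le_trans (p_ge x). Qed.
Let M := n%:R * pp.
Let M0 : 0 <= M. Proof. by rewrite mulr_ge0// ltW// (lt_trans ltr01). Qed.

(** The inequality of Jensen type behind everything. With [T] the integral of
    [f] over the cube and [t = T / 2], splitting [f] at the balance point of
    [le_powR_weight] gives [1 <= l * \int (f / t) ^ p * th]; log-Hoelder
    continuity lets [t ^ (p x)] replace [t ^ (p y)] as soon as [t] is between
    two powers of [(2 + |x|) / e], which fails only if the average of [f] is below the
    error term [(2 + |x|) ^ (- a)]. *)
Lemma cube_average_pointwise (a : R) : 0 <= a -> exists2 C : R, 0 < C &
  forall (f : 'rV[R]_n -> R) (x : 'rV[R]_n) (e : R), measurable_fun setT f -> (forall y, 0 <= f y) ->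
    (\int[mu]_y (f y `^ p y * th y)%:E <= 1)%E -> 0 < e -> e <= 1 ->
  (\int[mu]_(y in ball x e) (f y)%:E < +oo)%E /\
  (e ^- n * fine (\int[mu]_(y in ball x e) (f y)%:E)%E) `^ p x <=
  (2 + `|x|) `^ (- a) + C * (fine (\int[mu]_(y in ball x e) (f y `^ p y * th y)%:E)%E
     / fine (\int[mu]_(y in ball x e) (th y)%:E)%E).
Proof.
move=> a0; have [C1 C11 loc] := local_admissible hw.
have C10 : 0 < C1 by exact: lt_le_trans C11.
pose Ax := M + n%:R + a.
pose K := expR (pp * ln (2 * C1) + Ax * K0).
exists (2 `^ pp * (C1 * K)).
  by rewrite !mulr_gt0 ?powR_gt0 ?expR_gt0.
move=> f x e mf f0 f1 e0 e1.
have [l [[l0 hl] lW lt]] := loc x e e0 e1.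
set B := ball x e in hl lt *.
have mB : measurable B by exact: measurable_ball_rV.
set th_B := fine _ in lt *.
have thB0 : 0 < th_B.
  apply: fine_gt0; rewrite (th_bounded hw mB (@ball_sub_ball0 _ _ x e)) andbT.
  apply: (th_pos hw mB).
  apply: (lt_le_trans (mu_eball_gt0 x e0)).
  by apply: le_measure; rewrite ?inE//; [exact: measurable_eball|exact: eball_sub_ball].
have mfp : measurable_fun setT (fun y => f y `^ p y * th y).
  by apply: measurable_funM => //; exact: measurable_fun_powR2.
have fp0 y : 0 <= f y `^ p y * th y by rewrite mulr_ge0 ?powR_ge0 ?ltW.
set SE := (\int[mu]_(y in B) (f y `^ p y * th y)%:E)%E.
have SE1 : (SE <= 1)%E.
  apply: le_trans f1; apply: ge0_subset_integral => //.
    exact/measurable_EFinP.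
  by move=> y _; rewrite lee_fin.
have SE0 : (0 <= SE)%E by apply: integral_ge0 => y _; rewrite lee_fin.
have SEfin : SE \is a fin_num by rewrite ge0_fin_numE// (le_lt_trans SE1)// ltry.
set S := fine SE.
have S0 : 0 <= S by exact: fine_ge0.
have S1 : S <= 1 by rewrite -lee_fin fineK.
pose G t := (\int[mu]_(y in B) ((f y / t) `^ p y * th y)%:E)%E.
have mG t : measurable_fun setT (fun y => (f y / t) `^ p y * th y).
  apply: measurable_funM => //; apply: measurable_fun_powR2 => //.
  by apply: measurable_funM => //; exact: measurable_cst.
have mD : measurable_fun setT (fun y => (l * th y) `^ (- (p y - 1)^-1)).
  exact: measurable_dual_weight hw _.
(* Young's inequality at [f / t], with the weight [l * th]. *)
have split t : 0 < t -> (\int[mu]_(y in B) (f y)%:E <= (t * l)%:E * G t + t%:E)%E.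
  move=> t0.
  apply: (@le_trans _ _ (\int[mu]_(y in B) ((t * l)%:E * ((f y / t) `^ p y * th y)%:E +
     t%:E * ((l * th y) `^ (- (p y - 1)^-1))%:E))%E).
    apply: ge0_le_integral_nomeas => y _; first by rewrite lee_fin.
    rewrite -!EFinM -EFinD lee_fin.
    have ft0 : 0 <= f y / t by rewrite divr_ge0// ltW.
    have := le_powR_weight ft0 (mulr_gt0 l0 (th0 y)) (p1 y).
    have tf : t * (f y / t) = f y by rewrite mulrC divfK ?gt_eqF.
    move=> /(ler_wpM2l (ltW t0)); rewrite tf => /le_trans; apply.
    by rewrite mulrDr lerD2r; rewrite le_eqVlt; apply/orP; left; apply/eqP; ring.
  rewrite ge0_integralD//; last 4 first.
  - by move=> y _; rewrite -EFinM lee_fin mulr_ge0 ?mulr_ge0 ?powR_ge0 ?(ltW t0) ?(ltW l0) ?(ltW (th0 y)).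
  - apply: measurable_funeM; apply/measurable_EFinP; exact: measurable_funTS.
  - by move=> y _; rewrite -EFinM lee_fin mulr_ge0 ?powR_ge0 ?(ltW t0).
  - apply: measurable_funeM; apply/measurable_EFinP; exact: measurable_funTS.
  rewrite !ge0_integralZl//.
  - apply: leeD2l; rewrite -[leRHS]mule1; apply: lee_pmul => //.
      by rewrite lee_fin ltW.
    by apply: integral_ge0 => y _; rewrite lee_fin powR_ge0.
  - by apply/measurable_EFinP; exact: measurable_funTS.
  - by move=> y _; rewrite lee_fin powR_ge0.
  - by rewrite lee_fin ltW.
  - by apply/measurable_EFinP; exact: measurable_funTS.
  - by move=> y _; rewrite lee_fin mulr_ge0 ?powR_ge0 ?(ltW (th0 y)).
  - by rewrite lee_fin mulr_ge0 ?ltW.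
set FE := (\int[mu]_(y in B) (f y)%:E)%E in split *.
have FE0 : (0 <= FE)%E by apply: integral_ge0 => y _; rewrite lee_fin.
(* The case [t = 1] bounds the average above by a power of [(2 + |x|) / e]. *)
have FEl : (FE <= (l + 1)%:E)%E.
  have GSE : G 1 = SE by rewrite /G /SE; apply: eq_integral => y _; rewrite divr1.
  have := split 1 ltr01; rewrite mul1r GSE -(fineK SEfin) -EFinM -EFinD => h.
  by apply: (le_trans h); rewrite lee_fin lerD2r ler_piMr// ltW.
have FEfin : FE \is a fin_num by rewrite ge0_fin_numE// (le_lt_trans FEl)// ltry.
split; first by rewrite -ge0_fin_numE.
set T := fine FE.
have T0 : 0 <= T by exact: fine_ge0.
have Tl : T <= l + 1 by rewrite -lee_fin fineK.
have x2 : 2 <= 2 + `|x| by have := normr_ge0 x; lra.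
have x20 : 0 < 2 + `|x| by lra.
have err1 : 0 < (2 + `|x|) `^ (- a) <= 1.
  rewrite powR_gt0//= powRN invf_le1 ?powR_gt0// -[leLHS](powRr0 (2 + `|x|)).
  by apply: ler_powR => //; lra.
have err0 : 0 <= C1 by exact: ltW.
(* A small average is absorbed by the error term. *)
have [Tsmall|Tbig] := leP (e ^- n * T) ((2 + `|x|) `^ (- a)).
  apply: (@le_trans _ _ ((2 + `|x|) `^ (- a))); last first.
    by rewrite lerDl mulr_ge0 ?divr_ge0 ?(ltW thB0)// !mulr_ge0 ?powR_ge0 ?expR_ge0.
  apply: (@le_trans _ _ (((2 + `|x|) `^ (- a)) `^ p x)).
    by apply: ge0_ler_powR; rewrite ?nnegrE ?powR_ge0 ?mulr_ge0 ?invr_ge0 ?exprn_ge0 ?(ltW e0)// ltW// (lt_trans ltr01).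
  by apply: ge1r_powR => //; exact: ltW.
pose t := T / 2.
have en0 : 0 < e ^+ n by rewrite exprn_gt0.
have tbig : e ^+ n * (2 + `|x|) `^ (- a) / 2 <= t.
  rewrite /t ler_pM2r ?invr_gt0// mulrC ltW// -ltr_pdivlMr// mulrC//.
have t0 : 0 < t.
  by apply: lt_le_trans tbig; rewrite !mulr_gt0//; case/andP: err1.
pose W := (2 + `|x|) / e.
have W1 : 1 <= W by rewrite ler_pdivlMr// mul1r (le_trans e1)// (le_trans _ x2)// ler1n.
have W0 : 0 < W by exact: lt_le_trans W1.
have lW0 : 0 <= ln W by rewrite ln_ge0.
have Ax0 : 0 <= Ax by rewrite /Ax !addr_ge0.
have /andP[tlow tup] : (2 * C1 * W `^ Ax)^-1 <= t <= 2 * C1 * W `^ Ax.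
  apply: scale_bounds => //; first by rewrite (le_trans _ x2)// ler1n.
  have tT : t <= T by rewrite /t ler_pdivrMr// ler_peMr// ler1n.
  by rewrite (le_trans tT)// (le_trans Tl)// lerD2r.
have C2 : 1 <= 2 * C1 by rewrite -[leLHS]mulr1 ler_pM// ler1n.
have lnt : `|ln t| <= ln (2 * C1) + Ax * ln W by exact: ln_norm_le.
have c20 : 0 <= ln (2 * C1) by rewrite ln_ge0.
have Kt y : B y -> t `^ (p x - p y) <= K.
  move=> /ball_rV /ltW By; apply: powR_le_expR => //.
  have ho : `|p x - p y| * ln W <= K0.
    apply: hosc => //; rewrite (le_trans By)// ler_peMl ?(ltW e0)// ler1n//.
  have dp : `|p x - p y| <= pp.
    exact: dist_le_bound.
  apply: (@le_trans _ _ (`|p x - p y| * (ln (2 * C1) + Ax * ln W))).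
    by rewrite ler_wpM2l.
  rewrite mulrDr lerD// ?ler_wpM2r//.
  by rewrite mulrCA ler_wpM2l.
have GK : (G t <= (K * S / t `^ p x)%:E)%E.
  rewrite mulrAC EFinM (fineK SEfin) /SE -ge0_integralZl//.
  - apply: ge0_le_integral_nomeas => y By.
      by rewrite lee_fin mulr_ge0 ?powR_ge0 ?(ltW (th0 y)).
    rewrite -EFinM lee_fin mulrA ler_wpM2r ?(ltW (th0 y))//.
    rewrite powRM// ?invr_ge0 ?(ltW t0)// mulrC ler_wpM2r ?powR_ge0//.
    rewrite ler_pdivlMr ?powR_gt0// -powR_inv1 ?(ltW t0)// -powRrM mulN1r -powRD.
      by rewrite addrC; exact: Kt.
    by rewrite (gt_eqF t0) implybT.
  - by apply/measurable_EFinP; exact: measurable_funTS.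
  - by move=> y _; rewrite lee_fin.
  - by rewrite lee_fin divr_ge0 ?expR_ge0 ?powR_ge0.
(* Half of [T = 2 * t] absorbs the dual term of [split]. *)
have main : t `^ p x <= l * K * S.
  have := split t t0; rewrite -(fineK FEfin) -/T.
  have -> : T = t + t by rewrite /t -splitr.
  move=> h; have {}h : ((t + t)%:E <= (t * l * (K * S / t `^ p x) + t)%:E)%E.
    apply: (le_trans h); rewrite EFinD leeD2r// [X in (_ <= X)%E]EFinM.
    by apply: lee_pmul => //; [rewrite lee_fin mulr_ge0 ?ltW|
      apply: integral_ge0 => y _; rewrite lee_fin mulr_ge0 ?powR_ge0 ?(ltW (th0 y))].
  move: h; rewrite lee_fin lerD2r -[X in X <= _]mulr1 -mulrA ler_pM2l// mulrA.
  by rewrite ler_pdivlMr ?powR_gt0// mul1r mulrA.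
apply: (@le_trans _ _ (2 `^ pp * (C1 * K) * (S / th_B))); last by rewrite lerDr powR_ge0.
have -> : e ^- n * T = 2 * (e ^- n * t) by rewrite /t; field; rewrite gt_eqF.
rewrite powRM ?mulr_ge0 ?invr_ge0 ?(ltW t0) ?(ltW en0)// -mulrA.
apply: ler_pM; rewrite ?powR_ge0//; first by apply: ler_powR; rewrite ?p_le//; lra.
rewrite powRM ?invr_ge0 ?(ltW t0) ?(ltW en0)//.
have -> : (e ^- n) `^ p x = (e `^ (n%:R * p x))^-1.
  by rewrite -(powR_mulrn _ (ltW e0)) -!powRN -powRrM mulNr.
have enp : 0 < e `^ (n%:R * p x) by rewrite powR_gt0.
rewrite ler_pdivrMl//; apply: (le_trans main).
have : l <= C1 * e `^ (n%:R * p x) / th_B by rewrite ler_pdivlMr.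
have KS0 : 0 <= K * S by rewrite mulr_ge0 ?expR_ge0.
move=> /(ler_wpM2r KS0); rewrite mulrA => /le_trans; apply.
by rewrite le_eqVlt; apply/orP; left; apply/eqP; field; rewrite gt_eqF.
Qed.

End cube_averages.

Section cube_average_integrals.
Context {R : realType} {n : nat} (p th : 'rV[R]_n -> R) (pm pp K0 : R).
Local Notation mu := (lebesgue_rV n : {measure set 'rV[R]_n -> \bar R}).
Hypothesis hw : regular_weight p th pm pp K0.
Let n0 := rw_n0 hw.
Let pm1 := rw_pm1 hw.
Let p_ge := rw_p_ge hw.
Let p_le := rw_p_le hw.
Let mp := rw_mp hw.
Let mth := rw_mth hw.
Let th0 := rw_th0 hw.
Let th_loc := rw_th_loc hw.
Let sig_loc := rw_sig_loc hw.
Let K00 := rw_K00 hw.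
Let pp1 : 1 < pp. Proof. by rewrite (lt_le_trans pm1)// (le_trans (p_ge 0)). Qed.
Let p1 x : 1 < p x. Proof. exact: lt_le_trans (p_ge x). Qed.
Let M := n%:R * pp.
Let M0 : 0 <= M. Proof. by rewrite mulr_ge0// ltW// (lt_trans ltr01). Qed.

Lemma dyadic_bracket (s : R) : 1 <= s -> exists j : nat, 2 ^+ j <= s < 2 ^+ j.+1.
Proof.
move=> s1; have s0 : 0 <= s by exact: le_trans s1.
have ex : exists k : nat, s < 2 ^+ k.
  exists (Num.truncn s).+1; apply: (lt_le_trans (truncnS_gt s)).
  by rewrite -natrX ler_nat ltnW// ltn_expl.
case: (ex_minnP ex) => -[|j] sj jmin; first by rewrite expr0 ltNge s1 in sj.
exists j; rewrite sj andbT leNgt; apply/negP => /jmin.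
by rewrite ltnn.
Qed.

(** Dyadic shells: the weight of a ball grows at most like the power [M] of its
    radius. *)
Lemma weight_decay :
  (\int[mu]_x ((2 + `|x|) `^ (- (M + 1)) * th x)%:E < +oo)%E.
Proof.
have [C C1 growth] := muckenhoupt_growth hw.
have C0 : 0 <= C by exact: le_trans C1.
(* [w j] bounds the decaying factor where [2 ^+ j <= 2 + |x|]. *)
pose w (j : nat) : R := 2 `^ (- (M + 1) * j%:R).
pose B (j : nat) : set 'rV[R]_n := ball 0 (2 ^+ j.+1).
pose g (j : nat) x : \bar R := ((w j)%:E * (\1_(B j) x * th x)%:E)%E.
have mB j : measurable (B j) by exact: measurable_ball_rV.
have mind j : measurable_fun setT (fun x => \1_(B j) x * th x).
  by apply: measurable_funM => //; exact: measurable_indic.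
have ind0 j x : 0 <= \1_(B j) x * th x.
  by rewrite mulr_ge0 ?(ltW (th0 x))// indicE.
have mg j : measurable_fun setT (g j).
  by apply: measurable_funeM; apply/measurable_EFinP.
have w0 j : 0 <= w j by exact: powR_ge0.
have g0 j x : (0 <= g j x)%E by rewrite /g -EFinM lee_fin mulr_ge0.
pose D := C * (2 * n%:R) `^ M.
have D0 : 0 <= D by rewrite mulr_ge0 ?powR_ge0.
apply: (@le_lt_trans _ _ ((2 * D)%:E)); last by rewrite ltry.
apply: (@le_trans _ _ (\int[mu]_x (\sum_(j <oo) g j x))%E).
  apply: ge0_le_integral_nomeas => x _.
    by rewrite lee_fin mulr_ge0 ?powR_ge0 ?(ltW (th0 x)).
  have x1 : 1 <= 2 + `|x| by have := normr_ge0 x; lra.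
  have [j /andP[j1 j2]] := dyadic_bracket x1.
  apply: (@le_trans _ _ (g j x)); last first.
    apply: (@le_trans _ _ (\sum_(0 <= i < j.+1) g i x)%E); last first.
      by apply: nneseries_lim_ge => i _ _; exact: g0.
    rewrite big_nat_recr//= leeDr//; apply: sume_ge0 => i _; exact: g0.
  rewrite /g -EFinM lee_fin indicE mem_set ?mul1r; last first.
    apply/ball_rV; rewrite sub0r normrN; apply: lt_trans j2.
    by rewrite ltrDr.
  rewrite ler_wpM2r ?(ltW (th0 x))// /w mulNr !powRN lef_pV2 ?posrE ?powR_gt0//.
  rewrite mulrC powRrM powR_mulrn//; apply: ge0_ler_powR; rewrite ?nnegrE ?exprn_ge0//.
    by rewrite addr_ge0.
rewrite integral_nneseries//.
apply: (le_trans _ (@epsilon_trick0 R (2 * D) xpredT (mulr_ge0 (ler0n R 2) D0))).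
apply: lee_nneseries => j _; first by move=> _; apply: integral_ge0 => x _; exact: g0.
rewrite /g ge0_integralZl//; last 3 first.
- by apply/measurable_EFinP.
- by move=> x _; rewrite lee_fin.
- by rewrite lee_fin.
have -> : (\int[mu]_x (\1_(B j) x * th x)%:E = \int[mu]_(x in B j) (th x)%:E)%E.
  rewrite [RHS]integral_mkcond; apply: eq_integral => x _; rewrite patchE indicE.
  by case: ifPn => _; rewrite ?mul1r ?mul0r.
have nR1 : 1 <= n%:R :> R by rewrite ler1n.
have nR0 : 0 <= n%:R :> R by [].
have two0 : 0 < 2 ^+ j.+1 :> R by rewrite exprn_gt0.
pose r : R := n%:R * 2 ^+ j.+1.
have r1 : 1 <= r by rewrite /r -[leLHS]mulr1 ler_pM// exprn_ege1// ler1n.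
have r0 : 0 < r by exact: lt_le_trans r1.
have [_ gr] := growth r r1.
have {}gr : (\int[mu]_(x in B j) (th x)%:E <= (C * r `^ M)%:E)%E.
  apply: le_trans gr; apply: ge0_subset_integral => //.
  - exact: measurable_eball.
  - by apply/measurable_EFinP; exact: measurable_funTS.
  - by move=> x _; rewrite lee_fin ltW.
  - exact: ball_sub_eball.
apply: (@le_trans _ _ ((w j)%:E * (C * r `^ M)%:E)%E).
  by apply: lee_pmul => //; [rewrite lee_fin|apply: integral_ge0 => x _; rewrite lee_fin ltW].
rewrite -EFinM lee_fin /w /D /r.
have -> : (n%:R * 2 ^+ j.+1 : R) = (2 * n%:R) * 2 ^+ j by rewrite exprS; ring.
rewrite powRM ?mulr_ge0 ?exprn_ge0// -(powR_mulrn j)// -powRrM.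
rewrite (_ : 2 `^ (- (M + 1) * j%:R) = (2 `^ (j%:R * M))^-1 / 2 ^+ j); last first.
  rewrite -powRN -(powR_mulrn j)// -powRN -powRD; last by rewrite pnatr_eq0 implybT.
  by congr (_ `^ _); ring.
have h := powR_gt0 (j%:R * M) (@ltr0Sn R 1).
rewrite natrX exprS le_eqVlt; apply/orP; left; apply/eqP; field.
by rewrite gt_eqF//= expf_neq0.
Qed.

Definition orthant (y : 'rV[R]_n) (e : R) (s : {ffun 'I_n -> bool}) : set 'rV[R]_n :=
  ball y e `&` [set x | forall i, (y ord0 i <= x ord0 i) = s i].

Lemma measurable_orthant y e s : measurable (orthant y e s).
Proof.
apply: measurableI; first exact: measurable_ball_rV.
rewrite [X in measurable X](_ : _ =
  \bigcap_(i in [set: 'I_n]) ((fun x : 'rV[R]_n => x ord0 i) @^-1`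
    (if s i then `[y ord0 i, +oo[%classic else `]-oo, y ord0 i[%classic))); last first.
  apply/seteqP; split => x /= h i => [_|].
    have := h i; case: (s i) => /=; rewrite in_itv/= ?andbT//.
    by rewrite ltNge => ->.
  have := h i Logic.I; case: (s i) => /=; rewrite in_itv/= ?andbT//.
  by rewrite ltNge => /negbTE.
apply: fin_bigcap_measurable => // i _.
by rewrite -[X in measurable X]setTI; apply: measurable_coord_rV => //; case: (s i).
Qed.

Lemma orthant_sub_ball y e s x : 0 < e -> orthant y e s x ->
  orthant y e s `<=` ball x e.
Proof.
move=> e0 [/ball_rV /rV_norm_lt - /(_ e0) yx sx] z [/ball_rV /rV_norm_lt - /(_ e0) yz sz].
apply/ball_rV; apply/rV_norm_lt => // i; rewrite !mxE.
have := yx i; have := yz i; rewrite !mxE !ltr_norml.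
have := sx i; have := sz i; case: (s i).
  by move=> ? ?; move=> /andP[? ?] /andP[? ?]; apply/andP; split; lra.
move=> /negbT; rewrite -ltNge => ? /negbT; rewrite -ltNge => ?.
by move=> /andP[? ?] /andP[? ?]; apply/andP; split; lra.
Qed.

(** The cube around [y] is cut into [2 ^ n] orthants; any cube centred in an
    orthant and of the same size covers that orthant. *)
Lemma weight_ratio_integral (y : 'rV[R]_n) (e : R) : 0 < e ->
  (\int[mu]_(x in ball y e)
     (th x / fine (\int[mu]_(z in ball x e) (th z)%:E)%E)%:E <= (2 ^+ n)%:E)%E.
Proof.
move=> e0.
pose Th x := fine (\int[mu]_(z in ball x e) (th z)%:E)%E.
rewrite -[X in (X <= _)%E]/(\int[mu]_(x in ball y e) (th x / Th x)%:E)%E.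
have mTh : measurable_fun setT Th.
  apply: measurableT_comp => //.
  by apply: measurable_ball_integral => // x; exact: ltW.
have Thf (x : 'rV[R]_n) : (\int[mu]_(z in ball x e) (th z)%:E)%E \is a fin_num.
  rewrite ge0_fin_numE; last by apply: integral_ge0 => z _; rewrite lee_fin ltW.
  by apply: (th_bounded hw _ (@ball_sub_ball0 _ _ x e)); exact: measurable_ball_rV.
have Th0 x : 0 <= Th x.
  by apply: fine_ge0; apply: integral_ge0 => z _; rewrite lee_fin ltW.
have q0 x : 0 <= th x / Th x by rewrite divr_ge0// ltW.
have mq : measurable_fun setT (fun x => th x / Th x).
  by apply: measurable_funM => //; exact: measurable_fun_inv_pos.
have mO s := measurable_orthant y e s.
apply: (@le_trans _ _ (\sum_(s : {ffun 'I_n -> bool}) \int[mu]_(x in orthant y e s) (th x / Th x)%:E)%E).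
  under eq_bigr do rewrite integral_mkcond.
  rewrite -ge0_integral_sum//; last 2 first.
  - move=> s; rewrite -(measurable_restrictT _ (mO s)).
    by apply/measurable_EFinP; exact: measurable_funTS.
  - by move=> s x _; rewrite patchE; case: ifPn => // _; rewrite lee_fin.
  rewrite [leLHS]integral_mkcond; apply: ge0_le_integral_nomeas => x _.
    by rewrite patchE; case: ifPn => // _; rewrite lee_fin.
  rewrite [leLHS]patchE; case: ifPn => [/set_mem xB|_]; last first.
    by apply: sume_ge0 => s _; rewrite patchE; case: ifPn => // _; rewrite lee_fin.
  pose s := [ffun i => y ord0 i <= x ord0 i].
  rewrite (bigD1 s)//= [X in (_ <= X + _)%E]patchE ifT; last first.
    by rewrite inE; split => // i; rewrite ffunE.
  by rewrite leeDl//; apply: sume_ge0 => s' _; rewrite patchE; case: ifPn => // _; rewrite lee_fin.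
apply: (@le_trans _ _ (\sum_(s : {ffun 'I_n -> bool}) 1%:E)%E); last first.
  by rewrite sumEFin sumr_const card_ffun card_bool card_ord natrX.
apply: lee_sum => s _.
set O := orthant y e s; set m := (\int[mu]_(x in O) (th x)%:E)%E.
have mfin : m \is a fin_num.
  rewrite ge0_fin_numE; last by apply: integral_ge0 => z _; rewrite lee_fin ltW.
  apply: (th_bounded hw (mO s)); apply: (subset_trans _ (@ball_sub_ball0 _ _ y e)).
  exact: subIsetl.
have m0 : (0 <= m)%E by apply: integral_ge0 => z _; rewrite lee_fin ltW.
have [mpos|] := ltP 0%E m; last first.
  move=> m00; have mE : mu O = 0%E.
    apply/eqP; rewrite eq_le measure_ge0 andbT leNgt; apply/negP => /(th_pos hw (mO s)).
    by rewrite ltNge m00.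
  rewrite (ae_ge0_eq_integral_dom (g := cst 0%E))//.
  - by rewrite integral0 lee01.
  - by move=> x _; rewrite lee_fin.
  - exists O; split; [exact: mO|exact: mE|move=> x /= h].
    by apply: contrapT => nO; apply: h => /nO.
apply: (@le_trans _ _ (\int[mu]_(x in O) ((fine m)^-1%:E * (th x)%:E))%E).
  apply: ge0_le_integral_nomeas => x Ox; first by rewrite lee_fin.
  rewrite -EFinM lee_fin mulrC ler_wpM2r ?(ltW (th0 x))//.
  have fm0 : 0 < fine m by apply: fine_gt0; rewrite mpos -ge0_fin_numE.
  have fmT : fine m <= Th x.
    apply: fine_le => //; apply: ge0_subset_integral => //.
    - exact: mO.
    - exact: measurable_ball_rV.
    - by apply/measurable_EFinP; exact: measurable_funTS.
    - by move=> z _; rewrite lee_fin ltW.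
    - exact: orthant_sub_ball.
  by rewrite lef_pV2 ?posrE// (lt_le_trans fm0).
rewrite ge0_integralZl//.
- rewrite -/m -[X in (_ * X)%E](fineK mfin) -EFinM mulVf// gt_eqF//.
  by apply: fine_gt0; rewrite mpos -ge0_fin_numE.
- exact: mO.
- by apply/measurable_EFinP; exact: measurable_funTS.
- by move=> x _; rewrite lee_fin ltW.
- by rewrite lee_fin invr_ge0 fine_ge0.
Qed.

End cube_average_integrals.

Section cube_average_bound.
Context {R : realType} {n : nat} (p th : 'rV[R]_n -> R) (pm pp K0 : R).
Local Notation mu := (lebesgue_rV n : {measure set 'rV[R]_n -> \bar R}).
Hypothesis hw : regular_weight p th pm pp K0.
Let n0 := rw_n0 hw.
Let pm1 := rw_pm1 hw.
Let p_ge := rw_p_ge hw.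
Let p_le := rw_p_le hw.
Let mp := rw_mp hw.
Let mth := rw_mth hw.
Let th0 := rw_th0 hw.
Let th_loc := rw_th_loc hw.
Let sig_loc := rw_sig_loc hw.
Let K00 := rw_K00 hw.
Let pp1 : 1 < pp. Proof. by rewrite (lt_le_trans pm1)// (le_trans (p_ge 0)). Qed.
Let p1 x : 1 < p x. Proof. exact: lt_le_trans (p_ge x). Qed.
Let M := n%:R * pp.
Let M0 : 0 <= M. Proof. by rewrite mulr_ge0// ltW// (lt_trans ltr01). Qed.

(** The pointwise inequality is integrated against [th]. Its error term is
    integrable by [weight_decay]; in the other term Tonelli's theorem leaves the
    integral bounded in [weight_ratio_integral]. *)
Theorem cube_average_bound : exists2 C : R, 0 < C &
  forall (f : 'rV[R]_n -> R) (e : R), measurable_fun setT f -> (forall y, 0 <= f y) ->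
    (\int[mu]_y (f y `^ p y * th y)%:E <= 1)%E -> 0 < e -> e <= 1 ->
  (\int[mu]_x ((e ^- n * fine (\int[mu]_(y in ball x e) (f y)%:E)%E) `^ p x * th x)%:E
    <= C%:E)%E.
Proof.
have M10 : 0 <= M + 1 by exact: addr_ge0.
have [C C0 pw] := cube_average_pointwise hw M10.
have decay := weight_decay hw.
set E := (\int[mu]_x _)%E in decay.
have E0 : (0 <= E)%E.
  by apply: integral_ge0 => x _; rewrite lee_fin mulr_ge0 ?powR_ge0 ?(ltW (th0 x)).
have Efin : E \is a fin_num by rewrite ge0_fin_numE.
exists (fine E + C * 2 ^+ n).
  by rewrite ltr_wpDl ?fine_ge0// mulr_gt0// exprn_gt0.
move=> f e mf f0 f1 e0 e1.
pose Th x := fine (\int[mu]_(z in ball x e) (th z)%:E)%E.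
have mTh : measurable_fun setT Th.
  apply: measurableT_comp => //.
  by apply: measurable_ball_integral => // x; exact: ltW.
have Th0 x : 0 <= Th x.
  by apply: fine_ge0; apply: integral_ge0 => z _; rewrite lee_fin ltW.
pose q x := th x / Th x.
have q0 x : 0 <= q x by rewrite divr_ge0// ltW.
have mq : measurable_fun setT q.
  by apply: measurable_funM => //; exact: measurable_fun_inv_pos.
pose F y := f y `^ p y * th y.
have F0 y : 0 <= F y by rewrite mulr_ge0 ?powR_ge0// ltW.
have mF : measurable_fun setT F.
  by apply: measurable_funM => //; exact: measurable_fun_powR2.
have [S SE] : exists S : 'rV[R]_n -> R, forall x : 'rV[R]_n,
    (\int[mu]_(y in ball x e) (F y)%:E)%E = (S x)%:E.
  exists (fun x : 'rV[R]_n => fine (\int[mu]_(y in ball x e) (F y)%:E)%E) => x.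
  have I0 : (0 <= \int[mu]_(y in ball x e) (F y)%:E)%E.
    by apply: integral_ge0 => y _; rewrite lee_fin F0.
  have I1 : (\int[mu]_(y in ball x e) (F y)%:E <= 1)%E.
    apply: le_trans f1; apply: ge0_subset_integral => //.
    - exact: measurable_ball_rV.
    - by apply/measurable_EFinP.
    - by move=> y _; rewrite lee_fin F0.
  rewrite fineK; first by [].
  by rewrite (ge0_fin_numE I0) (le_lt_trans I1) ?ltry.
have S0 x : 0 <= S x.
  by rewrite -lee_fin -SE; apply: integral_ge0 => y _; rewrite lee_fin F0.
have mS : measurable_fun setT S.
  apply/measurable_EFinP; rewrite (_ : EFin \o S = fun x : 'rV[R]_n =>
    \int[mu]_(y in ball x e) (F y)%:E)%E; first exact: measurable_ball_integral.
  by apply/funext => x; rewrite SE.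
have mnorm : measurable_fun setT (fun x : 'rV[R]_n => (2 + `|x|) `^ (- (M + 1)) * th x).
  apply: measurable_funM => //; apply: measurable_fun_powR2; last exact: measurable_cst.
  apply: measurable_funD; first exact: measurable_cst.
  by apply: continuous_measurable_rV; exact: norm_continuous.
have qS0 x : 0 <= q x * S x by exact: mulr_ge0.
have mqS : measurable_fun setT (fun x => q x * S x) by exact: measurable_funM.
apply: (@le_trans _ _ (\int[mu]_x (((2 + `|x|) `^ (- (M + 1)) * th x)%:E +
   C%:E * (q x * S x)%:E)%E)%E).
  apply: ge0_le_integral_nomeas => x _.
    by rewrite lee_fin mulr_ge0 ?powR_ge0// ltW.
  rewrite -!EFinM -EFinD lee_fin.
  have [_ h] := pw f x e mf f0 f1 e0 e1.
  apply: (le_trans (ler_wpM2r (ltW (th0 x)) h)); rewrite mulrDl lerD2l.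
  rewrite -/(Th x) [X in C * (fine X / _)](SE x) /q.
  by rewrite le_eqVlt; apply/orP; left; apply/eqP; rewrite /=; ring.
rewrite ge0_integralD//; last 4 first.
- by move=> x _; rewrite lee_fin mulr_ge0 ?powR_ge0// ltW.
- by apply/measurable_EFinP.
- by move=> x _; rewrite -EFinM lee_fin mulr_ge0// ltW.
- by apply: measurable_funeM; apply/measurable_EFinP.
rewrite ge0_integralZl//; last 3 first.
- by apply/measurable_EFinP.
- by move=> x _; rewrite lee_fin.
- by rewrite lee_fin ltW.
rewrite -/E EFinD fineK// leeD2l// EFinM; apply: lee_pmul => //.
- by rewrite lee_fin ltW.
- by apply: integral_ge0 => x _; rewrite lee_fin.
pose ker (z : 'rV[R]_n * 'rV[R]_n) :=
  ((q z.1 * (\1_(ball (0 : 'rV[R]_n) e) (z.1 - z.2)%R * F z.2))%R%:E)%E.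
have mker : measurable_fun setT ker.
  apply/measurable_EFinP; apply: measurable_funM; first exact: measurableT_comp.
  exact: measurable_ball_kernel.
have ker0 z : (0 <= ker z)%E.
  by rewrite lee_fin mulr_ge0// mulr_ge0// indicE.
have -> : (\int[mu]_x (q x * S x)%:E = \int[mu]_x \int[mu]_y ker (x, y))%E.
  apply: eq_integral => x _; rewrite EFinM -SE integral_ballE -ge0_integralZl//.
  - by apply/measurable_EFinP; exact: (measurable_fun_pair2 x (measurable_ball_kernel e mF)).
  - by move=> y _; rewrite lee_fin mulr_ge0// indicE.
  - by rewrite lee_fin.
rewrite (@fubini_tonelli _ _ _ _ _ mu mu ker mker ker0).
apply: (@le_trans _ _ (\int[mu]_y ((2 ^+ n)%:E * (F y)%:E))%E); last first.
  rewrite ge0_integralZl//.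
  - rewrite -[leRHS]mule1; apply: lee_pmul; rewrite ?lee_fin ?exprn_ge0//.
    by apply: integral_ge0 => y _; rewrite lee_fin F0.
  - by apply/measurable_EFinP.
  - by move=> y _; rewrite lee_fin F0.
apply: ge0_le_integral_nomeas => y _; first by apply: integral_ge0.
have -> : (\int[mu]_x ker (x, y) = \int[mu]_x ((F y)%:E * (\1_(ball (0 : 'rV[R]_n) e) (y - x)%R * q x)%:E))%E.
  apply: eq_integral => x _; rewrite /ker/= -EFinM.
  have -> : \1_(ball (0 : 'rV[R]_n) e) (x - y)%R = \1_(ball (0 : 'rV[R]_n) e) (y - x)%R :> R.
    rewrite !indicE; congr (_ %:R); congr (nat_of_bool _).
    by apply/idP/idP => /set_mem /ball_rV h; apply/mem_set/ball_rV; move: h;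
      rewrite !sub0r !normrN distrC.
  by congr (_%:E); ring.
rewrite ge0_integralZl//; last 3 first.
- by apply/measurable_EFinP; exact: (measurable_fun_pair2 y (measurable_ball_kernel e mq)).
- by move=> x _; rewrite lee_fin mulr_ge0// indicE.
- by rewrite lee_fin.
rewrite muleC; apply: lee_pmul => //; rewrite ?lee_fin//.
- by apply: integral_ge0 => x _; rewrite lee_fin mulr_ge0// indicE.
- by rewrite -integral_ballE; exact: (weight_ratio_integral hw).
Qed.

End cube_average_bound.

(** * The modular and the norm *)

Section modular.
Context {R : realType} {n : nat} (p th : 'rV[R]_n -> R) (pm pp K0 : R).
Local Notation mu := (lebesgue_rV n : {measure set 'rV[R]_n -> \bar R}).
Hypothesis hw : regular_weight p th pm pp K0.
Let pm1 := rw_pm1 hw.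
Let p_ge := rw_p_ge hw.
Let p_le := rw_p_le hw.
Let mp := rw_mp hw.
Let mth := rw_mth hw.
Let th0 := rw_th0 hw.
Implicit Types f g : 'rV[R]_n -> R.
Let p1 x : 1 < p x. Proof. exact: lt_le_trans (p_ge x). Qed.
Let p00 x : 0 <= p x. Proof. by rewrite ltW// (lt_trans ltr01). Qed.

Definition modular (f : 'rV[R]_n -> R) : \bar R :=
  (\int[mu]_x (`|f x| `^ p x * th x)%:E)%E.

Arguments modular f%_R.

Lemma modular_ge0 f : (0 <= modular f)%E.
Proof.
by apply: integral_ge0 => x _; rewrite lee_fin mulr_ge0 ?powR_ge0 ?(ltW (th0 x)).
Qed.

Lemma modular_integrand_ge0 f x : 0 <= `|f x| `^ p x * th x.
Proof. by rewrite mulr_ge0 ?powR_ge0 ?(ltW (th0 x)). Qed.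

Lemma measurable_modular_integrand f : measurable_fun setT f ->
  measurable_fun setT (fun x => `|f x| `^ p x * th x).
Proof.
move=> mf; apply: measurable_funM => //; apply: measurable_fun_powR2 => //.
exact: measurableT_comp.
Qed.

Lemma eq_ae_modular f g : f = g %[ae mu] -> modular f = modular g.
Proof.
move=> fg; apply: ae_ge0_eq_integral_dom => [x _|x _|].
- by rewrite lee_fin modular_integrand_ge0.
- by rewrite lee_fin modular_integrand_ge0.
- by apply: filterS fg => x + _; move=> ->.
Qed.

Lemma le_ae_modular f g : {ae mu, forall x, `|f x| <= `|g x|} ->
  (modular f <= modular g)%E.
Proof.
move=> fg; apply: ae_ge0_le_integral_dom => [x _|x _|].
- by rewrite lee_fin modular_integrand_ge0.
- by rewrite lee_fin modular_integrand_ge0.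
- apply: filterS fg => x h _; rewrite lee_fin ler_wpM2r ?(ltW (th0 x))//.
  by apply: ge0_ler_powR; rewrite ?nnegrE.
Qed.

Lemma le_modular f g : (forall x, `|f x| <= `|g x|) -> (modular f <= modular g)%E.
Proof. by move=> fg; apply: le_ae_modular; apply: aeW. Qed.

Lemma modularN f : modular (\- f) = modular f.
Proof. by apply: eq_integral => x _; rewrite /= normrN. Qed.

Lemma modularC f g : modular (f \- g) = modular (g \- f).
Proof. by apply: eq_integral => x _; rewrite /= distrC. Qed.

Lemma modularD f g : measurable_fun setT f -> measurable_fun setT g ->
  (modular (f \+ g) <= (2 `^ pp)%:E * (modular f + modular g))%E.
Proof.
move=> mf mg; rewrite -ge0_integralD//; last 4 first.
- by move=> x _; rewrite lee_fin modular_integrand_ge0.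
- by apply/measurable_EFinP; exact: measurable_modular_integrand.
- by move=> x _; rewrite lee_fin modular_integrand_ge0.
- by apply/measurable_EFinP; exact: measurable_modular_integrand.
rewrite -ge0_integralZl//; last 2 first.
- by apply: emeasurable_funD; apply/measurable_EFinP; exact: measurable_modular_integrand.
- by move=> x _; rewrite -EFinD lee_fin addr_ge0 ?modular_integrand_ge0.
apply: ge0_le_integral_nomeas => x _; first by rewrite lee_fin modular_integrand_ge0.
rewrite -EFinD -EFinM lee_fin -mulrDl mulrA ler_wpM2r ?(ltW (th0 x))//.
apply: (le_trans _ (powR_add_le (normr_ge0 _) (normr_ge0 _) (p00 x) (p_le x))).
by apply: ge0_ler_powR; rewrite ?nnegrE ?addr_ge0// ler_normD.
Qed.

Lemma modularB f g : measurable_fun setT f -> measurable_fun setT g ->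
  (modular (f \- g) <= (2 `^ pp)%:E * (modular f + modular g))%E.
Proof.
move=> mf mg; rewrite -(modularN g).
by apply: (modularD mf); exact: measurableT_comp.
Qed.

(** All exponents are at least one, so a small factor comes out at least linearly;
    [modularZ_ge] is the counterpart for large factors and the largest exponent. *)
Lemma modularZ_le (s : R) f : measurable_fun setT f -> 0 <= s -> s <= 1 ->
  (modular (fun x => s * f x)%R <= s%:E * modular f)%E.
Proof.
move=> mf s0 s1; rewrite -ge0_integralZl//; last 2 first.
- by apply/measurable_EFinP; exact: measurable_modular_integrand.
- by move=> x _; rewrite lee_fin modular_integrand_ge0.
- apply: ge0_le_integral_nomeas => x _.
    by rewrite lee_fin; exact: (modular_integrand_ge0 (fun x => s * f x)).
  rewrite -EFinM lee_fin mulrA ler_wpM2r ?(ltW (th0 x))// normrM (ger0_norm s0).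
  rewrite powRM// ler_wpM2r ?powR_ge0//.
  have [->|sn0] := eqVneq s 0; first by rewrite powR0// gt_eqF// (lt_trans ltr01).
  by apply: ge1r_powR; rewrite ?lt_neqAle ?s0 ?s1 ?andbT 1?eq_sym// ltW.
Qed.

Lemma modularZ_ge (s : R) f : measurable_fun setT f -> 1 <= s ->
  (modular (fun x => s * f x)%R <= (s `^ pp)%:E * modular f)%E.
Proof.
move=> mf s1; have s0 : 0 <= s by exact: le_trans s1.
rewrite -ge0_integralZl//; last 3 first.
- by apply/measurable_EFinP; exact: measurable_modular_integrand.
- by move=> x _; rewrite lee_fin modular_integrand_ge0.
- by rewrite lee_fin powR_ge0.
apply: ge0_le_integral_nomeas => x _.
  by rewrite lee_fin; exact: (modular_integrand_ge0 (fun x => s * f x)).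
rewrite -EFinM lee_fin mulrA ler_wpM2r ?(ltW (th0 x))// normrM (ger0_norm s0).
by rewrite powRM// ler_wpM2r ?powR_ge0//; exact: ler_powR.
Qed.

Lemma modular_fin_scale (s : R) f : measurable_fun setT f -> (modular f < +oo)%E ->
  (modular (fun x => s * f x)%R < +oo)%E.
Proof.
move=> mf foo; apply: (@le_lt_trans _ _ (modular (fun x => Num.max 1 `|s| * f x)%R)).
  by apply: le_modular => x; rewrite !normrM ler_wpM2r// [leRHS]ger0_norm le_max ?ler01// lexx orbT.
apply: (le_lt_trans (modularZ_ge mf _)); first by rewrite le_max lexx.
by apply: lte_mul_pinfty => //; rewrite lee_fin powR_ge0.
Qed.

Lemma modular_finB f g : measurable_fun setT f -> measurable_fun setT g ->
  (modular f < +oo)%E -> (modular g < +oo)%E -> (modular (f \- g) < +oo)%E.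
Proof.
move=> mf mg foo goo; apply: (le_lt_trans (modularB mf mg)).
apply: lte_mul_pinfty => //.
exact: (lte_add_pinfty foo goo).
Qed.

(** The factor [th ^ (1 / p)] inside the norm becomes the weight [th]. *)
Lemma wnormE f : wnorm p th f = ereal_inf [set l%:E | l in [set l : R | 0 < l /\
    (modular (fun x => l^-1 * f x)%R <= 1)%E]].
Proof.
rewrite /wnorm /vnorm; congr (ereal_inf [set l%:E | l in _]).
suff e l : 0 < l -> (\int[mu]_(x in setT) (`|f x * th x `^ (p x)^-1 / l| `^ p x)%:E =
    modular (fun x => l^-1 * f x)%R)%E.
  by apply/seteqP; split => l /= [l0 h]; split=> //; move: h; rewrite e.
move=> l0; apply: eq_integral => x _; congr (_%:E).
rewrite mulrAC [f x / l]mulrC normrM powRM//; congr (_ * _).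
rewrite ger0_norm ?powR_ge0// -powRrM mulVf ?powRr1 ?(ltW (th0 x))//.
by rewrite gt_eqF// (lt_trans ltr01).
Qed.

(** If [wnorm f < l <= 1], then [rho (l^-1 * f) <= 1], and multiplication by [l]
    gains a factor [l] by [modularZ_le]. *)
Lemma wnorm_lt_modular f (e : R) : measurable_fun setT f -> e <= 1 ->
  (wnorm p th f < e%:E)%E -> (modular f < e%:E)%E.
Proof.
move=> mf e1; rewrite wnormE => /ereal_inf_lt[_ [l [l0 h] <-]]; rewrite lte_fin => le.
apply: (@le_lt_trans _ _ l%:E); last by rewrite lte_fin.
have -> : f = (fun x => l * (l^-1 * f x)).
  by apply/funext => x; rewrite mulrA divff ?mul1r// gt_eqF.
apply: (le_trans (modularZ_le _ (ltW l0) _)).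
- by apply: measurable_funM => //; exact: measurable_cst.
- by rewrite ltW// (lt_le_trans le).
- by rewrite -[leRHS]mule1 lee_pmul2l.
Qed.

Lemma modular_le_wnorm f (e : R) : measurable_fun setT f -> 0 < e -> e <= 1 ->
  (modular f <= (e `^ pp)%:E)%E -> (wnorm p th f <= e%:E)%E.
Proof.
move=> mf e0 e1 h; rewrite wnormE; apply: ereal_inf_lbound; exists e => //; split => //.
apply: (le_trans (modularZ_ge mf _)); first by rewrite invf_ge1.
have ep : 0 < e `^ pp by exact: powR_gt0.
have -> : 1%E = ((e^-1 `^ pp)%:E * (e `^ pp)%:E)%E :> \bar R.
  by rewrite -EFinM -powRM ?invr_ge0 ?(ltW e0)// mulVf ?gt_eqF// powR1.
by rewrite lee_pmul2l// ?lte_fin ?powR_gt0 ?invr_gt0.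
Qed.

Lemma wnorm_fin_modular f : measurable_fun setT f ->
  (wnorm p th f < +oo)%E <-> (modular f < +oo)%E.
Proof.
move=> mf; split.
  rewrite wnormE => /ereal_inf_lt[_ [l [l0 h] <-]] _.
  have -> : f = (fun x => l * (l^-1 * f x)).
    by apply/funext => x; rewrite mulrA divff ?mul1r// gt_eqF.
  apply: modular_fin_scale; last by rewrite (le_lt_trans h)// ltry.
  by apply: measurable_funM => //; exact: measurable_cst.
move=> foo; have mE : modular f = (fine (modular f))%:E.
  by rewrite fineK// ge0_fin_numE// modular_ge0.
pose l := Num.max 1 (fine (modular f)).
have l1 : 1 <= l by rewrite le_max lexx.
have l0 : 0 < l by exact: lt_le_trans l1.
apply: (@le_lt_trans _ _ l%:E); last by rewrite ltry.
rewrite wnormE; apply: ereal_inf_lbound; exists l => //; split => //.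
apply: (le_trans (modularZ_le mf _ _)); rewrite ?invr_ge0 ?(ltW l0) ?invf_le1//.
by rewrite mE -EFinM lee_fin ler_pdivrMl// mulr1 le_max lexx orbT.
Qed.

Lemma le_ae_wnorm f g : {ae mu, forall x, `|f x| <= `|g x|} ->
  (wnorm p th f <= wnorm p th g)%E.
Proof.
move=> fg; rewrite (wnormE f) (wnormE g).
apply: ereal_inf_le_tmp => _ [l [l0 h] <-].
exists l; last by [].
split; first exact: l0.
apply: (le_trans _ h); apply: le_ae_modular.
by apply: filterS fg => x fgx; rewrite !normrM ler_wpM2l.
Qed.

Lemma eq_ae_wnorm f g : f = g %[ae mu] -> wnorm p th f = wnorm p th g.
Proof.
move=> fg; apply/eqP; rewrite eq_le; apply/andP; split; apply: le_ae_wnorm;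
  by apply: filterS fg => x h; rewrite h.
Qed.

(** [le_powR_weight] at every point. *)
Lemma modular_locally_integrable f (r : R) : measurable_fun setT f ->
  (\int[mu]_(x in ball 0%R r) `|f x|%:E <=
   modular f + \int[mu]_(x in ball 0%R r) (th x `^ (- (p x - 1)^-1))%:E)%E.
Proof.
move=> mf; have mB := @measurable_ball_rV R n 0 r.
have mD : measurable_fun setT (fun y => th y `^ (- (p y - 1)^-1)).
  by apply: measurable_fun_powR2 => //; exact: measurable_neg_exponent hw.
apply: (@le_trans _ _ (\int[mu]_(x in ball 0%R r) ((`|f x| `^ p x * th x)%:E +
   (th x `^ (- (p x - 1)^-1))%:E))%E).
  apply: ge0_le_integral_nomeas => x _; first by rewrite lee_fin.
  by rewrite -EFinD lee_fin; exact: le_powR_weight.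
rewrite ge0_integralD//; last 4 first.
- by move=> x _; rewrite lee_fin modular_integrand_ge0.
- by apply/measurable_EFinP; apply: measurable_funTS; exact: measurable_modular_integrand.
- by move=> x _; rewrite lee_fin powR_ge0.
- by apply/measurable_EFinP; exact: measurable_funTS.
rewrite leeD2r//; apply: ge0_subset_integral => //.
- by apply/measurable_EFinP; exact: measurable_modular_integrand.
- by move=> x _; rewrite lee_fin modular_integrand_ge0.
Qed.

End modular.

(** * Convolution with a compactly supported kernel *)

Section convolution_kernel.
Context {R : realType} {n : nat}.
Local Notation mu := (lebesgue_rV n : {measure set 'rV[R]_n -> \bar R}).
Implicit Types (f g k psi : 'rV[R]_n -> R) (x y : 'rV[R]_n).

Definition borel_locally_integrable f : Prop :=
  measurable_fun setT f /\
  forall r : R, (\int[mu]_(x in ball (0%R : 'rV[R]_n) r) `|f x|%:E < +oo)%E.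

(** The properties of [dilation e phi] on which the estimates depend, stated for
    the sup norm. *)
Record mollifying_kernel k (e Mk : R) : Prop := MollifyingKernel {
  mk_e0 : 0 < e;
  mk_meas : measurable_fun setT k;
  mk_ge0 : forall z : 'rV[R]_n, 0 <= k z;
  mk_le : forall z : 'rV[R]_n, k z <= Mk;
  mk_supp : forall z : 'rV[R]_n, e <= `|z| -> k z = 0;
  mk_even : forall z : 'rV[R]_n, k (- z) = k z;
  mk_mass : \int[mu]_z k z = 1
}.

Lemma EFin_Rintegral (D : set 'rV[R]_n) f : measurable D -> mu.-integrable D (EFin \o f) ->
  (\int[mu]_(x in D) f x)%:E = (\int[mu]_(x in D) (f x)%:E)%E.
Proof. by move=> mD /(integrable_fin_num mD) h; rewrite fineK. Qed.

Lemma borel_locally_integrable_ball f (x : 'rV[R]_n) (r : R) : borel_locally_integrable f ->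
  (\int[mu]_(y in ball x r) `|f y|%:E < +oo)%E.
Proof.
move=> [mf h]; apply: le_lt_trans (h (`|x| + r)).
apply: ge0_subset_integral => //; try exact: measurable_ball_rV.
- by apply/measurable_EFinP; apply: measurable_funTS; exact: measurableT_comp.
- exact: ball_sub_ball0.
Qed.

Lemma ball_integral_le f x (r e : R) : measurable_fun setT f -> ball (0%R : 'rV[R]_n) r x ->
  (\int[mu]_(y in ball x e) `|f y|%:E <= \int[mu]_(y in ball (0%R : 'rV[R]_n) (r + e)) `|f y|%:E)%E.
Proof.
move=> mf xr; apply: ge0_subset_integral => //; try exact: measurable_ball_rV.
- by apply/measurable_EFinP; apply: measurable_funTS; exact: measurableT_comp.
- apply: (subset_trans (@ball_sub_ball0 _ _ x e)); apply: le_ball; rewrite lerD2r ltW//.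
  by move/ball_rV : xr; rewrite sub0r normrN.
Qed.

Lemma integral_abs_ball_fin f x (r : R) : borel_locally_integrable f ->
  (\int[mu]_(y in ball x r) `|f y|%:E)%E \is a fin_num.
Proof.
move=> lf; rewrite ge0_fin_numE; first exact: borel_locally_integrable_ball.
by apply: integral_ge0 => y _; rewrite lee_fin.
Qed.

Lemma borel_locally_integrableB f g : borel_locally_integrable f ->
  borel_locally_integrable g -> borel_locally_integrable (f \- g).
Proof.
move=> [mf hf] [mg hg]; split; first exact: measurable_funB.
move=> r; have mB := @measurable_ball_rV R n 0 r.
apply: (@le_lt_trans _ _ (\int[mu]_(x in ball (0%R : 'rV[R]_n) r) (`|f x|%:E + `|g x|%:E))%E).
  apply: ge0_le_integral_nomeas => x _; first by rewrite lee_fin.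
  by rewrite -EFinD lee_fin ler_normB.
rewrite ge0_integralD//.
- exact: (lte_add_pinfty (hf r) (hg r)).
- by apply/measurable_EFinP; apply: measurable_funTS; exact: measurableT_comp.
- by apply/measurable_EFinP; apply: measurable_funTS; exact: measurableT_comp.
Qed.

Lemma bounded_locally_integrable psi (B : R) : measurable_fun setT psi ->
  (forall x, `|psi x| <= B) -> borel_locally_integrable psi.
Proof.
move=> mpsi hB; split => // r; have mB := @measurable_ball_rV R n 0 r.
apply: (@le_lt_trans _ _ (\int[mu]_(x in ball (0%R : 'rV[R]_n) r) (cst B%:E x))%E).
  by apply: ge0_le_integral_nomeas => x _; rewrite lee_fin.
rewrite integral_cst//; apply: lte_mul_pinfty => //; last exact: ball_fin.
by rewrite lee_fin (le_trans _ (hB 0)).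
Qed.

Lemma integrable_bounded_product f psi (B r : R) : borel_locally_integrable f ->
  measurable_fun setT psi -> (forall x, `|psi x| <= B) ->
  (forall x, r <= `|x| -> psi x = 0) ->
  mu.-integrable setT (fun x => (f x * psi x)%:E).
Proof.
move=> [mf hf] mpsi hB psi0; apply/integrableP; split.
  by apply/measurable_EFinP; exact: measurable_funM.
have B0 : 0 <= B by exact: le_trans (hB 0).
apply: (@le_lt_trans _ _ (B%:E * \int[mu]_(x in ball (0%R : 'rV[R]_n) r) `|f x|%:E)%E).
  rewrite -ge0_integralZl//; last 2 first.
  - exact: measurable_ball_rV.
  - by apply/measurable_EFinP; apply: measurable_funTS; exact: measurableT_comp.
  rewrite [leRHS]integral_mkcond; apply: ge0_le_integral_nomeas => x _ //.
  rewrite patchE; case: ifPn => [_|/negP xr].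
    by rewrite -EFinM lee_fin normrM mulrC ler_wpM2r.
  rewrite psi0 ?mulr0 ?abse0// leNgt; apply/negP => h; apply: xr.
  by apply/mem_set/ball_rV; rewrite sub0r normrN.
by apply: lte_mul_pinfty.
Qed.

Section kernel.
Variables (k : 'rV[R]_n -> R) (e Mk : R).
Hypothesis hk : mollifying_kernel k e Mk.
Let e0 := mk_e0 hk.
Let mk := mk_meas hk.
Let k0 := mk_ge0 hk.

Lemma mk_bound_ge0 : 0 <= Mk. Proof. exact: le_trans (k0 0) (mk_le hk 0). Qed.

Lemma measurable_kernel_product f : measurable_fun setT f ->
  measurable_fun setT (fun z : 'rV[R]_n * 'rV[R]_n => k (z.1 - z.2) * f z.2).
Proof.
move=> mf; apply: measurable_funM; last exact: measurableT_comp.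
exact: (measurableT_comp mk measurable_subr_rV).
Qed.

Lemma measurable_kernel_product2 f x : measurable_fun setT f ->
  measurable_fun setT (fun y => k (x - y) * f y).
Proof. by move=> mf; exact: (measurable_fun_pair2 x (measurable_kernel_product mf)). Qed.

Lemma kernel_product_le f (x : 'rV[R]_n) :
  measurable_fun setT f ->
  (\int[mu]_y `|k (x - y)%R * f y|%:E <= Mk%:E * \int[mu]_(y in ball x e) `|f y|%:E)%E.
Proof.
move=> mf; rewrite -ge0_integralZl//; last 3 first.
- exact: measurable_ball_rV.
- by apply/measurable_EFinP; apply: measurable_funTS; exact: measurableT_comp.
- by rewrite lee_fin mk_bound_ge0.
rewrite [leRHS]integral_mkcond; apply: ge0_le_integral_nomeas => y _.
  by rewrite lee_fin.
rewrite patchE; case: ifPn => [_|/negP xy].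
  by rewrite -EFinM lee_fin normrM ler_wpM2r// ger0_norm// (mk_le hk).
rewrite (mk_supp hk) ?mul0r ?normr0// leNgt; apply/negP => h; apply: xy.
exact/mem_set/ball_rV.
Qed.

Lemma kernel_product_integrable f x : borel_locally_integrable f ->
  mu.-integrable setT (EFin \o (fun y => k (x - y) * f y)).
Proof.
move=> lf; have [mf _] := lf; apply/integrableP; split.
  by apply/measurable_EFinP; exact: measurable_kernel_product2.
apply: (le_lt_trans (kernel_product_le x mf)).
apply: lte_mul_pinfty; [by rewrite lee_fin mk_bound_ge0|by []|].
exact: borel_locally_integrable_ball.
Qed.

Lemma convolution_le f x : borel_locally_integrable f ->
  `|convolution k f x| <= Mk * fine (\int[mu]_(y in ball x e) `|f y|%:E)%E.
Proof.
move=> lf; have [mf _] := lf.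
have i := kernel_product_integrable x lf.
apply: (le_trans (le_normr_Rintegral measurableT i)).
set I := (\int[mu]_(y in ball x e) `|f y|%:E)%E.
have Ifin : I \is a fin_num by exact: integral_abs_ball_fin.
have P0 : (0 <= \int[mu]_y `|k (x - y)%R * f y|%:E)%E.
  by apply: integral_ge0 => y _; rewrite lee_fin.
have Pfin : (\int[mu]_y `|k (x - y)%R * f y|%:E)%E \is a fin_num.
  by rewrite (ge0_fin_numE P0); case/integrableP: i.
rewrite -lee_fin EFinM (fineK Ifin) /Rintegral (fineK Pfin).
exact: kernel_product_le.
Qed.

Lemma convolutionB f g x : borel_locally_integrable f -> borel_locally_integrable g ->
  convolution k (f \- g) x = convolution k f x - convolution k g x.
Proof.
move=> lf lg; rewrite /convolution -RintegralB//; try exact: kernel_product_integrable.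
by apply: eq_Rintegral => y _; rewrite /= mulrBr.
Qed.

Lemma measurable_convolution f : measurable_fun setT f ->
  measurable_fun setT (convolution k f).
Proof.
move=> mf; pose F (z : 'rV[R]_n * 'rV[R]_n) := (k (z.1 - z.2) * f z.2)%:E : \bar R.
have mF : measurable_fun setT F by apply/measurable_EFinP; exact: measurable_kernel_product.
have -> : convolution k f = fine \o
  (fun x => fubini_F mu F^\+ x - fubini_F mu F^\- x)%E.
  apply/funext => x; rewrite /convolution /Rintegral/=; congr fine.
  by rewrite integralE; congr (_ - _)%E; apply: eq_integral => y _;
    rewrite ?funeposE ?funenegE.
apply: measurableT_comp => //; apply: emeasurable_funB.
- by apply: measurable_fun_fubini_tonelli_F; [exact: measurable_funepos|move=> z; exact: funepos_ge0].
- by apply: measurable_fun_fubini_tonelli_F; [exact: measurable_funeneg|move=> z; exact: funeneg_ge0].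
Qed.

Lemma borel_locally_integrable_convolution f : borel_locally_integrable f ->
  borel_locally_integrable (convolution k f).
Proof.
move=> lf; have [mf hf] := lf; split; first exact: measurable_convolution.
move=> r; have Ifin := integral_abs_ball_fin 0 (r + e) lf.
set I := (\int[mu]_(y in ball (0%R : 'rV[R]_n) (r + e)) `|f y|%:E)%E in Ifin.
have I0 : 0 <= fine I by apply: fine_ge0; apply: integral_ge0 => y _; rewrite lee_fin.
apply: (@le_lt_trans _ _ (\int[mu]_(x in ball (0%R : 'rV[R]_n) r) (cst (Mk * fine I)%:E x))%E).
  apply: ge0_le_integral_nomeas => x xr; rewrite lee_fin//.
  apply: (le_trans (convolution_le x lf)); apply: ler_wpM2l; first exact: mk_bound_ge0.
  by apply: (fine_le _ Ifin); [exact: integral_abs_ball_fin|exact: ball_integral_le].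
rewrite integral_cst; last exact: measurable_ball_rV.
apply: lte_mul_pinfty; [|by []|exact: ball_fin].
by rewrite lee_fin mulr_ge0 ?mk_bound_ge0.
Qed.

Lemma convolution_supp psi (r : R) x : (forall y, r <= `|y| -> psi y = 0) ->
  r + e <= `|x| -> convolution k psi x = 0.
Proof.
move=> psi0 xr; rewrite /convolution; transitivity (\int[mu]_y (0 : R)); last first.
  by rewrite /Rintegral integral0.
apply: eq_Rintegral => y _; have [ry|yr] := leP r `|y|; first by rewrite psi0 ?mulr0.
rewrite (mk_supp hk) ?mul0r// -(lerD2l `|y|).
apply: (@le_trans _ _ `|x|); first by rewrite (le_trans _ xr)// lerD2r ltW.
by rewrite -[X in `|X| <= _](subrK y) addrC ler_normD.
Qed.

(** Fubini's theorem; evenness identifies [k (x - y)] with [k (y - x)]. *)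
Lemma convolution_symmetric f psi (B r : R) : borel_locally_integrable f ->
  measurable_fun setT psi -> (forall x, `|psi x| <= B) ->
  (forall x, r <= `|x| -> psi x = 0) ->
  \int[mu]_x (convolution k f x * psi x) = \int[mu]_y (f y * convolution k psi y).
Proof.
move=> lf mpsi hB psi0; have [mf hf] := lf.
have lpsi := bounded_locally_integrable mpsi hB.
pose F (z : 'rV[R]_n * 'rV[R]_n) := (k (z.1 - z.2) * f z.2 * psi z.1)%:E : \bar R.
have mF : measurable_fun setT F.
  apply/measurable_EFinP; apply: measurable_funM; last exact: measurableT_comp.
  exact: measurable_kernel_product.
have iF : (lebesgue_rV n \x lebesgue_rV n)%E.-integrable setT F.
  apply/(integrable12ltyP (lebesgue_rV n) (lebesgue_rV n) mF).
  have lcf : borel_locally_integrable (fun x => fine (\int[mu]_y `|k (x - y)%R * f y|%:E)%E).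
    pose G (z : 'rV[R]_n * 'rV[R]_n) := (`|k (z.1 - z.2)%R * f z.2|%:E)%E : \bar R.
    have mG : measurable_fun setT G.
      by apply/measurable_EFinP; apply: measurableT_comp => //; exact: measurable_kernel_product.
    split.
      apply: measurableT_comp => //.
      rewrite (_ : (fun x => _) = fubini_F mu G)//.
      by apply: measurable_fun_fubini_tonelli_F => // z; rewrite lee_fin.
    move=> s; have Ifin := integral_abs_ball_fin 0 (s + e) lf.
    set I := (\int[mu]_(y in ball (0%R : 'rV[R]_n) (s + e)) `|f y|%:E)%E in Ifin.
    have I0 : 0 <= fine I by apply: fine_ge0; apply: integral_ge0 => y _; rewrite lee_fin.
    apply: (@le_lt_trans _ _ (\int[mu]_(x in ball (0%R : 'rV[R]_n) s) (cst (Mk * fine I)%:E x))%E).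
      apply: ge0_le_integral_nomeas => x xs; rewrite lee_fin//.
      have P0 : (0 <= \int[mu]_y `|k (x - y)%R * f y|%:E)%E by apply: integral_ge0 => y _; rewrite lee_fin.
      have Q : (\int[mu]_y `|k (x - y)%R * f y|%:E <= (Mk * fine I)%:E)%E.
        apply: (le_trans (kernel_product_le x mf)); rewrite EFinM (fineK Ifin).
        apply: lee_pmul.
        - by rewrite lee_fin mk_bound_ge0.
        - by apply: integral_ge0 => y _; rewrite lee_fin.
        - exact: lexx.
        - exact: ball_integral_le.
      rewrite ger0_norm; last exact: fine_ge0.
      rewrite -lee_fin fineK; first exact: Q.
      by rewrite (ge0_fin_numE P0) (le_lt_trans Q)// ltry.
    rewrite integral_cst; last exact: measurable_ball_rV.
    apply: lte_mul_pinfty; [|by []|exact: ball_fin].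
    by rewrite lee_fin mulr_ge0 ?mk_bound_ge0.
  have /integrableP[_] := integrable_bounded_product lcf mpsi hB psi0.
  apply: le_lt_trans; apply: ge0_le_integral_nomeas => x _.
    by apply: integral_ge0 => y _; exact: abse_ge0.
  have P0 : (0 <= \int[mu]_y `|k (x - y)%R * f y|%:E)%E by apply: integral_ge0 => y _; rewrite lee_fin.
  have Pfin : (\int[mu]_y `|k (x - y)%R * f y|%:E)%E \is a fin_num.
    rewrite (ge0_fin_numE P0).
    by have /integrableP[_] := kernel_product_integrable x lf.
  rewrite /= normrM [X in (_ <= (X * _)%:E)%E]ger0_norm ?fine_ge0// EFinM fineK// muleC.
  rewrite -ge0_integralZl//.
  - apply: ge0_le_integral_nomeas => y _; first by rewrite lee_fin.
    by rewrite -EFinM lee_fin normrM mulrC.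
  - by apply/measurable_EFinP; apply: measurableT_comp => //; exact: measurable_kernel_product2.
have := Fubini iF; rewrite /F/=.
have -> : (\int[mu]_x \int[mu]_y (k (x - y)%R * f y * psi x)%:E =
    \int[mu]_x (convolution k f x * psi x)%:E)%E.
  apply: eq_integral => x _; rewrite -RintegralZr//; last exact: kernel_product_integrable.
  rewrite EFin_Rintegral//.
  have := integrableZr measurableT (psi x) (kernel_product_integrable x lf).
  by apply: eq_integrable => // y _ /=; rewrite EFinM.
have -> : (\int[mu]_y \int[mu]_x (k (x - y)%R * f y * psi x)%:E =
    \int[mu]_y (f y * convolution k psi y)%:E)%E.
  apply: eq_integral => y _; rewrite -RintegralZl//; last exact: kernel_product_integrable.
  rewrite EFin_Rintegral//; last first.
    have := integrableZl measurableT (f y) (kernel_product_integrable y lpsi).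
    by apply: eq_integrable => // x _ /=; rewrite EFinM.
  apply: eq_integral => x _; congr (_%:E).
  by rewrite -(mk_even hk) opprB; ring.
by rewrite /Rintegral => ->.
Qed.

End kernel.

End convolution_kernel.

(** * Test functions *)

Section test_functions.
Context {R : realType} {n : nat}.
Local Notation mu := (lebesgue_rV n : {measure set 'rV[R]_n -> \bar R}).
Implicit Types (f g psi : 'rV[R]_n -> R) (x y v : 'rV[R]_n).

Lemma derive_rVP f x v (l : R) :
  (forall eta, 0 < eta -> exists2 d, 0 < d & forall h, h != 0 -> `|h| < d ->
     `|h^-1 * (f (h *: v + x) - f x) - l| <= eta) <->
  (derivable f x v /\ 'D_v f x = l).
Proof.
rewrite /derivable /derive; split=> [H|[hc hl]].
  have hcv : h^-1 *: ((f \o shift x) (h *: v) - f x) @[h --> 0^'] --> l.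
    apply/cvgrPdist_le => eta eta0; have [d d0 hd] := H eta eta0.
    apply/nbhs_ballP; exists d => //= h; rewrite -ball_normE/= sub0r normrN => hdl h0.
    by rewrite distrC; exact: hd.
  by split; [apply/cvg_ex; exists l|exact/cvg_lim].
have : h^-1 *: ((f \o shift x) (h *: v) - f x) @[h --> 0^'] --> l by rewrite -hl.
move=> hcv eta eta0; move/cvgrPdist_le : hcv => /(_ _ eta0) /nbhs_ballP[d /= d0 hd].
exists d => // h h0 hdl; rewrite distrC; apply: hd => //.
by rewrite -ball_normE/= sub0r normrN.
Qed.

Lemma compact_unif_continuous f (r : R) : continuous f ->
  (forall y, r <= `|y| -> f y = 0) -> forall eta, 0 < eta ->
  exists2 d, 0 < d & forall x y, `|x - y| < d -> `|f x - f y| < eta.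
Proof.
move=> /continuous_rVP cf f0 eta eta0.
have /compact_near_coveringP := @compact_closed_ball0 R n (r + 1).
move=> /(_ R (0^'+) (fun d x => forall y, `|x - y| < d -> `|f x - f y| < eta) _) [].
  move=> x _; have [d d0 hd] := cf x (eta / 2) (divr_gt0 eta0 (ltr0Sn _ 1)).
  have d2 : d / 2 <= d by rewrite ler_pdivrMr// ler_peMr ?(ltW d0)// ler1n.
  exists (ball x (d / 2), [set t | t < d / 2]) => /=.
    split; first by apply: nbhsx_ballx; rewrite divr_gt0.
    by apply: nbhs_right_lt; rewrite divr_gt0.
  move=> [x' t] /= [/ball_rV xx' td] y x'y.
  rewrite -(subrKA (f x)) (splitr eta) (le_lt_trans (ler_normD _ _))// ltrD//.
    by rewrite distrC hd// (lt_le_trans xx').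
  rewrite hd// -(subrKA x') (splitr d) (le_lt_trans (ler_normD _ _))// ltrD//.
  exact: lt_trans td.
move=> d /= d0 hd; exists (Num.min (d / 2) 1); first by rewrite lt_min divr_gt0/=.
move=> x y; rewrite lt_min => /andP[xyd xy1].
have [xr|rx] := leP `|x| (r + 1).
  apply: (hd (d / 2)) => //=; last by rewrite divr_gt0.
  by rewrite sub0r normrN gtr0_norm ?divr_gt0// ltr_pdivrMr// ltr_pMr// ltr1n.
rewrite !f0 ?subrr ?normr0//.
  rewrite -(lerD2r 1); apply: (le_trans (ltW rx)).
  rewrite -[X in `|X| <= _](subrK y) addrC (le_trans (ler_normD _ _))// lerD2l.
  by rewrite ltW.
by rewrite (le_trans _ (ltW rx))// lerDl.
Qed.

Lemma vanish_compact_supp f (r : R) : (forall y, r <= `|y| -> f y = 0) ->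
  compact (closure [set x | f x != 0]).
Proof.
move=> f0; apply: (subclosed_compact _ (@compact_closed_ball0 R n r)); first exact: closed_closure.
have cl : closed [set x : 'rV[R]_n | `|x| <= r].
  by apply: closed_comp (@closed_le R r) => x _; exact: norm_continuous.
move=> x hx; rewrite ((closure_id _).1 cl); apply: closureS hx => y /= fy.
by rewrite leNgt; apply/negP => /ltW/f0/eqP; rewrite (negbTE fy).
Qed.

Lemma test_function_vanish psi : test_function psi ->
  exists2 r : R, 0 < r & forall y, r <= `|y| -> psi y = 0.
Proof.
move=> [_ /compact_sub_ball[r r0 hr]]; exists r => // y ry.
apply/eqP/negPn/negP => py; have /hr/ball_rV : closure [set x | psi x != 0] y.
  exact: subset_closure.
by rewrite sub0r normrN ltNge ry.
Qed.

Lemma partial_vanish psi i (r : R) : (forall y, r <= `|y| -> psi y = 0) ->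
  forall y, r + 1 <= `|y| -> partial i psi y = 0.
Proof.
move=> psi0 y ry; apply: (proj2 (proj1 (derive_rVP psi y (delta_mx ord0 i) 0) _)).
move=> eta eta0; exists 1 => // h h0 h1.
have ry' : r <= `|y| by rewrite (le_trans _ ry)// lerDl.
suff ry2 : r <= `|h *: delta_mx ord0 i + y|.
  by rewrite !psi0// !subrr mulr0 subr0 normr0 ltW.
have : `|h *: delta_mx ord0 i : 'rV[R]_n| <= 1.
  apply/rV_norm_le => // j; rewrite !mxE normrM.
  by rewrite eqxx /=; case: (j == i); rewrite ?normr1 ?normr0 ?mulr1 ?mulr0// ltW.
have := ler_normB (h *: delta_mx ord0 i + y) (h *: delta_mx ord0 i : 'rV[R]_n).
by rewrite [_ + y]addrC addrK; lra.
Qed.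

Lemma test_function_foldr psi (s : seq 'I_n) : test_function psi ->
  test_function (foldr partial psi s).
Proof.
move=> tpsi; have [sm _] := tpsi; split.
  by move=> t; rewrite -foldr_cat; exact: sm.
suff [r hr] : exists r : R, forall y, r <= `|y| -> foldr partial psi s y = 0.
  exact: vanish_compact_supp hr.
elim: s => [|i s [r hr]] /=.
  by have [r _ hr] := test_function_vanish tpsi; exists r.
by exists (r + 1); exact: partial_vanish.
Qed.

Lemma test_function_partial psi i : test_function psi -> test_function (partial i psi).
Proof. by move=> h; exact: (test_function_foldr [:: i] h). Qed.

Lemma test_function_continuous psi : test_function psi -> continuous psi.
Proof. by move=> [sm _]; have [] := sm [::]. Qed.

Lemma test_function_measurable psi : test_function psi -> measurable_fun setT psi.
Proof. by move=> h; apply: continuous_measurable_rV; exact: test_function_continuous. Qed.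

Lemma test_function_derivable psi i x : test_function psi ->
  derivable psi x (delta_mx ord0 i).
Proof. by move=> [sm _]; have [_] := sm [::]; exact. Qed.

Lemma test_function_partialP psi i x : test_function psi ->
  forall eta, 0 < eta -> exists2 d, 0 < d & forall h, h != 0 -> `|h| < d ->
   `|h^-1 * (psi (h *: delta_mx ord0 i + x) - psi x) - partial i psi x| <= eta.
Proof.
move=> tpsi; apply/derive_rVP; split => //; exact: test_function_derivable.
Qed.

Lemma test_function_bounded psi : test_function psi ->
  exists B : R, forall y, `|psi y| <= B.
Proof.
move=> tpsi; have [r r0 psi0] := test_function_vanish tpsi.
have : compact (psi @` [set x : 'rV[R]_n | `|x| <= r]).
  apply: continuous_compact; last exact: compact_closed_ball0.
  by apply: continuous_subspaceT; exact: test_function_continuous.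
move=> /compact_bounded[M [_ hM]]; exists (`|M| + 1) => y.
have [yr|ry] := leP `|y| r; last by rewrite psi0 ?normr0 ?ltW// ltr_wpDl.
apply: (hM (`|M| + 1)); last by exists y.
by rewrite (le_lt_trans (ler_norm _))// ltrDl.
Qed.

(** [D] is a candidate for the family of iterated partial derivatives; it spares
    the computation of [foldr partial f]. *)
Lemma test_functionP f (D : seq 'I_n -> 'rV[R]_n -> R) (r : R) :
  (forall y, r <= `|y| -> f y = 0) -> D [::] = f ->
  (forall s, continuous (D s)) ->
  (forall s i x, derivable (D s) x (delta_mx ord0 i) /\
     'D_(delta_mx ord0 i) (D s) x = D (i :: s) x) ->
  test_function f.
Proof.
move=> f0 D0 cD dD; split; last exact: vanish_compact_supp f0.
have E s : foldr partial f s = D s.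
  elim: s => [//|i s IH] /=; rewrite IH /partial; apply/funext => x.
  by have [] := dD s i x.
by move=> s; rewrite E; split => // i x; have [] := dD s i x.
Qed.

Lemma test_function_affine psi (c : R) (b : 'rV[R]_n) : test_function psi -> c != 0 ->
  test_function (fun y => psi (c *: y + b)).
Proof.
move=> tpsi c0; have [r r0 psi0] := test_function_vanish tpsi.
have cp : 0 < `|c| by rewrite normr_gt0.
pose D (s : seq 'I_n) y := c ^+ size s * foldr partial psi s (c *: y + b).
apply: (@test_functionP _ D ((r + `|b|) / `|c|)).
- move=> y; rewrite ler_pdivrMr// => h; apply: psi0.
  have := ler_normB (c *: y + b) b; rewrite addrK normrZ.
  by move: h; rewrite mulrC; lra.
- by apply/funext => y; rewrite /D/= mul1r.
- move=> s; have /continuous_rVP ct := test_function_continuous (test_function_foldr s tpsi).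
  apply/continuous_rVP => x eta eta0.
  have cs : 0 < `|c ^+ size s| by rewrite normr_gt0 expf_neq0.
  have [d d0 hd] := ct (c *: x + b) (eta / `|c ^+ size s|) (divr_gt0 eta0 cs).
  exists (d / `|c|) => [|y xy]; first by rewrite divr_gt0.
  rewrite -mulrBr normrM mulrC -ltr_pdivlMr//; apply: hd.
  by rewrite opprD addrACA subrr addr0 -scalerBr normrZ mulrC -ltr_pdivlMr.
- move=> s i x; apply/derive_rVP => eta eta0.
  have ts := test_function_foldr s tpsi.
  have H := test_function_partialP i (c *: x + b) ts.
  have cs : 0 < `|c ^+ (size s).+1| by rewrite normr_gt0 expf_neq0.
  have [d d0 hd] := H (eta / `|c ^+ (size s).+1|) (divr_gt0 eta0 cs).
  exists (d / `|c|) => [|h h0 hd']; first by rewrite divr_gt0.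
  have := hd (c * h) (mulf_neq0 c0 h0); rewrite normrM mulrC -ltr_pdivlMr// => /(_ hd').
  rewrite ler_pdivlMr// -normrM; congr (`|_| <= _).
  rewrite /D/= -/(partial i (foldr partial psi s) (c *: x + b)).
  rewrite scalerDr addrA scalerA [c ^+ (size s).+1]exprS -mulrBr.
  rewrite /partial mulrBl; congr (_ - _); last by rewrite mulrC.
  by field; rewrite c0 h0.
Qed.

End test_functions.

Section test_convolution.
Context {R : realType} {n : nat}.
Local Notation mu := (lebesgue_rV n : {measure set 'rV[R]_n -> \bar R}).
Implicit Types (f g psi : 'rV[R]_n -> R) (x y v : 'rV[R]_n).

Section kernel.
Variables (k : 'rV[R]_n -> R) (e Mk : R).
Hypothesis hk : mollifying_kernel k e Mk.

Lemma kernel_shift_mass x : \int[mu]_y k (x - y) = 1.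
Proof.
rewrite -(mk_mass hk) [RHS](Rintegral_shift (- x)); last exact: mk_meas hk.
by apply: eq_Rintegral => y _; rewrite -(mk_even hk) opprB.
Qed.

(** A probability kernel does not increase the supremum. *)
Lemma convolution_le_sup psi (B : R) x : measurable_fun setT psi ->
  (forall y, `|psi y| <= B) -> `|convolution k psi x| <= B.
Proof.
move=> mpsi hB; have lpsi := bounded_locally_integrable mpsi hB.
have i := kernel_product_integrable hk x lpsi.
apply: (le_trans (le_normr_Rintegral measurableT i)).
have ik : mu.-integrable setT (EFin \o (fun y => k (x - y))).
  have l1 : borel_locally_integrable (cst 1 : 'rV[R]_n -> R).
    by apply: (@bounded_locally_integrable _ _ _ 1) => // y; rewrite normr1.
  by have := kernel_product_integrable hk x l1; apply: eq_integrable => // y _ /=; rewrite mulr1.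
rewrite -[leRHS]mulr1 -(kernel_shift_mass x) -RintegralZl//.
apply: le_Rintegral => //.
- by have := integrable_norm i; apply: eq_integrable.
- have := integrableZl measurableT B ik; by apply: eq_integrable => // y _ /=; rewrite EFinM.
- by move=> y _; rewrite normrM mulrC (ger0_norm (mk_ge0 hk _)) (ler_wpM2r (mk_ge0 hk _) (hB y)).
Qed.

Lemma convolution_translate psi x v : measurable_fun setT psi ->
  convolution k psi (x + v) = convolution k (fun y => psi (y + v)) x.
Proof.
move=> mpsi; rewrite /convolution (Rintegral_shift v).
  by apply: eq_Rintegral => y _; rewrite opprD addrACA subrr addr0.
exact: (measurable_kernel_product2 hk _ mpsi).
Qed.

Lemma convolutionZ psi c x : borel_locally_integrable psi ->
  convolution k (fun y => c * psi y) x = c * convolution k psi x.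
Proof.
move=> lpsi; rewrite /convolution -RintegralZl//; last exact: (kernel_product_integrable hk _ lpsi).
by apply: eq_Rintegral => y _; rewrite mulrCA.
Qed.

Lemma measurable_translate psi v : measurable_fun setT psi ->
  measurable_fun setT (fun y => psi (y + v)).
Proof.
move=> mpsi; rewrite (_ : (fun y => _) = psi \o (fun y => 1 *: y + v)).
  exact: (measurableT_comp mpsi (measurable_affine 1 v)).
by apply/funext => y /=; rewrite scale1r.
Qed.

(** The mean value theorem turns difference quotients of a test function into
    values of its partial derivative at a nearby point. *)
Lemma test_function_mvt psi i x (h : R) : test_function psi ->
  exists2 c : R, `|c| <= `|h| & psi (h *: delta_mx ord0 i + x) - psi x =
     partial i psi (c *: delta_mx ord0 i + x) * h.
Proof.
move=> tpsi; set v := delta_mx ord0 i.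
pose g (t : R) := psi (t *: v + x).
have dg (t : R) : is_derive t (1 : R) g (partial i psi (t *: v + x)).
  have E : (fun s : R => s^-1 *: ((g \o shift t) (s *: 1) - g t)) =
      (fun s : R => s^-1 *: ((psi \o shift (t *: v + x)) (s *: v) - psi (t *: v + x))).
    apply/funext => s /=; congr (_ *: (psi _ - _)).
    by rewrite [s *: 1]mulr1 scalerDl addrA.
  split; last by rewrite /derive E.
  by rewrite /derivable E; exact: test_function_derivable.
have cg : continuous g.
  move=> t; apply: differentiable_continuous; apply/derivable1_diffP.
  by have [] := dg t.
have [h0|h0] := leP 0 h.
  have [c] := MVT_segment h0 (fun t _ => dg t) (continuous_subspaceT cg).
  rewrite in_itv/= => /andP[c0 ch]; rewrite /g scale0r add0r subr0 => ->.
  by exists c => //; rewrite !ger0_norm.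
have [c] := MVT_segment (ltW h0) (fun t _ => dg t) (continuous_subspaceT cg).
rewrite in_itv/= => /andP[hc c0]; rewrite /g scale0r add0r sub0r => E.
exists c; first by rewrite !ler0_norm ?(ltW h0)// lerN2.
by rewrite -opprB E mulrN opprK.
Qed.

Lemma delta_norm (i : 'I_n) (t : R) : `|t *: delta_mx ord0 i : 'rV[R]_n| <= `|t|.
Proof.
apply/rV_norm_le => // j; rewrite !mxE normrM eqxx /=.
by case: (j == i); rewrite ?normr1 ?normr0 ?mulr1 ?mulr0.
Qed.

Lemma test_function_locally_integrable psi : test_function psi ->
  borel_locally_integrable psi.
Proof.
move=> tpsi; have [B hB] := test_function_bounded tpsi.
exact: bounded_locally_integrable (test_function_measurable tpsi) hB.
Qed.

Lemma test_function_unif psi : test_function psi -> forall eta, 0 < eta ->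
  exists2 d, 0 < d & forall x y, `|x - y| < d -> `|psi x - psi y| < eta.
Proof.
move=> tpsi; have [r _ psi0] := test_function_vanish tpsi.
exact: compact_unif_continuous (test_function_continuous tpsi) psi0.
Qed.

Lemma test_convolution_continuous psi : test_function psi ->
  continuous (convolution k psi).
Proof.
move=> tpsi; have mpsi := test_function_measurable tpsi.
have lpsi := test_function_locally_integrable tpsi.
apply/continuous_rVP => x eta eta0.
have eta20 : 0 < eta / 2 by rewrite divr_gt0.
have [d d0 hd] := test_function_unif tpsi eta20.
exists d => // y xy.
have [B hB] := test_function_bounded tpsi.
have lt : borel_locally_integrable (fun z => psi (z + (y - x))).
  exact: bounded_locally_integrable (measurable_translate _ mpsi) (fun z => hB _).
rewrite -[X in convolution k psi X](subrK x) in |- *.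
rewrite [X in `|_ - convolution k psi X|](_ : y = x + (y - x)); last by rewrite addrC subrK.
rewrite subrK convolution_translate// -(convolutionB hk)//.
apply: (@le_lt_trans _ _ (eta / 2)); last by rewrite ltr_pdivrMr// ltr_pMr// ltr1n.
apply: convolution_le_sup; first by case: (borel_locally_integrableB lpsi lt).
move=> z /=; apply: ltW; apply: hd.
by rewrite opprD addrA subrr sub0r opprB.
Qed.

(** The difference quotients converge uniformly by [test_function_mvt] and uniform
    continuity, so they may be averaged by the kernel. *)
Lemma test_convolution_derivable psi i x : test_function psi ->
  derivable (convolution k psi) x (delta_mx ord0 i) /\
  'D_(delta_mx ord0 i) (convolution k psi) x = convolution k (partial i psi) x.
Proof.
move=> tpsi; have mpsi := test_function_measurable tpsi.
have lpsi := test_function_locally_integrable tpsi.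
have tp := test_function_partial i tpsi.
have lp := test_function_locally_integrable tp.
have [B hB] := test_function_bounded tpsi.
set v := delta_mx ord0 i.
apply/derive_rVP => eta eta0.
have [d d0 hd] := test_function_unif tp eta0.
exists d => // h h0 hdl.
have lt : borel_locally_integrable (fun z => psi (z + h *: v)).
  exact: bounded_locally_integrable (measurable_translate _ mpsi) (fun z => hB _).
rewrite [h *: v + x]addrC convolution_translate// -(convolutionB hk)//.
have lq := borel_locally_integrableB lt lpsi.
rewrite -convolutionZ//.
have lq' : borel_locally_integrable (fun y => h^-1 * ((fun z => psi (z + h *: v)) \- psi) y).
  have -> : (fun y => h^-1 * ((fun z => psi (z + h *: v)) \- psi) y) =
     (fun z => h^-1 * psi (z + h *: v)) \- (fun z => h^-1 * psi z).
    by apply/funext => y /=; rewrite mulrBr.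
  have mh (q : 'rV[R]_n -> R) : measurable_fun setT q -> measurable_fun setT (fun y => h^-1 * q y).
    by move=> mq; apply: measurable_funM => //; exact: measurable_cst.
  apply: borel_locally_integrableB.
  - apply: (@bounded_locally_integrable _ _ _ (`|h^-1| * B)).
      exact: (mh _ (measurable_translate _ mpsi)).
    by move=> y; rewrite normrM ler_wpM2l.
  - apply: (@bounded_locally_integrable _ _ _ (`|h^-1| * B)); first exact: mh.
    by move=> y; rewrite normrM ler_wpM2l.
rewrite -(convolutionB hk)//.
apply: convolution_le_sup; first by case: (borel_locally_integrableB lq' lp).
move=> y /=.
rewrite [y + _]addrC; have [c ch ->] := test_function_mvt i y h tpsi.
rewrite mulrCA mulVf// mulr1; apply: ltW; apply: hd.
by rewrite addrK (le_lt_trans (delta_norm _ _))// (le_lt_trans ch).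
Qed.

Lemma partial_convolution psi i : test_function psi ->
  partial i (convolution k psi) = convolution k (partial i psi).
Proof. by move=> tpsi; apply/funext => x; have [] := test_convolution_derivable i x tpsi. Qed.

Lemma test_function_convolution psi : test_function psi ->
  test_function (convolution k psi).
Proof.
move=> tpsi; have [r r0 psi0] := test_function_vanish tpsi.
apply: (@test_functionP _ _ _ (fun s => convolution k (foldr partial psi s)) (r + e)) => //.
- by move=> y; exact: convolution_supp hk _ _ _ psi0.
- by move=> s; apply: test_convolution_continuous; exact: test_function_foldr.
- by move=> s i x; apply: test_convolution_derivable; exact: test_function_foldr.
Qed.

Lemma test_function_iter_partial psi i m : test_function psi ->
  test_function (iter m (partial i) psi).
Proof. by move=> tpsi; elim: m => //= m IH; exact: test_function_partial. Qed.

Lemma test_function_multi_partial psi a : test_function psi ->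
  test_function (multi_partial a psi).
Proof.
move=> tpsi; rewrite /multi_partial; elim: (enum 'I_n) => //= i s IH.
exact: test_function_iter_partial.
Qed.

Lemma multi_partial_convolution psi a : test_function psi ->
  multi_partial a (convolution k psi) = convolution k (multi_partial a psi).
Proof.
move=> tpsi; rewrite /multi_partial.
suff [] : test_function (foldr (fun i => iter (a i) (partial i)) psi (enum 'I_n)) /\
  foldr (fun i => iter (a i) (partial i)) (convolution k psi) (enum 'I_n) =
  convolution k (foldr (fun i => iter (a i) (partial i)) psi (enum 'I_n)) by [].
elim: (enum 'I_n) => [//|i s [ts IH]] /=; rewrite IH; split.
  exact: test_function_iter_partial.
elim: (a i) => [//|m IHm]; rewrite !iterS IHm partial_convolution//.
exact: test_function_iter_partial.
Qed.

End kernel.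

(** * Weak derivatives *)

Lemma locally_integrable_borel f : locally_integrable_rV f ->
  exists2 g, borel_locally_integrable g & f = g %[ae mu].
Proof.
move=> [[g mg fg] hf]; exists g => //; split => // r.
apply: (@le_lt_trans _ _ (\int[mu]_(x in [set x : 'rV[R]_n | (`|x| <= r)%R]) `|f x|%:E)%E); last first.
  exact: hf (@compact_closed_ball0 R n r).
rewrite integral_mkcond [leRHS]integral_mkcond.
apply: ae_ge0_le_integralT.
- by move=> x; rewrite patchE; case: ifPn => // _; rewrite lee_fin.
- by move=> x; rewrite patchE; case: ifPn => // _; rewrite lee_fin.
- apply: filterS fg => x fgx; rewrite !patchE; case: ifPn => [/set_mem/ball_rV xr|_].
    by rewrite mem_set ?fgx//= -normrN -(sub0r x) ltW.
  by case: ifPn => // _; rewrite lee_fin.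
Qed.

Lemma borel_locally_integrable_rV f g : borel_locally_integrable g -> f = g %[ae mu] ->
  locally_integrable_rV f.
Proof.
move=> [mg hg] fg; split; first by exists g.
move=> K /compact_sub_ball[r r0 Kr]; apply: le_lt_trans (hg r).
rewrite integral_mkcond [leRHS]integral_mkcond.
apply: ae_ge0_le_integralT.
- by move=> x; rewrite patchE; case: ifPn => // _; rewrite lee_fin.
- by move=> x; rewrite patchE; case: ifPn => // _; rewrite lee_fin.
- apply: filterS fg => x fgx; rewrite !patchE; case: ifPn => [/set_mem/Kr xr|_].
    by rewrite mem_set ?fgx.
  by case: ifPn => // _; rewrite lee_fin.
Qed.

Lemma eq_ae_Rintegral_mul f g psi : f = g %[ae mu] ->
  \int[mu]_x (f x * psi x) = \int[mu]_x (g x * psi x).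
Proof. by move=> fg; apply: ae_eq_Rintegral_dom; apply: filterS fg => x h _; rewrite h. Qed.

Lemma eq_ae_convolution k f g : f = g %[ae mu] -> convolution k f = convolution k g.
Proof.
move=> fg; apply/funext => x; apply: ae_eq_Rintegral_dom.
by apply: filterS fg => y h _; rewrite h.
Qed.

(** The kernel is moved to the test function, where it commutes with classical
    derivatives, and back. *)
Lemma weak_derivative_convolution k e Mk a f g : mollifying_kernel k e Mk ->
  weak_derivative a f g ->
  weak_derivative a (convolution k f) (convolution k g).
Proof.
move=> hk [lf lg h].
have [f' lf' ff] := locally_integrable_borel lf.
have [g' lg' gg] := locally_integrable_borel lg.
rewrite (eq_ae_convolution _ ff) (eq_ae_convolution _ gg).
split.
- exact: borel_locally_integrable_rV (borel_locally_integrable_convolution hk lf') (ae_eq_refl _ _ _).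
- exact: borel_locally_integrable_rV (borel_locally_integrable_convolution hk lg') (ae_eq_refl _ _ _).
move=> psi tpsi; have tp := test_function_multi_partial a tpsi.
have [r _ psi0] := test_function_vanish tpsi.
have [B hB] := test_function_bounded tpsi.
have [rp _ p0] := test_function_vanish tp.
have [Bp hBp] := test_function_bounded tp.
rewrite (convolution_symmetric hk lf' (test_function_measurable tp) hBp p0).
rewrite (convolution_symmetric hk lg' (test_function_measurable tpsi) hB psi0).
rewrite -(multi_partial_convolution hk)//.
rewrite -(eq_ae_Rintegral_mul _ ff) -(eq_ae_Rintegral_mul _ gg).
by apply: h; exact: (test_function_convolution hk).
Qed.

(** The defining integrals are linear on Borel representatives. *)
Lemma weak_derivativeB a f1 g1 f2 g2 : weak_derivative a f1 g1 ->
  weak_derivative a f2 g2 -> weak_derivative a (f1 \- f2) (g1 \- g2).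
Proof.
move=> [lf1 lg1 h1] [lf2 lg2 h2].
have [f1' bf1 ff1] := locally_integrable_borel lf1.
have [f2' bf2 ff2] := locally_integrable_borel lf2.
have [g1' bg1 gg1] := locally_integrable_borel lg1.
have [g2' bg2 gg2] := locally_integrable_borel lg2.
have ff : f1 \- f2 = f1' \- f2' %[ae mu].
  by apply: filterS2 ff1 ff2 => x h1' h2' _ /=; rewrite h1'// h2'.
have gg : g1 \- g2 = g1' \- g2' %[ae mu].
  by apply: filterS2 gg1 gg2 => x h1' h2' _ /=; rewrite h1'// h2'.
split.
- exact: borel_locally_integrable_rV (borel_locally_integrableB bf1 bf2) ff.
- exact: borel_locally_integrable_rV (borel_locally_integrableB bg1 bg2) gg.
move=> psi tpsi; rewrite (eq_ae_Rintegral_mul _ ff) (eq_ae_Rintegral_mul _ gg).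
have tp := test_function_multi_partial a tpsi.
have [r _ psi0] := test_function_vanish tpsi.
have [B hB] := test_function_bounded tpsi.
have [rp _ p0] := test_function_vanish tp.
have [Bp hBp] := test_function_bounded tp.
have sub (q q1 q2 : 'rV[R]_n -> R) (Bq rq : R) : borel_locally_integrable q1 -> borel_locally_integrable q2 ->
    measurable_fun setT q -> (forall x, `|q x| <= Bq) -> (forall x, rq <= `|x| -> q x = 0) ->
    \int[mu]_x ((q1 \- q2) x * q x) = \int[mu]_x (q1 x * q x) - \int[mu]_x (q2 x * q x).
  move=> l1 l2 mq hq q0; rewrite -RintegralB//.
  - by apply: eq_Rintegral => x _ /=; rewrite mulrBl.
  - exact: integrable_bounded_product l1 mq hq q0.
  - exact: integrable_bounded_product l2 mq hq q0.
rewrite (sub _ _ _ _ _ bf1 bf2 (test_function_measurable tp) hBp p0).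
rewrite (sub _ _ _ _ _ bg1 bg2 (test_function_measurable tpsi) hB psi0).
rewrite -(eq_ae_Rintegral_mul _ ff1) -(eq_ae_Rintegral_mul _ ff2).
rewrite -(eq_ae_Rintegral_mul _ gg1) -(eq_ae_Rintegral_mul _ gg2).
by rewrite h1// h2// mulrBr.
Qed.

(** * Mollifiers *)

Lemma mollifier_kernel (phi : 'rV[R]_n -> R) (e : R) : mollifier phi -> 0 < e ->
  mollifying_kernel (dilation e phi) e (e ^- n * phi 0).
Proof.
move=> [tphi [phi0 phir phid] supp mass] e0.
have en0 : 0 < e ^+ n by rewrite exprn_gt0.
have mphi := test_function_measurable tphi.
have mdil : measurable_fun setT (fun x => phi (e^-1 *: x)).
  rewrite (_ : (fun x => _) = phi \o (fun x => e^-1 *: x + 0)).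
    exact: (measurableT_comp mphi (measurable_affine e^-1 0)).
  by apply/funext => x /=; rewrite addr0.
split => //.
- by apply: measurable_funM => //; exact: measurable_cst.
- by move=> z; rewrite mulr_ge0// invr_ge0 ltW.
- move=> z; rewrite ler_pM2l ?invr_gt0//; apply: phid.
  by rewrite enorm0 enorm_ge0.
- move=> z ez; rewrite /dilation supp ?mulr0// enormZ gtr0_norm ?invr_gt0//.
  by rewrite ler_pdivlMl// mulr1 (le_trans ez)// norm_le_enorm.
- move=> z; rewrite /dilation; congr (_ * _); apply: phir.
  by rewrite scalerN enormN.
rewrite -mass /Rintegral; congr fine.
have ei0 : 0 < e^-1 by rewrite invr_gt0.
rewrite [RHS](ge0_integral_affine 0 ei0).
- rewrite -ge0_integralZl//.
  + apply: eq_integral => x _; rewrite -EFinM addr0 /dilation exprVn//.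
  + by apply/measurable_EFinP; under eq_fun do rewrite addr0.
  + by move=> x _; rewrite lee_fin.
  + by rewrite lee_fin exprn_ge0// ltW.
- exact/measurable_EFinP.
- by move=> x; rewrite lee_fin.
Qed.

Lemma mollifier_translate (phi : 'rV[R]_n -> R) (e : R) x : mollifier phi -> 0 < e ->
  test_function (fun y => dilation e phi (x - y)).
Proof.
move=> [tphi _ _ _] e0; have ei : - e^-1 != 0 by rewrite oppr_eq0 invr_eq0 gt_eqF.
have t1 := test_function_affine (e^-1 *: x) tphi ei.
have [r r0 t10] := test_function_vanish t1.
pose D s y := e ^- n * foldr partial (fun y => phi (- e^-1 *: y + e^-1 *: x)) s y.
apply: (@test_functionP _ _ _ D r).
- move=> y ry; rewrite /dilation scalerBr addrC -scaleNr t10 ?mulr0//.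
- by apply/funext => y; rewrite /D /dilation/= scalerBr scaleNr addrC.
- move=> s; apply/continuous_rVP => y eta eta0.
  have en0 : 0 < e ^- n by rewrite invr_gt0 exprn_gt0.
  have /continuous_rVP cs := test_function_continuous (test_function_foldr s t1).
  have [d d0 hd] := cs y _ (divr_gt0 eta0 en0).
  exists d => // z yz; rewrite /D -mulrBr normrM gtr0_norm// mulrC -ltr_pdivlMr//.
  exact: hd.
- move=> s i y; have ts := test_function_foldr s t1.
  have [_ /(_ i y) dd] := ts.1 [::].
  by split; [exact: derivableZ|rewrite /D (deriveZ (e ^- n) dd)].
Qed.

End test_convolution.

(** Dominated convergence to zero, in quantitative form. *)
Lemma dominated_small {d} {T : measurableType d} {R : realType}
    (mu : {measure set T -> \bar R}) (f : nat -> T -> R) (g : T -> R) :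
  (forall m, measurable_fun setT (f m)) -> mu.-integrable setT (EFin \o g) ->
  (forall m x, 0 <= f m x <= g x) ->
  {ae mu, forall x, forall eta, 0 < eta -> exists M, forall m, (M <= m)%N -> f m x <= eta} ->
  forall eta, 0 < eta -> exists M, forall m, (M <= m)%N ->
    (\int[mu]_x (f m x)%:E <= eta%:E)%E.
Proof.
move=> mf ig fg f0 eta eta0.
have [|||_ _] := @dominated_convergence _ _ _ mu setT measurableT
   (fun m x => (f m x)%:E) (cst 0%E) (EFin \o g) (fun m => proj2 (measurable_EFinP _ _) (mf m)) (measurable_cst _).
- apply: filterS f0 => x hx _; apply: cvg_EFin; first exact: nearW.
  apply/cvgrPdist_le => e e0; have [M hM] := hx e e0.
  exists M => // m /= Mm; rewrite sub0r normrN ger0_norm ?hM//.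
  by have /andP[] := fg m x.
- exact: ig.
- apply: aeW => x m _ /=; rewrite lee_fin; have /andP[h1 h2] := fg m x.
  by rewrite ger0_norm.
rewrite integral0 => h.
have : nbhs (0%E : \bar R) [set y : \bar R | (y < eta%:E)%E].
  by apply: open_nbhs_nbhs; split; [exact: open_ereal_lt_ereal|rewrite /= lte_fin].
by move=> /h [M _ hM]; exists M => m Mm; apply: ltW; exact: hM.
Qed.

(** * Uniqueness of weak derivatives *)

Section uniqueness.
Context {R : realType} {n : nat}.
Local Notation mu := (lebesgue_rV n : {measure set 'rV[R]_n -> \bar R}).
Implicit Types (f g psi h : 'rV[R]_n -> R) (x y v a b : 'rV[R]_n).

(** The [e]-neighbourhood of the hyperplanes that carry the faces of
    [box a b]. *)
Definition shell a b (e : R) : set 'rV[R]_n :=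
  \bigcup_(i in [set: 'I_n]) ([set x | `|x ord0 i - a ord0 i| < e] `|`
                              [set x | `|x ord0 i - b ord0 i| < e]).

Lemma measurable_shell a b (e : R) : measurable (shell a b e).
Proof.
apply: fin_bigcup_measurable => // i _.
have mc (s : R) : measurable [set x : 'rV[R]_n | `|x ord0 i - s| < e].
  rewrite [X in measurable X](_ : _ =
     (fun x : 'rV[R]_n => `|x ord0 i - s|) @^-1` `]-oo, e[%classic); last first.
    by apply/seteqP; split => x /=; rewrite in_itv.
  rewrite -[X in measurable X]setTI.
  have mf : measurable_fun setT (fun x : 'rV[R]_n => `|x ord0 i - s|).
    apply: measurableT_comp => //; apply: measurable_funB => //.
    exact: measurable_coord_rV.
  exact: mf.
by apply: measurableU; exact: mc.
Qed.

Lemma box_sub_norm_ball a b : box a b `<=` ball (0%R : 'rV[R]_n) (`|a| + `|b| + 1).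
Proof.
move=> x hx; apply/ball_rV; rewrite sub0r normrN.
apply/rV_norm_lt => [|i]; first by rewrite ltr_wpDl// addr_ge0.
have /andP[h1 h2] := hx i.
have := coord_le_norm a i; have := coord_le_norm b i.
rewrite !ler_norml => /andP[b1 b2] /andP[a1 a2]; rewrite ltr_norml.
have := normr_ge0 a; have := normr_ge0 b.
by move=> ? ?; apply/andP; split; lra.
Qed.

(** Off the shell, a point and its [e]-neighbours lie on the same side of
    every face. *)
Lemma box_indic_local a b (e : R) x y : ~ shell a b e x -> ball x e y ->
  \1_(box a b) y = \1_(box a b) x :> R.
Proof.
move=> nx /ball_rV xy; rewrite !indicE; congr (_%:R : R); congr nat_of_bool.
have hi i : (a ord0 i < y ord0 i) = (a ord0 i < x ord0 i) /\
            (y ord0 i <= b ord0 i) = (x ord0 i <= b ord0 i).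
  have : ~ (`|x ord0 i - a ord0 i| < e \/ `|x ord0 i - b ord0 i| < e).
    by move=> hs; apply: nx; exists i.
  move=> /not_orP[/negP + /negP]; rewrite -!leNgt => ha hb.
  have := le_lt_trans (coord_le_norm (x - y) i) xy.
  rewrite !mxE ltr_norml => /andP[h1 h2].
  split.
  - by move: ha; rewrite ler_normr => /orP[ha|ha]; apply/idP/idP => ?; lra.
  - by move: hb; rewrite ler_normr => /orP[hb|hb]; apply/idP/idP => ?; lra.
by apply/idP/idP => /set_mem H; apply/mem_set => i; have := H i;
  have [-> ->] := hi i.
Qed.

(** The kernel has mass one and only sees the ball of radius [e]. *)
Lemma convolution_local k e Mk h x : mollifying_kernel k e Mk ->
  (forall y, ball x e y -> h y = h x) -> convolution k h x = h x.
Proof.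
move=> hk hx; rewrite /convolution.
transitivity (\int[mu]_y (h x * k (x - y))).
  apply: eq_Rintegral => y _; have [xy|xy] := ltP `|x - y| e.
    by rewrite hx 1?mulrC//; apply/ball_rV.
  by rewrite (mk_supp hk)// mul0r mulr0.
rewrite RintegralZl//; first by rewrite (kernel_shift_mass hk) mulr1.
have l1 : borel_locally_integrable (cst 1 : 'rV[R]_n -> R).
  by apply: (@bounded_locally_integrable _ _ _ 1) => // y; rewrite normr1.
by have := kernel_product_integrable hk x l1; apply: eq_integrable => // y _ /=; rewrite mulr1.
Qed.

Lemma indic_bounded (A : set 'rV[R]_n) x : `|\1_A x : R| <= 1.
Proof. by rewrite indicE; case: (_ \in _); rewrite ?normr1 ?normr0. Qed.

Lemma convolution_indic_itv k e Mk (A : set 'rV[R]_n) x :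
  mollifying_kernel k e Mk -> measurable A ->
  0 <= convolution k (\1_A) x <= 1.
Proof.
move=> hk mA; have mi : measurable_fun setT (\1_A : 'rV[R]_n -> R) by exact: measurable_indic.
apply/andP; split.
  by apply: Rintegral_ge0 => y _; rewrite mulr_ge0 ?(mk_ge0 hk)// indicE; case: (_ \in _).
by apply: (le_trans (ler_norm _)); exact: (convolution_le_sup hk x mi (indic_bounded A)).
Qed.

(** Off the shell [convolution_local] applies; on it both functions lie between
    zero and one. *)
Lemma convolution_box_shell k e Mk a b x : mollifying_kernel k e Mk -> e <= 1 ->
  `|convolution k (\1_(box a b)) x - \1_(box a b) x| <=
  \1_(shell a b e `&` ball (0%R : 'rV[R]_n) (`|a| + `|b| + 2)) x.
Proof.
move=> hk e1; have [xs|xs] := pselect (shell a b e x); last first.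
  by rewrite (convolution_local hk) ?subrr ?normr0 ?indicE ?ler0n// => y; exact: box_indic_local.
have [xb|xb] := pselect (ball (0%R : 'rV[R]_n) (`|a| + `|b| + 2) x); last first.
  rewrite (convolution_local hk) ?subrr ?normr0 ?indicE ?ler0n// => y /ball_rV xy.
  have out z : `|x - z| <= 1 -> z \notin box a b.
    move=> xz; apply/negP => /set_mem/box_sub_norm_ball/ball_rV; rewrite sub0r normrN => zb.
    apply: xb; apply/ball_rV; rewrite sub0r normrN.
    have := ler_normD (x - z) z; rewrite subrK; lra.
  rewrite indicE (negbTE (out y _)); last exact: le_trans (ltW xy) e1.
  by rewrite (negbTE (out x _))// subrr normr0.
have /andP[c0 c1] := convolution_indic_itv x hk (measurable_box_rV a b).
rewrite [leRHS]indicE mem_set//= indicE.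
by case: (_ \in _) => /=; rewrite ler_norml; apply/andP; split; lra.
Qed.

(** The shells of a box decrease to a finite union of hyperplanes, which is a
    null set. *)
Lemma shell_integral_small f a b (r eta : R) : borel_locally_integrable f -> 0 < eta ->
  exists2 d : R, 0 < d & forall e, e < d ->
  (\int[mu]_x (`|f x| * \1_(shell a b e `&` ball (0%R : 'rV[R]_n) r) x)%:E <= eta%:E)%E.
Proof.
move=> [mf hf] eta0.
pose A (e : R) := shell a b e `&` ball (0%R : 'rV[R]_n) r.
have mA e : measurable (A e).
  by apply: measurableI; [exact: measurable_shell|exact: measurable_ball_rV].
have mF e : measurable_fun setT (fun x => `|f x| * \1_(A e) x).
  apply: measurable_funM; last exact: measurable_indic.
  exact: measurableT_comp.
have mB := @measurable_ball_rV R n 0 r.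
have ig : mu.-integrable setT (EFin \o (fun x => `|f x| * \1_(ball (0%R : 'rV[R]_n) r) x)).
  apply/integrableP; split.
    apply/measurable_EFinP; apply: measurable_funM; last exact: measurable_indic.
    exact: measurableT_comp.
  apply: le_lt_trans (hf r); rewrite [leRHS]integral_mkcond.
  apply: ge0_le_integral_nomeas => x _ //=.
  rewrite patchE indicE; case: (_ \in _); last by rewrite mulr0 normr0.
  by rewrite mulr1 normr_id.
have dom (m : nat) x : 0 <= `|f x| * \1_(A m.+1%:R^-1) x <= `|f x| * \1_(ball (0%R : 'rV[R]_n) r) x.
  rewrite mulr_ge0 ?indicE ?ler0n//= ler_wpM2l// ler_nat.
  case: (boolP (x \in A _)) => // /set_mem[_ xb]; by rewrite mem_set.
have F0 : {ae mu, forall x, forall eta, 0 < eta -> exists M, forall m, (M <= m)%N ->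
    `|f x| * \1_(A m.+1%:R^-1) x <= eta}.
  have hyp i (s : R) : {ae mu, forall x, x ord0 i != s}.
    exists [set x : 'rV[R]_n | x ord0 i = s]; split.
    - rewrite [X in measurable X](_ : _ = (fun x : 'rV[R]_n => x ord0 i) @^-1` [set s])//.
      by rewrite -[X in measurable X]setTI; exact: measurable_coord_rV.
    - exact: mu_hyperplane.
    - by move=> x /negP; rewrite negbK => /eqP.
  have hall : {ae mu, forall x, forall i, x ord0 i != a ord0 i /\ x ord0 i != b ord0 i}.
    by apply: filter_forall => i; exact: filterI (hyp i (a ord0 i)) (hyp i (b ord0 i)).
  apply: filterS hall => x hx e e0.
  have : \forall m \near \oo, forall i, m.+1%:R^-1 < `|x ord0 i - a ord0 i| /\ m.+1%:R^-1 < `|x ord0 i - b ord0 i|.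
    apply: filter_forall => i; have [h1 h2] := hx i.
    by apply: filterI; apply: near_infty_natSinv_lt (PosNum _); rewrite normr_gt0 subr_eq0.
  move=> [M _ hM]; exists M => m Mm; rewrite indicE memNset ?mulr0 ?ltW//.
  move=> [[i _ [h3|h3]] _] /=; have [h1 h2] := hM m Mm i.
  - by move: (lt_trans h1 h3); rewrite ltxx.
  - by move: (lt_trans h2 h3); rewrite ltxx.
have [M hM] := dominated_small (fun m => mF m.+1%:R^-1) ig dom F0 eta0.
exists M.+1%:R^-1; first by rewrite invr_gt0.
move=> e eM; apply: le_trans (hM M (leqnn _)).
apply: ge0_le_integral_nomeas => x _; rewrite lee_fin; first by rewrite mulr_ge0// indicE ler0n.
rewrite ler_wpM2l// !indicE ler_nat; case: (boolP (x \in A e)) => // /set_mem[xs xb].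
rewrite mem_set//; split => //; move: xs => [i _ xi]; exists i => //.
by move: xi => [xi|xi]; [left|right]; apply: lt_trans xi eM.
Qed.

Section density_measure.
Variable f : 'rV[R]_n -> R.
Hypotheses (mf : measurable_fun setT f) (f0 : forall x, 0 <= f x).

(* The hypotheses are arguments, so that unification recovers the measure
   structure from the term. *)
Definition density_measure of measurable_fun setT f & (forall x, 0 <= f x) :
    set 'rV[R]_n -> \bar R :=
  fun A => (\int[mu]_(x in A) (f x)%:E)%E.
Local Notation dm := (density_measure mf f0).

Let density0 : dm set0 = 0%E.
Proof. by rewrite /density_measure integral_set0. Qed.

Let density_ge0 A : (0 <= dm A)%E.
Proof. by apply: integral_ge0 => x _; rewrite lee_fin. Qed.

Let density_sigma_additive : semi_sigma_additive dm.
Proof.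
move=> G mG tG mUG; rewrite /density_measure ge0_integral_bigcup//.
- by apply: is_cvg_ereal_nneg_natsum_cond => m _ _; exact: density_ge0.
- by apply/measurable_EFinP; apply: measurable_funTS.
- by move=> x _; rewrite lee_fin.
Qed.

HB.instance Definition _ := isMeasure.Build _ _ _ dm
  density0 density_ge0 density_sigma_additive.

End density_measure.

(** By symmetry [\int g * (k * 1_Q) = \int (k * g) * 1_Q = 0], and [k * 1_Q]
    differs from [1_Q] on a shell that shrinks to a null set. *)
Lemma box_integral_vanish g a b : borel_locally_integrable g ->
  (forall e, 0 < e -> e <= 1 -> exists k Mk, mollifying_kernel k e Mk /\
     forall x, convolution k g x = 0) ->
  \int[mu]_x (g x * \1_(box a b) x) = 0.
Proof.
move=> lg H; have [mg _] := lg; apply/eqP; rewrite -normr_le0.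
apply/ler_addgt0Pl => eta eta0; rewrite addr0.
have [d d0 hd] := shell_integral_small a b (`|a| + `|b| + 2) lg eta0.
pose e := Num.min 1 (d / 2).
have e0 : 0 < e by rewrite lt_min ltr01 divr_gt0.
have e1 : e <= 1 by rewrite ge_min lexx.
have ed : e < d by rewrite gt_min ltr_pdivrMr// ltr_pMr// ltr1n orbT.
have [k [Mk [hk kg0]]] := H e e0 e1.
have mi : measurable_fun setT (\1_(box a b) : 'rV[R]_n -> R).
  exact: measurable_indic (measurable_box_rV a b).
have i0 x : `|a| + `|b| + 1 <= `|x| -> \1_(box a b) x = 0 :> R.
  move=> xr; rewrite indicE memNset// => /box_sub_norm_ball/ball_rV.
  by rewrite sub0r normrN ltNge xr.
have int1 := integrable_bounded_product lg mi (indic_bounded _) i0.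
have mc := measurable_convolution hk mi.
have cb x : `|convolution k (\1_(box a b)) x| <= 1.
  exact: (convolution_le_sup hk x mi (indic_bounded _)).
have c0 x : `|a| + `|b| + 1 + e <= `|x| -> convolution k (\1_(box a b)) x = 0.
  by apply: (convolution_supp hk); exact: i0.
have int2 := integrable_bounded_product lg mc cb c0.
have sym : \int[mu]_x (g x * convolution k (\1_(box a b)) x) = 0.
  rewrite -(convolution_symmetric hk lg mi (indic_bounded _) i0).
  transitivity (\int[mu]_(x in setT) (0 : R)).
    by apply: eq_Rintegral => x _; rewrite kg0 mul0r.
  by rewrite Rintegral_cst// mul0r.
rewrite -[X in `|X|]subr0 -sym -RintegralB//.
apply: (le_trans (le_normr_Rintegral measurableT _)).
  by have := integrableB measurableT int1 int2; apply: eq_integrable.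
rewrite -lee_fin EFin_Rintegral//; last first.
  by have := integrable_norm (integrableB measurableT int1 int2); apply: eq_integrable.
apply: le_trans (hd _ ed); apply: ge0_le_integral_nomeas => x _; rewrite lee_fin//.
by rewrite -mulrBr normrM ler_wpM2l// distrC; exact: convolution_box_shell hk e1.
Qed.

(** Both densities [g^+] and [g^-] define the same measure once their
    difference integrates to zero on every box. *)
Lemma ae_zero_of_boxes g : borel_locally_integrable g ->
  (forall a b, \int[mu]_x (g x * \1_(box a b) x) = 0) -> g = cst 0 %[ae mu].
Proof.
move=> lg H; have [mg hg] := lg.
pose gp x := Num.max (g x) 0; pose gn x := Num.max (- g x) 0.
have mgp : measurable_fun setT gp by exact: measurable_maxr.
have mgn : measurable_fun setT gn by apply: measurable_maxr => //; exact: measurableT_comp.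
have gp0 x : 0 <= gp x by rewrite le_max lexx orbT.
have gn0 x : 0 <= gn x by rewrite le_max lexx orbT.
have fin (q : 'rV[R]_n -> R) a b : measurable_fun setT q -> (forall x, 0 <= q x) ->
    (forall x, q x <= `|g x|) -> (\int[mu]_(x in box a b) (q x)%:E < +oo)%E.
  move=> mq q0 qg; apply: le_lt_trans (hg (`|a| + `|b| + 1)).
  rewrite integral_mkcond [leRHS]integral_mkcond.
  apply: ge0_le_integral_nomeas => x _; rewrite !patchE.
    by case: ifPn => // _; rewrite lee_fin.
  case: ifPn => [/set_mem xb|_]; last by case: ifPn => // _; rewrite lee_fin.
  by rewrite mem_set ?lee_fin//; exact: box_sub_norm_ball xb.
have gpg x : gp x <= `|g x| by rewrite ge_max ler_norm normr_ge0.
have gng x : gn x <= `|g x| by rewrite ge_max normr_ge0 -normrN ler_norm.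
have intq (q : 'rV[R]_n -> R) a b : measurable_fun setT q -> (forall x, 0 <= q x) ->
    (forall x, q x <= `|g x|) -> mu.-integrable (box a b) (EFin \o q).
  move=> mq q0 qg; apply/integrableP; split.
    by apply/measurable_EFinP; exact: measurable_funTS.
  apply: le_lt_trans (fin q a b mq q0 qg).
  by apply: ge0_le_integral_nomeas => x _ //=; rewrite ger0_norm.
have eqm A : measurable A -> density_measure mgp gp0 A = density_measure mgn gn0 A.
  apply: measure_eq_boxes => [a b|a b]; first exact: fin.
  have ip := intq _ a b mgp gp0 gpg; have iq := intq _ a b mgn gn0 gng.
  have mb := measurable_box_rV a b.
  change ((\int[mu]_(x in box a b) (gp x)%:E)%E = (\int[mu]_(x in box a b) (gn x)%:E)%E).
  rewrite -EFin_Rintegral// -EFin_Rintegral//; congr _%:E.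
  apply/eqP; rewrite -subr_eq0 -RintegralB// -(H a b) Rintegral_mkcond; apply/eqP.
  apply: eq_Rintegral => x _; rewrite patchE indicE; case: ifPn => _; last by rewrite mulr0.
  by rewrite mulr1 /gp /gn; case: (leP (g x) 0) => h; case: (leP (- g x) 0) => h'; lra.
have zero (q q' : 'rV[R]_n -> R) (mq : measurable_fun setT q) (q0 : forall x, 0 <= q x)
    (mq' : measurable_fun setT q') (q0' : forall x, 0 <= q' x) :
    (forall A, measurable A -> density_measure mq q0 A = density_measure mq' q0' A) ->
    (forall x, q x = 0 \/ q' x = 0) -> q = cst 0 %[ae mu].
  move=> E qq'; have mE : measurable [set x | 0 < q x].
    rewrite [X in measurable X](_ : _ = q @^-1` `]0, +oo[%classic); last first.
      by apply/seteqP; split => x /=; rewrite in_itv/= andbT.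
    by rewrite -[X in measurable X]setTI; exact: (mq measurableT _ (measurable_itv _)).
  have Z : density_measure mq q0 setT = 0%E.
    transitivity (density_measure mq q0 [set x | 0 < q x]).
      rewrite /density_measure [RHS]integral_mkcond; apply: eq_integral => x _.
      rewrite patchE; case: ifPn => // /negP xE; congr _%:E.
      apply/eqP; rewrite eq_le q0 andbT leNgt; apply/negP => x0.
      by apply: xE; exact: mem_set.
    rewrite E// /density_measure integral0_eq// => x /= qx.
    by have [h|->//] := qq' x; move: qx; rewrite h ltxx.
  have mqE : measurable_fun setT (EFin \o q) by exact/measurable_EFinP.
  have := (ae_eq_integral_abs mu measurableT mqE).1 _.
  move=> /(_ _) hh; have : (\int[mu]_x `|(EFin \o q) x| = 0)%E.
    by rewrite -[RHS]Z; apply: eq_integral => x _ /=; rewrite ger0_norm.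
  by move=> /hh; apply: filterS => x /= hx _; have := hx I => -[].
have gpn x : gp x = 0 \/ gn x = 0.
  rewrite /gp /gn; have [h|h] := leP (g x) 0; [by left|right].
  by apply: max_r; rewrite oppr_le0 ltW.
have zp := zero gp gn mgp gp0 mgn gn0 eqm gpn.
have zn := zero gn gp mgn gn0 mgp gp0 (fun A mA => esym (eqm A mA)) (fun x => (or_comm _ _).1 (gpn x)).
apply: filterS2 zp zn => x h1 h2 _; move: (h1 I) (h2 I); rewrite /gp /gn /=.
by case: (leP (g x) 0) => h; case: (leP (- g x) 0) => h'; lra.
Qed.

(** Testing against the translated mollifier shows that a function orthogonal to
    all test functions has vanishing mollifications. *)
Lemma ae_zero_of_test (phi : 'rV[R]_n -> R) g : mollifier phi -> borel_locally_integrable g ->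
  (forall psi, test_function psi -> \int[mu]_x (g x * psi x) = 0) ->
  g = cst 0 %[ae mu].
Proof.
move=> hphi lg H; apply: ae_zero_of_boxes => // a b.
apply: box_integral_vanish => // e e0 e1.
exists (dilation e phi), (e ^- n * phi 0); split; first exact: mollifier_kernel.
move=> x; rewrite -[RHS](H _ (mollifier_translate x hphi e0)).
by apply: eq_Rintegral => y _; rewrite mulrC.
Qed.

Lemma weak_derivative_unique (phi : 'rV[R]_n -> R) (a : 'I_n -> nat) f g1 g2 : mollifier phi ->
  weak_derivative a f g1 -> weak_derivative a f g2 -> g1 = g2 %[ae mu].
Proof.
move=> hphi h1 h2; have [_ /locally_integrable_borel[d ld hd] h] := weak_derivativeB h1 h2.
suff d0 : d = cst 0 %[ae mu].
  apply: filterS2 hd d0 => x e1 e2 _; apply/eqP; rewrite -subr_eq0; apply/eqP.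
  by rewrite -[LHS]/((g1 \- g2) x) e1// e2.
apply: (ae_zero_of_test hphi ld) => psi tpsi; rewrite -(eq_ae_Rintegral_mul _ hd).
have : (-1) ^+ multi_order a * \int[mu]_x ((g1 \- g2) x * psi x) = 0.
  rewrite -h//; transitivity (\int[mu]_(x in setT) (0 : R)).
    by apply: eq_Rintegral => x _; rewrite /= subrr mul0r.
  by rewrite Rintegral_cst// mul0r.
by move=> /eqP; rewrite mulf_eq0 signr_eq0/= => /eqP.
Qed.

Lemma weakD_eq (phi : 'rV[R]_n -> R) (a : 'I_n -> nat) f g : mollifier phi -> weak_derivative a f g ->
  weakD a f = g %[ae mu] /\ weak_derivative a f (weakD a f).
Proof.
move=> hphi h; have h' : weak_derivative a f (weakD a f).
  by rewrite /weakD; case: xgetP => // /(_ g).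
by split => //; exact: weak_derivative_unique hphi h' h.
Qed.

End uniqueness.

(** * Mollifications converge in the modular *)

Section density.
Context {R : realType} {n : nat} (p th : 'rV[R]_n -> R) (pm pp K0 : R).
Local Notation mu := (lebesgue_rV n : {measure set 'rV[R]_n -> \bar R}).
Hypothesis hw : regular_weight p th pm pp K0.
Let pm1 := rw_pm1 hw.
Let p_ge := rw_p_ge hw.
Let p_le := rw_p_le hw.
Let mp := rw_mp hw.
Let mth := rw_mth hw.
Let th0 := rw_th0 hw.
Let th_loc := rw_th_loc hw.
Let sig_loc := rw_sig_loc hw.
Variable phi : 'rV[R]_n -> R.
Hypothesis hphi : mollifier phi.
Implicit Types f g h : 'rV[R]_n -> R.
Import HBNNSimple.
Local Notation rho f := (modular p th f%R).
Local Notation mollify e := (convolution (dilation e phi)).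
Let K : R := 2 `^ pp.
Let K1 : 1 <= K. Proof. by rewrite -(powRr0 2) ler_powR ?ler1n// (le_trans _ (p_le 0))// (le_trans _ (p_ge 0))// ltW// (lt_trans ltr01). Qed.
Let K0' : 0 < K. Proof. exact: lt_le_trans K1. Qed.
Let p1 x : 1 <= p x. Proof. by rewrite ltW// (lt_le_trans pm1). Qed.
Let kern e (e0 : 0 < e) := mollifier_kernel hphi e0.

Lemma modular_borel_locally_integrable f : measurable_fun setT f -> (rho f < +oo)%E ->
  borel_locally_integrable f.
Proof.
move=> mf foo; split => // r; apply: (le_lt_trans (modular_locally_integrable hw r mf)).
exact: (lte_add_pinfty foo (sig_loc r)).
Qed.

Lemma modularB_le f g (a b : R) : measurable_fun setT f -> measurable_fun setT g ->
  (rho f <= a%:E)%E -> (rho g <= b%:E)%E -> (rho (f \- g) <= (K * (a + b))%:E)%E.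
Proof.
move=> mf mg fa gb; apply: (le_trans (modularB hw mf mg)).
by rewrite EFinM EFinD; apply: lee_wpmul2l; [rewrite lee_fin ltW|exact: leeD].
Qed.

Lemma modularD_le f g (a b : R) : measurable_fun setT f -> measurable_fun setT g ->
  (rho f <= a%:E)%E -> (rho g <= b%:E)%E -> (rho (f \+ g) <= (K * (a + b))%:E)%E.
Proof.
move=> mf mg fa gb; apply: (le_trans (modularD hw mf mg)).
by rewrite EFinM EFinD; apply: lee_wpmul2l; [rewrite lee_fin ltW|exact: leeD].
Qed.

(** The mollifier is at most [e ^- n * phi 0] on a cube and zero elsewhere, so a
    mollification is dominated by a multiple of the cube average. *)
Lemma mollify_modular_bound : exists2 C : R, 0 < C & forall f (e : R),
  measurable_fun setT f -> (rho f <= 1)%E -> 0 < e -> e <= 1 ->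
  (rho (mollify e f) <= C%:E)%E.
Proof.
have [C C0 hC] := cube_average_bound hw.
pose s := Num.max 1 (phi 0).
have s1 : 1 <= s by rewrite le_max lexx.
exists (s `^ pp * C); first by rewrite mulr_gt0// powR_gt0// (lt_le_trans ltr01).
move=> f e mf f1 e0 e1.
have lf : borel_locally_integrable f.
  by apply: modular_borel_locally_integrable => //; apply: le_lt_trans f1 (ltry 1).
have mn : measurable_fun setT (fun y => `|f y|) by exact: measurableT_comp.
pose A x := e ^- n * fine (\int[mu]_(y in ball x e) (`|f y|)%:E)%E.
have mA : measurable_fun setT A.
  apply: measurable_funM => //.
  by apply: measurableT_comp => //; exact: measurable_ball_integral.
have A0 x : 0 <= A x.
  rewrite mulr_ge0// ?invr_ge0 ?exprn_ge0 ?(ltW e0)//.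
  by apply: fine_ge0; apply: integral_ge0 => y _; rewrite lee_fin.
have hA' : (rho A <= C%:E)%E.
  apply: le_trans (hC (fun y => `|f y|) e mn (fun y => normr_ge0 _) f1 e0 e1).
  by apply: ge0_le_integral_nomeas => x _; rewrite lee_fin ?(modular_integrand_ge0 hw)// (ger0_norm (A0 x)).
apply: (@le_trans _ _ (rho (fun x => s * A x)%R)).
  apply: (le_modular hw) => x; apply: (le_trans (convolution_le (kern e0) x lf)).
  rewrite [leRHS]ger0_norm; last exact: mulr_ge0 (le_trans ler01 s1) (A0 x).
  rewrite mulrAC -/(A x) mulrC; apply: ler_wpM2r; first exact: A0.
  by rewrite le_max lexx orbT.
apply: (le_trans (modularZ_ge hw mA s1)).
by rewrite EFinM; apply: lee_wpmul2l; [rewrite lee_fin powR_ge0|].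
Qed.

(** Scaling turns the bound on the unit ball of the modular into equicontinuity
    of the mollifications at zero. *)
Lemma mollify_modular_small (eta : R) : 0 < eta -> exists2 d : R, 0 < d &
  forall f (e : R), measurable_fun setT f -> (rho f <= d%:E)%E -> 0 < e -> e <= 1 ->
  (rho (mollify e f) <= eta%:E)%E.
Proof.
move=> eta0; have [C C0 hC] := mollify_modular_bound.
pose s := Num.min 1 (eta / C).
have s0 : 0 < s by rewrite lt_min ltr01 divr_gt0.
have s1 : s <= 1 by rewrite ge_min lexx.
have sp0 : 0 < s `^ pp by exact: powR_gt0.
exists (s `^ pp) => // f e mf fs e0 e1.
pose f' x := s^-1 * f x.
have mf' : measurable_fun setT f' by apply: measurable_funM => //; exact: measurable_cst.
have f'1 : (rho f' <= 1)%E.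
  have si1 : 1 <= s^-1 by rewrite invf_ge1.
  apply: (le_trans (modularZ_ge hw mf si1)).
  apply: (@le_trans _ _ ((s^-1 `^ pp)%:E * (s `^ pp)%:E)%E).
    by apply: lee_wpmul2l; [rewrite lee_fin powR_ge0|].
  by rewrite -EFinM -powRM ?invr_ge0 ?(ltW s0)// mulVf ?gt_eqF// powR1.
have lf' : borel_locally_integrable f'.
  by apply: modular_borel_locally_integrable => //; apply: le_lt_trans f'1 (ltry 1).
have -> : mollify e f = (fun x => s * mollify e f' x).
  apply/funext => x; rewrite -(convolutionZ (kern e0))//; congr (convolution _ _ x).
  by apply/funext => y; rewrite /f' mulrA divff ?gt_eqF// mul1r.
have mc := measurable_convolution (kern e0) mf'.
apply: (le_trans (modularZ_le hw mc (ltW s0) s1)).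
apply: (@le_trans _ _ (s%:E * C%:E)%E).
  by apply: lee_wpmul2l; [rewrite lee_fin ltW|exact: hC].
by rewrite -EFinM lee_fin -ler_pdivlMr// ge_min lexx orbT.
Qed.

Definition mollifiable f : Prop := [/\ measurable_fun setT f, (rho f < +oo)%E &
  forall eta, 0 < eta -> exists2 d : R, 0 < d & forall e, 0 < e -> e < d ->
    (rho (mollify e f \- f) <= eta%:E)%E].

(** A function inherits the approximation by mollifications from its neighbours
    in the modular, because all mollifications are equicontinuous. *)
Lemma mollify_error_transfer (eta : R) : 0 < eta -> exists2 d : R, 0 < d &
  forall f h (e : R), measurable_fun setT f -> measurable_fun setT h ->
  (rho f < +oo)%E -> (rho h < +oo)%E -> 0 < e -> e <= 1 ->
  (rho (f \- h) <= d%:E)%E -> (rho (mollify e h \- h) <= d%:E)%E ->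
  (rho (mollify e f \- f) <= eta%:E)%E.
Proof.
move=> eta0; pose eta' := eta / (3 * K ^+ 2).
have e'0 : 0 < eta' by rewrite divr_gt0// mulr_gt0// exprn_gt0.
have [d1 d10 hd1] := mollify_modular_small e'0.
exists (Num.min d1 eta'); first by rewrite lt_min d10.
move=> f h e mf mh foo hoo e0 e1 fh hh.
have mfh : measurable_fun setT (f \- h) by exact: measurable_funB.
have lf := modular_borel_locally_integrable mf foo.
have lh := modular_borel_locally_integrable mh hoo.
have -> : mollify e f \- f = (mollify e (f \- h) \- (f \- h)) \+ (mollify e h \- h).
  apply/funext => x /=; rewrite (convolutionB (kern e0))//; ring.
have m1 : measurable_fun setT (mollify e (f \- h)) by exact: (measurable_convolution (kern e0) mfh).
have m2 : measurable_fun setT (mollify e h) by exact: (measurable_convolution (kern e0) mh).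
have r1 : (rho (mollify e (f \- h)) <= eta'%:E)%E.
  apply: hd1 => //.
  by apply: le_trans fh _; rewrite lee_fin ge_min lexx.
have r2 : (rho (f \- h) <= eta'%:E)%E.
  by apply: le_trans fh _; rewrite lee_fin ge_min lexx orbT.
have r0 : (rho (mollify e h \- h) <= eta'%:E)%E.
  by apply: le_trans hh _; rewrite lee_fin ge_min lexx orbT.
have r3 := modularB_le m1 mfh r1 r2.
have m3 : measurable_fun setT (mollify e (f \- h) \- (f \- h)) by exact: measurable_funB.
have m4 : measurable_fun setT (mollify e h \- h) by exact: measurable_funB.
apply: (le_trans (modularD_le m3 m4 r3 r0)); rewrite lee_fin.
have -> : eta = 3 * K ^+ 2 * eta' by rewrite mulrC divfK// gt_eqF// mulr_gt0// exprn_gt0.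
have h1' : eta' <= K * eta' by rewrite ler_peMl// ltW.
have -> : 3 * K ^+ 2 * eta' = K * (K * (eta' + eta')) + K * (K * eta') by ring.
by rewrite mulrDr lerD2l ler_wpM2l// ltW.
Qed.

Lemma mollifiable_limit f : measurable_fun setT f ->
  (forall eta, 0 < eta -> exists2 h, mollifiable h & (rho (f \- h) <= eta%:E)%E) ->
  mollifiable f.
Proof.
move=> mf H; have [h1 [mh1 h1oo _] hh1] := H 1 ltr01.
have foo : (rho f < +oo)%E.
  have -> : f = (f \- h1) \+ h1 by apply/funext => x /=; rewrite subrK.
  have mb : measurable_fun setT (f \- h1) by exact: measurable_funB.
  apply: (le_lt_trans (modularD hw mb mh1)); apply: lte_mul_pinfty => //.
  exact: (lte_add_pinfty (le_lt_trans hh1 (ltry 1)) h1oo).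
split => // eta eta0; have [d2 d20 tr] := mollify_error_transfer eta0.
have [h [mh hoo hh] fh] := H _ d20.
have [d d0 hd] := hh _ d20.
exists (Num.min d 1); first by rewrite lt_min d0 ltr01.
move=> e e0; rewrite lt_min => /andP[ed e1].
exact: (tr f h e mf mh foo hoo e0 (ltW e1) fh (hd e e0 ed)).
Qed.

Lemma mollifiableB f g : mollifiable f -> mollifiable g -> mollifiable (f \- g).
Proof.
move=> [mf foo hf] [mg goo hg]; split; first exact: measurable_funB.
  exact: (modular_finB hw mf mg foo goo).
move=> eta eta0; pose eta' := eta / (2 * K).
have e'0 : 0 < eta' by rewrite divr_gt0// mulr_gt0.
have [d1 d10 h1] := hf _ e'0; have [d2 d20 h2] := hg _ e'0.
exists (Num.min d1 d2); first by rewrite lt_min d10.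
move=> e e0; rewrite lt_min => /andP[ed1 ed2].
have lf := modular_borel_locally_integrable mf foo.
have lg := modular_borel_locally_integrable mg goo.
have -> : mollify e (f \- g) \- (f \- g) = (mollify e f \- f) \- (mollify e g \- g).
  apply/funext => x /=; rewrite (convolutionB (kern e0))//; ring.
have m1 : measurable_fun setT (mollify e f \- f).
  by apply: measurable_funB => //; exact: (measurable_convolution (kern e0) mf).
have m2 : measurable_fun setT (mollify e g \- g).
  by apply: measurable_funB => //; exact: (measurable_convolution (kern e0) mg).
apply: (le_trans (modularB_le m1 m2 (h1 e e0 ed1) (h2 e e0 ed2))).
have -> : eta = 2 * K * eta' by rewrite mulrC divfK// gt_eqF// mulr_gt0.
by rewrite lee_fin (_ : K * (eta' + eta') = 2 * K * eta')//; ring.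
Qed.

Lemma mollifiableZ c f : mollifiable f -> mollifiable (fun x => c * f x).
Proof.
move=> [mf foo hf]; have mZ (q : 'rV[R]_n -> R) : measurable_fun setT q ->
    measurable_fun setT (fun x => c * q x).
  by move=> mq; apply: measurable_funM => //; exact: measurable_cst.
split; [exact: mZ|exact: (modular_fin_scale hw c mf foo)|].
move=> eta eta0; pose s := Num.max 1 `|c|.
have s1 : 1 <= s by rewrite le_max lexx.
have sp : 0 < s `^ pp by rewrite powR_gt0// (lt_le_trans ltr01).
have [d d0 hd] := hf _ (divr_gt0 eta0 sp).
exists d => // e e0 ed.
have lf := modular_borel_locally_integrable mf foo.
have m1 : measurable_fun setT (mollify e f \- f).
  by apply: measurable_funB => //; exact: (measurable_convolution (kern e0) mf).
apply: (@le_trans _ _ (rho (fun x => s * (mollify e f \- f) x)%R)).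
  apply: (le_modular hw) => x /=; rewrite (convolutionZ (kern e0))// -mulrBr !normrM.
  by rewrite ler_wpM2r// [leRHS]ger0_norm ?(le_trans ler01 s1)// le_max lexx orbT.
apply: (le_trans (modularZ_ge hw m1 s1)).
apply: (@le_trans _ _ ((s `^ pp)%:E * (eta / s `^ pp)%:E)%E).
  by apply: lee_wpmul2l; [rewrite lee_fin powR_ge0|exact: hd].
by rewrite -EFinM mulrC divfK// gt_eqF.
Qed.

Lemma mollifiableD f g : mollifiable f -> mollifiable g -> mollifiable (f \+ g).
Proof.
move=> hf hg; have := mollifiableB hf (mollifiableZ (-1) hg).
by congr mollifiable; apply/funext => x /=; rewrite mulN1r opprK.
Qed.

(** Dominated convergence turns a pointwise limit into a limit in the modular. *)
Lemma mollifiable_dominated (f_ : nat -> 'rV[R]_n -> R) f g :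
  (forall m, mollifiable (f_ m)) -> measurable_fun setT f ->
  measurable_fun setT g -> (rho g < +oo)%E ->
  (forall m x, `|f_ m x| <= g x) -> (forall x, `|f x| <= g x) ->
  (forall x eta, 0 < eta -> exists M, forall m, (M <= m)%N -> `|f x - f_ m x| <= eta) ->
  mollifiable f.
Proof.
move=> hf mf mg goo fmg fg lim; apply: mollifiable_limit => // eta eta0.
have g0 x : 0 <= g x by apply: le_trans (fg x).
have mf_ m : measurable_fun setT (f_ m) by have [] := hf m.
pose F m x := `|f x - f_ m x| `^ p x * th x.
pose G x := `|2 * g x| `^ p x * th x.
have m2g : measurable_fun setT (fun x => 2 * g x).
  by apply: measurable_funM => //; exact: measurable_cst.
have mF m : measurable_fun setT (F m).
  by apply: (measurable_modular_integrand hw (f := f \- f_ m)); exact: measurable_funB.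
have mG : measurable_fun setT G by exact: (measurable_modular_integrand hw m2g).
have iG : mu.-integrable setT (EFin \o G).
  apply/integrableP; split; first exact/measurable_EFinP.
  have g2oo := modular_fin_scale hw 2 mg goo.
  apply: le_lt_trans g2oo; apply: ge0_le_integral_nomeas => x _ //=.
  by rewrite lee_fin ger0_norm// (modular_integrand_ge0 hw (fun x => 2 * g x)).
have FG m x : 0 <= F m x <= G x.
  rewrite (modular_integrand_ge0 hw (f \- f_ m))/= ler_wpM2r ?(ltW (th0 x))//.
  apply: ge0_ler_powR; rewrite ?nnegrE ?(le_trans ler01 (p1 x))//.
  rewrite [leRHS]ger0_norm ?mulr_ge0//.
  by apply: (le_trans (ler_normB _ _)); rewrite mulr_natl mulr2n lerD.
have F0 : {ae mu, forall x, forall e, 0 < e -> exists M, forall m, (M <= m)%N -> F m x <= e}.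
  apply: aeW => x e e0; pose e' := Num.min 1 (e / th x).
  have e'0 : 0 < e' by rewrite lt_min ltr01 divr_gt0.
  have [M hM] := lim x _ e'0; exists M => m Mm.
  have := hM m Mm; rewrite le_min => /andP[h1 h2].
  rewrite /F -ler_pdivlMr//; apply: le_trans h2.
  have [d0|d0] := eqVneq `|f x - f_ m x| 0.
    by rewrite d0 powR0// gt_eqF// (lt_le_trans ltr01 (p1 x)).
  by apply: ge1r_powR => //; rewrite lt_def d0 normr_ge0.
have [M hM] := dominated_small mF iG FG F0 eta0.
by exists (f_ M) => //; exact: hM.
Qed.

Lemma th_borel_locally_integrable : borel_locally_integrable th.
Proof.
split => // r; apply: le_lt_trans (th_loc r).
by apply: ge0_le_integral_nomeas => x _ //; rewrite lee_fin (ger0_norm (ltW (th0 x))).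
Qed.

Lemma mollifiable_box a b : mollifiable (\1_(box a b)).
Proof.
have mi : measurable_fun setT (\1_(box a b) : 'rV[R]_n -> R).
  exact: measurable_indic (measurable_box_rV a b).
have powi (A : set 'rV[R]_n) x (t : R) : `|t| <= \1_A x -> `|t| `^ p x * th x <= `|th x| * \1_A x.
  have px : p x != 0 by rewrite gt_eqF// (lt_le_trans ltr01 (p1 x)).
  rewrite (ger0_norm (ltW (th0 x))) indicE mulrC ler_pM2l//; case: (_ \in _) => /= ht.
    apply: (@le_trans _ _ (1 `^ p x)); last by rewrite powR1.
    by apply: ge0_ler_powR; rewrite ?nnegrE ?(le_trans ler01 (p1 x)).
  have -> : `|t| = 0 by apply/eqP; rewrite eq_le ht normr_ge0.
  by rewrite powR0.
split => //.
  apply: le_lt_trans (th_borel_locally_integrable.2 (`|a| + `|b| + 1)).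
  rewrite [leRHS]integral_mkcond; apply: ge0_le_integral_nomeas => x _.
    by rewrite lee_fin (modular_integrand_ge0 hw).
  have := powi (box a b) x (\1_(box a b) x) _.
  rewrite [`|\1_(box a b) x|]ger0_norm ?indicE ?ler0n// => /(_ (lexx _)) h.
  rewrite patchE; case: ifPn => xb; rewrite lee_fin; apply: (le_trans h).
    by rewrite ler_piMr//; case: (_ \in _).
  rewrite memNset ?mulr0// => xq; move/negP : xb; apply.
  by apply/mem_set; exact: box_sub_norm_ball xq.
move=> eta eta0.
have [d d0 hd] := shell_integral_small a b (`|a| + `|b| + 2) th_borel_locally_integrable eta0.
exists (Num.min d 1); first by rewrite lt_min d0 ltr01.
move=> e e0; rewrite lt_min => /andP[ed e1].
apply: le_trans (hd e ed); apply: ge0_le_integral_nomeas => x _.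
  by rewrite lee_fin (modular_integrand_ge0 hw).
by rewrite lee_fin; apply: powi; exact: convolution_box_shell (kern e0) (ltW e1).
Qed.

(** Boxes generate the Borel sets and are stable under intersection, and the
    indicators involved are dominated by that of [cbox k]. *)
Lemma mollifiable_indic (E : set 'rV[R]_n) k : measurable E ->
  mollifiable (\1_(E `&` cbox k)).
Proof.
have eqi (A B : set 'rV[R]_n) : A = B -> \1_A = \1_B :> ('rV[R]_n -> R) by move=> ->.
have mQ : measurable (cbox k : set 'rV[R]_n) by exact: measurable_box_rV.
have hQ : mollifiable (\1_(cbox k)) by exact: mollifiable_box.
move=> mE; have := mE; rewrite measurable_rV_boxes; move: E {mE}.
apply: (dynkin_induction measurable_rV_boxes setI_closed_boxes).
- by rewrite setTI.
- by move=> _ [a [b ->]]; rewrite boxI; exact: mollifiable_box.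
- move=> S mS hS; have -> : \1_(~` S `&` cbox k) = \1_(cbox k) \- \1_(S `&` cbox k) :> ('rV[R]_n -> R).
    apply/funext => x /=; rewrite !indicE !in_setI in_setC.
    by case: (x \in S) => /=; case: (x \in _); rewrite /= ?subr0 ?subrr.
  exact: mollifiableB.
- move=> G mG tG hG.
  have mU : measurable (\bigcup_j G j) by exact: bigcup_measurable.
  pose f_ m x : R := \sum_(j < m) \1_(G j `&` cbox k) x.
  have f_E m x : f_ m x = \1_((\bigcup_(j in `I_m) G j) `&` cbox k) x.
    rewrite /f_; elim: m => [|m IH].
      by rewrite big_ord0 indicE memNset// => -[[]].
    rewrite big_ord_recr/= IH !indicE !in_setI.
    case: (boolP (x \in (cbox k : set 'rV[R]_n))) => _; rewrite ?andbF ?addr0// !andbT.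
    case: (boolP (x \in G m)) => xm.
      have -> : x \in \bigcup_(j in `I_m.+1) G j.
        by apply/mem_set; exists m => //=; exact: set_mem.
      rewrite memNset ?add0r// => -[j /= jm xj].
      have : (G j `&` G m) !=set0 by exists x; split => //; exact: set_mem.
      by move=> /(tG _ _ I I) E; move: jm; rewrite E ltnn.
    rewrite addr0; congr (_%:R); congr nat_of_bool; apply/idP/idP => /set_mem[j /= jm xj]; apply/mem_set.
      by exists j => //=; rewrite ltnS ltnW.
    exists j => //=; move: jm; rewrite ltnS leq_eqVlt => /orP[/eqP jm|//].
    by move: xm; rewrite -jm mem_set.
  have mi : measurable_fun setT (\1_((\bigcup_j G j) `&` cbox k) : 'rV[R]_n -> R).
    by apply: measurable_indic; exact: measurableI.
  have [mq qoo _] := hQ.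
  have hf_ m : mollifiable (f_ m).
    elim: m => [|m IH].
      have -> : f_ 0 = (fun x => 0 * \1_(cbox k) x).
        by apply/funext => x; rewrite /f_ big_ord0 mul0r.
      exact: mollifiableZ.
    have -> : f_ m.+1 = f_ m \+ \1_(G m `&` cbox k).
      by apply/funext => x; rewrite /f_ big_ord_recr.
    exact: (mollifiableD IH (hG m)).
  apply: (mollifiable_dominated hf_ mi mq qoo).
  + move=> m x; rewrite f_E ger0_norm ?indicE ?ler0n// in_setI ler_nat.
    by case: (_ \in _).
  + move=> x; rewrite ger0_norm ?indicE ?ler0n// in_setI ler_nat.
    by case: (_ \in _).
  + move=> x eta eta0; have [[j _ xj]|nx] := pselect ((\bigcup_j G j) x).
      exists j.+1 => m jm; rewrite f_E !indicE !in_setI mem_set; last by exists j.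
      by rewrite [x \in \bigcup_(i in `I_m) _]mem_set ?subrr ?normr0 ?ltW//; exists j.
    exists 0%N => m _; rewrite f_E !indicE !in_setI memNset//.
    rewrite [x \in \bigcup_(i in `I_m) _]memNset ?subrr ?normr0 ?ltW//.
    by move=> [j _ xj]; apply: nx; exists j.
Qed.

Lemma mollifiable_ge0 f : measurable_fun setT f -> (forall x, 0 <= f x) ->
  (rho f < +oo)%E -> mollifiable f.
Proof.
move=> mf f0 foo.
have mEf : measurable_fun setT (EFin \o f) by exact/measurable_EFinP.
pose h_ := nnsfun_approx measurableT mEf.
have hf x : EFin \o h_^~ x @ \oo --> (EFin \o f) x.
  by apply: cvg_nnsfun_approx => // y _; rewrite lee_fin.
have hlef m x : h_ m x <= f x.
  have hc : h_ ^~ x @ \oo --> f x by exact: (fine_cvg (hf x)).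
  rewrite -(cvg_lim (@Rhausdorff R) hc); apply: nondecreasing_cvgn_le.
    by move=> i j ij; exact: (lefP _ _ (nd_nnsfun_approx measurableT mEf ij)).
  by apply/cvg_ex; exists (f x).
pose f_ m (x : 'rV[R]_n) := h_ m x * \1_(cbox m) x.
have hf_ m : mollifiable (f_ m).
  have sumg (s : seq R) : mollifiable (fun x =>
      \sum_(y <- s) y * \1_((h_ m @^-1` [set y]) `&` cbox m) x).
    elim: s => [|y s IH].
      have := mollifiableZ 0 (mollifiable_indic m (@measurableT _ 'rV[R]_n)).
      by congr mollifiable; apply/funext => x; rewrite big_nil mul0r.
    have mE : measurable (h_ m @^-1` [set y]) by exact: measurable_sfunP.
    have := mollifiableD (mollifiableZ y (mollifiable_indic m mE)) IH.
    by congr mollifiable; apply/funext => x; rewrite big_cons.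
  have := sumg (finmap.enum_fset (fset_set (range (h_ m)))).
  congr mollifiable; apply/funext => x; rewrite /f_ fimfunE fsbig_finite//= mulr_suml.
  by apply: eq_bigr => y _; rewrite indicI/= mulrA.
apply: (mollifiable_dominated hf_ mf mf foo).
- move=> m x; rewrite /f_ indicE ger0_norm; last by rewrite mulr_ge0.
  by case: (_ \in _); rewrite ?mulr1 ?mulr0.
- by move=> x; rewrite ger0_norm.
- move=> x eta eta0.
  have hc : h_ ^~ x @ \oo --> f x by exact: (fine_cvg (hf x)).
  have [M1 _ hM1] := (cvgrPdist_le _ _).1 hc eta eta0.
  have [k _ xk] : (\bigcup_j (cbox j : set 'rV[R]_n)) x by rewrite bigcup_cbox.
  exists (maxn M1 k) => m; rewrite geq_max => /andP[m1 mk].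
  rewrite /f_ indicE mem_set ?mulr1; first exact: hM1.
  exact: cbox_nd mk _ xk.
Qed.

(** Boxes, unions of disjoint sets, simple functions and dominated limits
    exhaust the functions of finite modular. *)
Theorem mollify_converges f : measurable_fun setT f -> (rho f < +oo)%E ->
  forall eta, 0 < eta -> exists2 d : R, 0 < d & forall e, 0 < e -> e < d ->
    (rho (mollify e f \- f) <= eta%:E)%E.
Proof.
move=> mf foo; suff [_ _] : mollifiable f by [].
pose gp x := Num.max (f x) 0; pose gn x := Num.max (- f x) 0.
have -> : f = gp \- gn.
  by apply/funext => x; rewrite /gp /gn /=; case: (leP (f x) 0) => h; case: (leP (- f x) 0) => h'; lra.
have gp0 x : 0 <= gp x by rewrite le_max lexx orbT.
have gn0 x : 0 <= gn x by rewrite le_max lexx orbT.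
have mgp : measurable_fun setT gp by exact: measurable_maxr.
have mgn : measurable_fun setT gn by apply: measurable_maxr => //; exact: measurableT_comp.
have gpoo : (rho gp < +oo)%E.
  apply: le_lt_trans foo; apply: (le_modular hw) => x.
  by rewrite ger0_norm// ge_max ler_norm normr_ge0.
have gnoo : (rho gn < +oo)%E.
  apply: le_lt_trans foo; apply: (le_modular hw) => x.
  by rewrite ger0_norm// ge_max normr_ge0 -normrN ler_norm.
exact: (mollifiableB (mollifiable_ge0 mgp gp0 gpoo) (mollifiable_ge0 mgn gn0 gnoo)).
Qed.

End density.

(** * From uniform smoothness to finite nets *)

(** Two vectors of bounded numbers with the same integer parts are close, and
    only finitely many integer parts occur. *)
Lemma finite_codes {R : realType} (T : Type) (F : set T) (I : finType)
    (v : T -> I -> R) (U s : R) : 0 < s -> (forall f i, F f -> `|v f i| <= U) ->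
  exists N : set T, [/\ finite_set N, N `<=` F &
    forall f, F f -> exists2 g, N g & forall i, `|v f i - v g i| <= s].
Proof.
move=> s0 hU; have [[f0 Ff0]|F0] := pselect (exists f, F f); last first.
  exists set0; split => // f Ff; by have := F0 (ex_intro _ f Ff).
pose c f i := Num.truncn ((v f i + U) / s).
pose M := (Num.truncn (2 * U / s)).+1.
have cM f i : F f -> (c f i < M)%N.
  move=> Ff; rewrite ltnS; apply: le_truncn.
  rewrite ler_pM2r ?invr_gt0//; have := hU f i Ff; rewrite ler_norml => /andP[_].
  by rewrite mulr_natl mulr2n lerD2r.
pose code f : {ffun I -> 'I_M} := [ffun i => inord (c f i)].
pose rep (w : {ffun I -> 'I_M}) := if pselect (exists f, F f /\ code f = w) is left h
  then sval (cid h) else f0.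
exists (range rep); split.
- by apply: finite_image; exact: finite_finset.
- move=> _ [w _ <-]; rewrite /rep; case: pselect => // h.
  by case: (cid h) => f [].
- move=> f Ff; exists (rep (code f)); first by exists (code f).
  move=> i; rewrite /rep; case: pselect => [h|[]]; last by exists f.
  case: (cid h) => g /= [Fg cg].
  have /(congr1 val) := congr1 (fun w : {ffun I -> 'I_M} => w i) cg.
  rewrite !ffunE /= !inordK ?cM// => E.
  have tr h' : F h' -> (c h' i)%:R <= (v h' i + U) / s < (c h' i).+1%:R.
    move=> Fh'; apply/truncn_itv; rewrite divr_ge0 ?(ltW s0)//.
    by have := hU h' i Fh'; rewrite ler_norml => /andP[+ _]; rewrite -subr_ge0 opprK.
  have /andP[f1 f2] := tr f Ff; have /andP[g1 g2] := tr g Fg.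
  move: g1 g2; rewrite E => g1 g2.
  have : `|(v f i + U) / s - (v g i + U) / s| <= 1.
    by move: f2 g2; rewrite -!natr1 ler_norml => f2 g2; apply/andP; split; lra.
  rewrite -mulrBl normrM (gtr0_norm (x := s^-1)) ?invr_gt0// ler_pdivrMr// mul1r.
  by rewrite (_ : v f i + U - (v g i + U) = v f i - v g i)//; ring.
Qed.

Lemma ball_finite_net {R : realType} {n : nat} (r d : R) : 0 < d ->
  exists xs : seq 'rV[R]_n, (forall i : 'I_(size xs), `|xs`_i| <= r) /\
    forall x, `|x| <= r -> exists i : 'I_(size xs), `|x - xs`_i| < d.
Proof.
move=> d0; have := @compact_closed_ball0 R n r; rewrite compact_cover.
move=> /(_ _ [set x : 'rV[R]_n | `|x| <= r] (fun c => ball c d)) [c _|x xr|D Dr hD].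
- exact: ball_open.
- by exists x => //; exact: ballxx.
exists (finmap.enum_fset D); split=> [i|x /hD[c /= cD /ball_rV xc]].
  have : (finmap.enum_fset D)`_i \in finmap.enum_fset D by exact: mem_nth.
  by move=> /Dr; rewrite inE.
have ci : (index c (finmap.enum_fset D) < size (finmap.enum_fset D))%N.
  by rewrite index_mem.
by exists (Ordinal ci) => /=; rewrite nth_index// distrC.
Qed.

Section sufficiency.
Context {R : realType} {n : nat} (p th : 'rV[R]_n -> R) (pm pp K0 : R).
Local Notation mu := (lebesgue_rV n : {measure set 'rV[R]_n -> \bar R}).
Hypothesis hw : regular_weight p th pm pp K0.
Let pm1 := rw_pm1 hw.
Let p_ge := rw_p_ge hw.
Let p_le := rw_p_le hw.
Let mp := rw_mp hw.
Let mth := rw_mth hw.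
Let th0 := rw_th0 hw.
Let th_loc := rw_th_loc hw.
Let sig_loc := rw_sig_loc hw.
Variable phi : 'rV[R]_n -> R.
Hypothesis hphi : mollifier phi.
Implicit Types f g h : 'rV[R]_n -> R.
Local Notation rho f := (modular p th f%R).
Local Notation mollify e := (convolution (dilation e phi)).
Let K : R := 2 `^ pp.
Let p1 x : 1 <= p x. Proof. by rewrite ltW// (lt_le_trans pm1). Qed.
Let K1 : 1 <= K. Proof. by rewrite -(powRr0 2) ler_powR ?ler1n// (le_trans _ (p_le 0))// (le_trans ler01). Qed.
Let K0' : 0 < K. Proof. exact: lt_le_trans K1. Qed.
Let kern e (e0 : 0 < e) := mollifier_kernel hphi e0.

Lemma dilation_unif (e w : R) : 0 < e -> 0 < w -> exists2 d : R, 0 < d &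
  forall x y, `|x - y| < d -> `|dilation e phi x - dilation e phi y| < w.
Proof.
move=> e0 w0; have tphi := mollifier_translate 0 hphi e0.
have [d d0 hd] := test_function_unif tphi w0.
exists d => // x y xy; have := hd x y xy.
by rewrite !sub0r !(mk_even (kern e0)).
Qed.

(** The modulus of continuity of the mollifier is inherited by a mollification,
    up to a local [L^1] bound. *)
Lemma mollify_equicontinuous f (e r w : R) x y : borel_locally_integrable f ->
  0 < e -> e <= 1 -> `|x| <= r -> `|y| <= r ->
  (forall z, `|dilation e phi (x - z) - dilation e phi (y - z)| <= w) ->
  `|mollify e f x - mollify e f y| <=
    w * fine (\int[mu]_(z in ball (0%R : 'rV[R]_n) (r + 1)) `|f z|%:E)%E.
Proof.
move=> lf e0 e1 xr yr hw'; have hk := kern e0.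
have [mf _] := lf; have Ifin := integral_abs_ball_fin 0 (r + 1) lf.
have ix := kernel_product_integrable hk x lf.
have iy := kernel_product_integrable hk y lf.
have mB := @measurable_ball_rV R n 0 (r + 1).
rewrite /convolution -RintegralB//.
apply: (le_trans (le_normr_Rintegral measurableT _)).
  by have := integrableB measurableT ix iy; apply: eq_integrable.
have ixy := integrable_norm (integrableB measurableT ix iy).
rewrite -lee_fin EFin_Rintegral//.
rewrite EFinM (fineK Ifin) -ge0_integralZl//; last first.
- by rewrite lee_fin (le_trans (normr_ge0 _) (hw' 0)).
- by apply/measurable_EFinP; apply: measurable_funTS; exact: measurableT_comp.
rewrite [leRHS]integral_mkcond; apply: ge0_le_integral_nomeas => z _; first by rewrite lee_fin.
rewrite patchE; case: ifPn => [_|zB].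
  by rewrite -EFinM lee_fin -mulrBl normrM ler_wpM2r.
have ze : r + 1 <= `|z|.
  rewrite leNgt; apply/negP => zr; move/negP : zB; apply; apply/mem_set/ball_rV.
  by rewrite sub0r normrN.
have far c : `|c| <= r -> e <= `|c - z|.
  move=> cr; rewrite distrC; have := ler_normD (z - c) c; rewrite subrK => zc.
  by apply: (le_trans e1); rewrite -(lerD2r r) addrC (le_trans ze)// (le_trans zc)// lerD2l.
by rewrite !(mk_supp hk) ?far// !mul0r subrr normr0.
Qed.

Lemma modular_abs f : rho (fun x => `|f x|) = rho f.
Proof. by apply: eq_integral => x _; rewrite normr_id. Qed.

(** On a large cube two elements are close because their mollifications are;
    outside of it both are small. *)
Lemma modular_split f g u v (S : set 'rV[R]_n) (eta t : R) :
  measurable_fun setT f -> measurable_fun setT g ->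
  measurable_fun setT u -> measurable_fun setT v -> measurable S ->
  (rho (f \- u) <= eta%:E)%E -> (rho (g \- v) <= eta%:E)%E ->
  (rho (fun x => f x * \1_(~` S) x) <= eta%:E)%E ->
  (rho (fun x => g x * \1_(~` S) x) <= eta%:E)%E ->
  0 <= t -> t <= 1 -> (forall x, S x -> `|u x - v x| <= t) ->
  (t%:E * \int[mu]_(x in S) (th x)%:E <= eta%:E)%E ->
  (rho (f \- g) <= (5 * K ^+ 3 * eta)%:E)%E.
Proof.
move=> mf mg mu' mv mS fu gv fS gS t0 t1 uv teta.
have ab (q : 'rV[R]_n -> R) : measurable_fun setT q -> measurable_fun setT (fun x => `|q x|).
  by move=> mq; exact: measurableT_comp.
have mi (A : set 'rV[R]_n) (q : 'rV[R]_n -> R) : measurable A -> measurable_fun setT q ->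
    measurable_fun setT (fun x => q x * \1_A x).
  by move=> mA mq; apply: measurable_funM => //; exact: measurable_indic.
have mSc : measurable (~` S) by exact: measurableC.
have m1 := ab _ (measurable_funB mf mu'); have m2 := ab _ (measurable_funB mg mv).
have m3 := ab _ (mi _ _ mS (measurable_funB mu' mv)).
have m4 := ab _ (mi _ _ mSc mf); have m5 := ab _ (mi _ _ mSc mg).
have r1 : (rho (fun x => `|f x - u x|) <= eta%:E)%E by rewrite (modular_abs (f \- u)).
have r2 : (rho (fun x => `|g x - v x|) <= eta%:E)%E by rewrite (modular_abs (g \- v)).
have r4 : (rho (fun x => `|f x * \1_(~` S) x|) <= eta%:E)%E.
  by rewrite (modular_abs (fun x => f x * \1_(~` S) x)).
have r5 : (rho (fun x => `|g x * \1_(~` S) x|) <= eta%:E)%E.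
  by rewrite (modular_abs (fun x => g x * \1_(~` S) x)).
have r3 : (rho (fun x => `|(u x - v x) * \1_S x|) <= eta%:E)%E.
  apply: le_trans teta; rewrite -ge0_integralZl//; last 2 first.
  - by apply/measurable_EFinP; apply: measurable_funTS.
  - by move=> x _; rewrite lee_fin ltW.
  rewrite [leRHS]integral_mkcond; apply: ge0_le_integral_nomeas => x _.
    by rewrite lee_fin mulr_ge0 ?powR_ge0 ?(ltW (th0 x)).
  rewrite patchE normr_id indicE; case: ifPn => xS; last first.
    by rewrite mulr0 normr0 powR0 ?mul0r// gt_eqF// (lt_le_trans ltr01 (p1 x)).
  rewrite mulr1 -EFinM lee_fin ler_wpM2r ?(ltW (th0 x))//.
  apply: (@le_trans _ _ (t `^ p x)).
    apply: ge0_ler_powR; rewrite ?nnegrE ?(le_trans ler01 (p1 x))//.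
    by apply: uv; exact: set_mem.
  have [->|tn0] := eqVneq t 0; first by rewrite powR0// gt_eqF// (lt_le_trans ltr01 (p1 x)).
  by apply: ge1r_powR => //; rewrite lt_def tn0 t0.
have eta0 : 0 <= eta.
  by rewrite -lee_fin; apply: le_trans fu; exact: (modular_ge0 hw).
have r12 := modularD_le hw m1 m2 r1 r2.
have r45 := modularD_le hw m4 m5 r4 r5.
have r345 := modularD_le hw m3 (measurable_funD m4 m5) r3 r45.
have r := modularD_le hw (measurable_funD m1 m2) (measurable_funD m3 (measurable_funD m4 m5)) r12 r345.
apply: (@le_trans _ _ _ _ _ (le_trans _ r)).
  apply: (le_modular hw) => x /=; rewrite [leRHS]ger0_norm ?addr_ge0//.
  rewrite !indicE in_setC; case: (x \in S) => /=.
    rewrite !mulr0 !mulr1 normr0 !addr0.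
    rewrite (_ : f x - g x = f x - u x - (g x - v x) + (u x - v x)); last by ring.
    by apply: (le_trans (ler_normD _ _)); rewrite lerD2r ler_normB.
  rewrite !mulr0 !mulr1 normr0 add0r.
  by apply: (le_trans (ler_normB _ _)); rewrite lerDr addr_ge0.
rewrite lee_fin -/K.
have e1 : eta <= K * eta by rewrite ler_peMl.
have e2 : K * eta <= K * (K * eta) by rewrite ler_wpM2l// ltW.
have e3 : K * (K * eta) <= K * (K * (K * eta)) by rewrite ler_wpM2l// ltW// ?ler_wpM2l// ltW.
have -> : 5 * K ^+ 3 * eta = 5 * (K * (K * (K * eta))) by ring.
have -> : K * (K * (eta + eta) + K * (eta + K * (eta + eta))) =
  3 * (K * (K * eta)) + 2 * (K * (K * (K * eta))) by ring.
move: e3; set a := K * (K * eta); set b := K * (K * (K * eta)) => e3.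
rewrite (_ : 5 * b = 3 * b + 2 * b); last by ring.
by rewrite lerD2r ler_wpM2l.
Qed.

(** The nets are chosen inside the family. The scale is fixed first, by the error
    of mollification; then the local [L^1] bound makes the mollifications a
    bounded equicontinuous family on a cube. *)
Lemma family_finite_net (T : Type) (F : set T) (J : finType) (D : T -> J -> 'rV[R]_n -> R) :
  (forall (f : T) j, F f -> measurable_fun setT (D f j)) ->
  (exists C : R, forall (f : T) j, F f -> (rho (D f j) <= C%:E)%E) ->
  (forall eta, 0 < eta -> exists r : R, forall (f : T) j, F f ->
     (rho (fun x => D f j x * \1_(~` ball (0%R : 'rV[R]_n) r) x) <= eta%:E)%E) ->
  (forall eta, 0 < eta -> exists e : R, [/\ 0 < e, e <= 1 & forall (f : T) j, F f ->
     (rho (mollify e (D f j) \- D f j) <= eta%:E)%E]) ->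
  forall eta, 0 < eta -> exists N : set T, [/\ finite_set N, N `<=` F &
    forall f : T, F f -> exists2 g, N g & forall j, (rho (D f j \- D g j) <= eta%:E)%E].
Proof.
move=> mD [C hC] tails moll eta eta0.
pose eta1 := eta / (5 * K ^+ 3).
have K30 : 0 < 5 * K ^+ 3 by rewrite mulr_gt0// exprn_gt0.
have e10 : 0 < eta1 by rewrite divr_gt0.
have [r hr] := tails _ e10; have [e [e0 e1 he]] := moll _ e10.
have sfin : (\int[mu]_(x in ball (0%R : 'rV[R]_n) (r + 1)) (th x `^ (- (p x - 1)^-1))%:E)%E \is a fin_num.
  rewrite ge0_fin_numE ?sig_loc//.
  by apply: integral_ge0 => x _; rewrite lee_fin powR_ge0.
pose L := Num.max 1 (C + fine (\int[mu]_(x in ball (0%R : 'rV[R]_n) (r + 1)) (th x `^ (- (p x - 1)^-1))%:E)%E).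
have L0 : 0 < L by rewrite lt_max ltr01.
have lD (f : T) j : F f -> borel_locally_integrable (D f j).
  move=> Ff; apply: (modular_borel_locally_integrable hw (mD f j Ff)).
  exact: le_lt_trans (hC f j Ff) (ltry C).
have DL (f : T) j : F f -> fine (\int[mu]_(z in ball (0%R : 'rV[R]_n) (r + 1)) `|D f j z|%:E)%E <= L.
  move=> Ff; rewrite -lee_fin fineK; last exact: integral_abs_ball_fin (lD f j Ff).
  apply: (le_trans (modular_locally_integrable hw (r + 1) (mD f j Ff))).
  apply: (@le_trans _ _ (C%:E + \int[mu]_(x in ball (0%R : 'rV[R]_n) (r + 1)) (th x `^ (- (p x - 1)^-1))%:E)%E).
    by apply: leeD2r; exact: hC.
  by rewrite -(fineK sfin) -EFinD lee_fin le_max lexx orbT.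
have thfin : (\int[mu]_(x in ball (0%R : 'rV[R]_n) r) (th x)%:E)%E \is a fin_num.
  rewrite ge0_fin_numE ?th_loc//.
  by apply: integral_ge0 => x _; rewrite lee_fin ltW.
set Th := (\int[mu]_(x in ball (0%R : 'rV[R]_n) r) (th x)%:E)%E in thfin.
have Th0 : 0 <= fine Th by apply: fine_ge0; apply: integral_ge0 => x _; rewrite lee_fin ltW.
pose t := Num.min 1 (eta1 / (1 + fine Th)).
have Th1 : 0 < 1 + fine Th by rewrite ltr_pwDl.
have t0 : 0 < t by rewrite lt_min ltr01 divr_gt0.
have t1 : t <= 1 by rewrite ge_min lexx.
have tT : (t%:E * Th <= eta1%:E)%E.
  rewrite -(fineK thfin) -EFinM lee_fin.
  apply: (@le_trans _ _ (eta1 / (1 + fine Th) * fine Th)).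
    by rewrite ler_wpM2r// ge_min lexx orbT.
  by rewrite mulrAC ler_pdivrMr// ler_wpM2l ?(ltW e10)// lerDr.
(* With this modulus of continuity of the kernel, mollifications vary by at most
   [t / 3] within distance [d]. *)
pose w := t / (3 * L).
have w0 : 0 < w by rewrite divr_gt0// mulr_gt0.
have wL : w * L = t / 3 by rewrite /w; field; rewrite gt_eqF.
have [d d0 hd] := dilation_unif e0 w0.
have [xs [xr hxs]] := @ball_finite_net R n r d d0.
pose v (f : T) (i : 'I_(size xs) * J) := mollify e (D f i.2) (xs`_i.1).
have hU (f : T) i : F f -> `|v f i| <= e ^- n * phi 0 * L.
  move=> Ff; have lf := lD f i.2 Ff; have [mf _] := lf.
  apply: (le_trans (convolution_le (kern e0) (xs`_i.1) lf)).
  apply: ler_wpM2l; first exact: (mk_bound_ge0 (kern e0)).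
  apply: le_trans (DL f i.2 Ff); apply: fine_le.
  - exact: integral_abs_ball_fin.
  - exact: integral_abs_ball_fin.
  apply: ge0_subset_integral => //; try exact: measurable_ball_rV.
    by apply/measurable_EFinP; apply: measurable_funTS; exact: measurableT_comp.
  apply: (subset_trans (@ball_sub_ball0 _ _ _ _)); apply: le_ball.
  by rewrite lerD.
have t30 : 0 < t / 3 by rewrite divr_gt0.
have [N [finN NF hN]] := finite_codes t30 hU.
exists N; split => // f Ff; have [g Ng fg] := hN f Ff; exists g => // j.
have Fg := NF _ Ng.
have -> : eta = 5 * K ^+ 3 * eta1 by rewrite mulrC divfK// gt_eqF.
have mu1 := measurable_convolution (kern e0) (mD f j Ff).
have mu2 := measurable_convolution (kern e0) (mD g j Fg).
have c1 : (rho (D f j \- mollify e (D f j)) <= eta1%:E)%E.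
  by rewrite modularC; exact: (he f j Ff).
have c2 : (rho (D g j \- mollify e (D g j)) <= eta1%:E)%E.
  by rewrite modularC; exact: (he g j Fg).
apply: (modular_split (mD f j Ff) (mD g j Fg) mu1 mu2 (@measurable_ball_rV R n 0 r)
  c1 c2 (hr f j Ff) (hr g j Fg) (ltW t0) t1 _ tT).
move=> x /ball_rV; rewrite sub0r normrN => /ltW xle.
have [i xi] := hxs x xle.
have osc (h : T) : F h -> `|mollify e (D h j) x - mollify e (D h j) xs`_i| <= t / 3.
  move=> Fh; rewrite -wL; apply: le_trans (_ : _ <= w * _) _.
    apply: (mollify_equicontinuous (lD h j Fh) e0 e1 xle (xr i)) => z.
    by apply/ltW/hd; rewrite opprB addrA subrK.
  by apply: ler_wpM2l (DL h j Fh); exact: ltW.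
have := fg (i, j); rewrite /v /=.
have := osc f Ff; have := osc g Fg.
set a := mollify e (D f j) x; set b := mollify e (D g j) x.
set a' := mollify e (D f j) _; set b' := mollify e (D g j) _ => gb fa ab.
rewrite (_ : a - b = (a - a') + (a' - b') - (b - b')); last by ring.
apply: (le_trans (ler_normB _ _)); rewrite (_ : t = t / 3 + t / 3 + t / 3); last by field.
apply: lerD => //; apply: (le_trans (ler_normD _ _)); exact: lerD.
Qed.

End sufficiency.

(** * Changing the weight on a null set *)

Section regularization.
Context {R : realType} {n : nat}.
Local Notation mu := (lebesgue_rV n : {measure set 'rV[R]_n -> \bar R}).
Implicit Types (p th f g : 'rV[R]_n -> R).

Lemma eq_ae_vnorm (D : set 'rV[R]_n) (s : 'rV[R]_n -> R) f g : f = g %[ae mu] ->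
  vnorm D s f = vnorm D s g.
Proof.
move=> fg.
have E l : (\int[mu]_(x in D) (`|f x / l| `^ s x)%:E = \int[mu]_(x in D) (`|g x / l| `^ s x)%:E)%E.
  apply: ae_ge0_eq_integral_dom => [x _|x _|].
  - by rewrite lee_fin powR_ge0.
  - by rewrite lee_fin powR_ge0.
  - by apply: filterS fg => x h _; rewrite h.
apply/eqP; rewrite eq_le; apply/andP; split; apply: ereal_inf_le_tmp => _ [l [l0 h] <-].
  by exists l; [split; [exact: l0|rewrite E; exact: h]|].
by exists l; [split; [exact: l0|rewrite -E; exact: h]|].
Qed.

Lemma wnorm_eq_ae_weight p th th' : th = th' %[ae mu] -> wnorm p th = wnorm p th'.
Proof.
move=> E; apply/funext => f; rewrite /wnorm; apply: eq_ae_vnorm.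
by apply: filterS E => x h _ /=; rewrite h.
Qed.

Lemma modular_eq_ae_weight p th th' (D : set 'rV[R]_n) f : th = th' %[ae mu] ->
  (forall x, 0 <= th x) -> (forall x, 0 <= th' x) ->
  (\int[mu]_(x in D) (`|f x| `^ p x * th x)%:E = \int[mu]_(x in D) (`|f x| `^ p x * th' x)%:E)%E.
Proof.
move=> E t0 t0'; apply: ae_ge0_eq_integral_dom => [x _|x _|].
- by rewrite lee_fin mulr_ge0 ?powR_ge0.
- by rewrite lee_fin mulr_ge0 ?powR_ge0.
- by apply: filterS E => x h _; rewrite h.
Qed.

Lemma muckenhoupt_eq_ae_weight p th th' : th = th' %[ae mu] ->
  muckenhoupt p th -> muckenhoupt p th'.
Proof.
move=> E.
have Ei c (r : R) : (\int[mu]_(x in eball c r) `|th x|%:E = \int[mu]_(x in eball c r) `|th' x|%:E)%E.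
  apply: ae_ge0_eq_integral_dom => [x _|x _|]; rewrite ?lee_fin//.
  by apply: filterS E => x h _; rewrite h.
have Ev c (r : R) : vnorm (eball c r) (fun x => conj_exponent p x / p x) (fun x => (th x)^-1) =
    vnorm (eball c r) (fun x => conj_exponent p x / p x) (fun x => (th' x)^-1).
  by apply: eq_ae_vnorm; apply: filterS E => x h _ /=; rewrite h.
apply: le_lt_trans; apply: ereal_sup_le => v [c [r [r0 /= ->]]].
exists c, r; split; first exact: r0.
cbv zeta; rewrite Ei Ev; reflexivity.
Qed.

(** An essential bound of a continuous function is a bound, since nonempty open
    sets have positive measure. *)
Lemma ess_inf_continuous_bound p : continuous p ->
  (1 < ess_inf mu (EFin \o p))%E -> exists2 pm : R, 1 < pm & forall x, pm <= p x.
Proof.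
move=> cp hinf.
have [pm [pm1 pmi]] : exists pm : R, 1 < pm /\ (pm%:E <= ess_inf mu (EFin \o p))%E.
  move: hinf; case: (ess_inf _ _) => [s| |//].
    by rewrite lte_fin => s1; exists s.
  by move=> _; exists 2; rewrite ltr1n leey.
exists pm => // x; rewrite leNgt; apply/negP => px.
have /ess_infP [N [mN N0 subN]] := pmi.
have [d d0 hd] := (continuous_rVP p).2 cp x (pm - p x) (eqbRL (subr_gt0 _ _) px).
have sub : eball x d `<=` N.
  move=> y yd; apply: subN => /=; rewrite lee_fin; apply/negP; rewrite -ltNge.
  have /ball_rV/hd := eball_sub_ball yd; rewrite distrC ltr_norml => /andP[_]; lra.
have := mu_eball_gt0 x d0; rewrite lt_neqAle => /andP[/eqP h _]; apply: h.
by apply/esym/eqP; rewrite eq_le measure_ge0 andbT -N0 le_measure ?inE//; exact: measurable_eball.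
Qed.

Lemma regularize (hn : (0 < n)%N) p th : P_log p ->
  (1 < ess_inf mu (EFin \o p))%E -> weight th -> muckenhoupt p th ->
  locally_integrable_rV (fun x => th x `^ (- (p x - 1)^-1)) ->
  exists th' pm pp K0, th = th' %[ae mu] /\ regular_weight p th' pm pp K0.
Proof.
move=> [_ [C [pinf [C0 pinf1 hp1 hp2]]]] hinf [lth th0] hA [_ hloc].
have cp := log_holder_continuous hp1.
have [pm pm1 p_ge] := ess_inf_continuous_bound cp hinf.
have [K0 K00 hosc] := log_holder_osc C0 hp1 hp2.
have [g [mg lg] thg] := locally_integrable_borel lth.
pose th' x := if 0 < g x then g x else 1.
have th'0 x : 0 < th' x by rewrite /th'; case: ifPn.
have E : th = th' %[ae mu].
  by apply: filterS thg => x h _; rewrite /th' -h// th0.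
have mth' : measurable_fun setT th'.
  rewrite /th'; apply: measurable_fun_ifT => //.
  exact: measurable_fun_ltr.
have p_le x : p x <= pinf + C by exact: (log_holder_bounded C0 hp2).
have th'_loc r : (\int[mu]_(x in ball (0%R : 'rV[R]_n) r) (th' x)%:E < +oo)%E.
  apply: le_lt_trans (lg r); apply: ae_ge0_le_integral_dom => [x _|x _|].
  - by rewrite lee_fin ltW.
  - by rewrite lee_fin.
  - by apply: filterS2 E thg => x h1 h2 _; rewrite -h1// h2// lee_fin ler_norm.
have sig_loc r : (\int[mu]_(x in ball (0%R : 'rV[R]_n) r) (th' x `^ (- (p x - 1)^-1))%:E < +oo)%E.
  apply: le_lt_trans (hloc _ (@compact_closed_ball0 R n r)).
  rewrite integral_mkcond [leRHS]integral_mkcond.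
  apply: ae_ge0_le_integralT => [x|x|].
  - by rewrite patchE; case: ifPn => // _; rewrite lee_fin powR_ge0.
  - by rewrite patchE; case: ifPn => // _; rewrite lee_fin.
  - apply: filterS E => x h; rewrite !patchE; case: ifPn => [/set_mem/ball_rV xr|_].
      rewrite mem_set ?h ?lee_fin ?ler_norm//=.
      by rewrite -normrN -(sub0r x) ltW.
    by case: ifPn => // _; rewrite lee_fin.
exists th', pm, (pinf + C), K0; split; first exact: E.
exact: (RegularWeight hn pm1 p_ge p_le (continuous_measurable_rV cp) mth' th'0
  th'_loc sig_loc K00 hosc (muckenhoupt_eq_ae_weight E hA)).
Qed.

End regularization.

(** * Total boundedness in the weighted Sobolev space *)

(** The maximum of the individual parameters works, by monotonicity. *)
Lemma finite_uniform {R : realType} (T : choiceType) (N : set T) (P : T -> R -> Prop) :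
  finite_set N -> (forall x c c', P x c -> c <= c' -> P x c') ->
  (forall x, N x -> exists c, P x c) -> exists c, forall x, N x -> P x c.
Proof.
move=> /finite_seqP[s ->] mono; elim: s => [|y s IH] h; first by exists 0.
have [c1 h1] := h y (mem_head _ _).
have [|c2 h2] := IH _; first by move=> x xs; apply: h; rewrite /= inE xs orbT.
exists (Num.max c1 c2) => x /=; rewrite inE => /orP[/eqP ->|xs].
  by apply: mono h1 _; rewrite le_max lexx.
by apply: mono (h2 x xs) _; rewrite le_max lexx orbT.
Qed.

Section sobolev_nets.
Context {R : realType} {n : nat} (p th : 'rV[R]_n -> R) (pm pp K0 : R).
Local Notation mu := (lebesgue_rV n : {measure set 'rV[R]_n -> \bar R}).
Hypothesis hw : regular_weight p th pm pp K0.
Let pm1 := rw_pm1 hw.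
Let p_ge := rw_p_ge hw.
Let p_le := rw_p_le hw.
Let mp := rw_mp hw.
Let mth := rw_mth hw.
Let th0 := rw_th0 hw.
Variables (k : nat) (phi : 'rV[R]_n -> R).
Hypothesis hphi : mollifier phi.
Implicit Types (f g h : 'rV[R]_n -> R) (a : 'I_n -> nat) (F : set ('rV[R]_n -> R)).
Local Notation rho f := (modular p th f%R).
Local Notation mollify e := (convolution (dilation e phi)).
Let K : R := 2 `^ pp.
Let p1 x : 1 <= p x. Proof. by rewrite ltW// (lt_le_trans pm1). Qed.
Let K1 : 1 <= K. Proof. by rewrite -(powRr0 2) ler_powR ?ler1n// (le_trans _ (p_le 0))// (le_trans ler01). Qed.
Let K0' : 0 < K. Proof. exact: lt_le_trans K1. Qed.
Let kern e (e0 : 0 < e) := mollifier_kernel hphi e0.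

(** The modular calculus needs Borel functions, whereas [weakD] is measurable only
    up to a null set. *)
Definition borel_weakD a f : 'rV[R]_n -> R :=
  xget (cst 0) [set g | measurable_fun setT g /\ weakD a f = g %[ae mu]].

(** [weakD] may pick any locally integrable version; by uniqueness it agrees with
    the one of finite norm. *)
Lemma sobolev_weakD f a : sobolev k p th f -> (multi_order a <= k)%N ->
  [/\ weak_derivative a f (weakD a f), measurable_fun setT (borel_weakD a f),
      weakD a f = borel_weakD a f %[ae mu] & (rho (borel_weakD a f) < +oo)%E].
Proof.
move=> [_ hf] ak; have [g wg [[g' mg' gg'] goo]] := hf a ak.
have [Dg wD] := weakD_eq hphi wg.
have Dg' : weakD a f = g' %[ae mu].
  by apply: filterS2 Dg gg' => x h1 h2 _; rewrite h1// h2.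
have [mb Eb] : [set g | measurable_fun setT g /\ weakD a f = g %[ae mu]] (borel_weakD a f).
  exact: (xgetPex (cst 0) (ex_intro _ g' (conj mg' Dg'))).
split => //; rewrite -(eq_ae_modular hw (f := g')).
  by apply/(wnorm_fin_modular hw mg'); rewrite -(eq_ae_wnorm hw gg').
by apply: filterS2 Eb Dg' => x h1 h2 _; rewrite -h1// h2.
Qed.

Lemma weakD_sub f g a : sobolev k p th f -> sobolev k p th g -> (multi_order a <= k)%N ->
  weakD a (f \- g) = borel_weakD a f \- borel_weakD a g %[ae mu].
Proof.
move=> sf sg ak; have [wf _ ef _] := sobolev_weakD sf ak.
have [wg _ eg _] := sobolev_weakD sg ak.
have [h _] := weakD_eq hphi (weak_derivativeB wf wg).
by apply: filterS3 h ef eg => x h1 h2 h3 _; rewrite h1//= h2// h3.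
Qed.

Lemma weakD_mollify f a e : sobolev k p th f -> (multi_order a <= k)%N -> 0 < e ->
  weakD a (mollify e f) \- weakD a f =
  mollify e (borel_weakD a f) \- borel_weakD a f %[ae mu].
Proof.
move=> sf ak e0; have [wf _ ef _] := sobolev_weakD sf ak.
have [h _] := weakD_eq hphi (weak_derivative_convolution (kern e0) wf).
rewrite -(eq_ae_convolution _ ef).
by apply: filterS2 h ef => x h1 h2 _ /=; rewrite h1// h2.
Qed.

Lemma wnorm_ge0 f : (0 <= wnorm p th f)%E.
Proof. by apply: le_ereal_inf_tmp => _ [l [l0 _] <-]; rewrite lee_fin ltW. Qed.

Lemma sobolev_norm_lt_wnorm f (e : \bar R) a : (sobolev_norm k p th f < e)%E ->
  (multi_order a <= k)%N -> (wnorm p th (weakD a f) < e)%E.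
Proof.
move=> h ak; apply: le_lt_trans h.
have ai i : (a i < k.+1)%N.
  by rewrite ltnS (leq_trans _ ak)// /multi_order (bigD1 i)//= leq_addr.
pose j : {ffun 'I_n -> 'I_k.+1} := [ffun i => inord (a i)].
have ja : (fun i => j i : nat) = a by apply/funext => i; rewrite ffunE inordK.
rewrite /sobolev_norm (bigD1 j)/= ?ja// leeDl// sume_ge0// => b _.
exact: wnorm_ge0.
Qed.

Lemma sobolev_norm_lt (e : R) : 0 < e -> exists2 s : R, 0 < s /\ s <= 1 &
  forall f, (forall a, (multi_order a <= k)%N -> (wnorm p th (weakD a f) <= s%:E)%E) ->
  (sobolev_norm k p th f < e%:E)%E.
Proof.
move=> e0; pose M : R := (#|[pred a : {ffun 'I_n -> 'I_k.+1} | (multi_order (fun i => a i) <= k)%N]|)%:R.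
have M0 : 0 <= M by rewrite ler0n.
have M1 : 0 < M + 1 by rewrite ltr_wpDl.
exists (Num.min 1 (e / 2 / (M + 1))).
  by split; [rewrite lt_min ltr01 !divr_gt0|rewrite ge_min lexx].
set s := Num.min _ _ => g hg.
apply: (@le_lt_trans _ _ (\sum_(a : {ffun 'I_n -> 'I_k.+1} | (multi_order (fun i => a i) <= k)%N) s%:E)%E).
  by apply: lee_sum => a ak; exact: hg.
rewrite sumEFin lte_fin sumr_const -mulr_natl -/M.
apply: (@le_lt_trans _ _ (M * (e / 2 / (M + 1)))).
  by rewrite ler_wpM2l// ge_min lexx orbT.
rewrite mulrA ltr_pdivrMr// mulrC.
apply: (@le_lt_trans _ _ (e / 2 * (M + 1))).
  by rewrite ler_wpM2l ?divr_ge0 ?ltW// ltrDl.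
by rewrite ltr_pM2r// ltr_pdivrMr// ltr_pMr// ltr1n.
Qed.

(** Norm and modular define the same notion of smallness. *)
Lemma wnorm_lt_of_modular (e : R) : 0 < e -> exists2 d : R, 0 < d &
  forall f, measurable_fun setT f -> (rho f <= d%:E)%E -> (wnorm p th f < e%:E)%E.
Proof.
move=> e0; pose s := Num.min 1 (e / 2).
have s0 : 0 < s by rewrite lt_min ltr01 divr_gt0.
exists (s `^ pp) => [|f mf fs]; first exact: powR_gt0.
apply: (@le_lt_trans _ _ s%:E).
  by apply: (modular_le_wnorm hw mf s0 _ fs); rewrite ge_min lexx.
by rewrite lte_fin gt_min ltr_pdivrMr// ltr_pMr// ltr1n orbT.
Qed.

Lemma modular_lt_of_wnorm (e : R) : 0 < e -> exists2 d : R, 0 < d &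
  forall f, measurable_fun setT f -> (wnorm p th f < d%:E)%E -> (rho f < e%:E)%E.
Proof.
move=> e0; exists (Num.min 1 e) => [|f mf fs]; first by rewrite lt_min ltr01.
apply: (@lt_le_trans _ _ (Num.min 1 e)%:E); last by rewrite lee_fin ge_min lexx orbT.
by apply: (wnorm_lt_modular hw mf _ fs); rewrite ge_min lexx.
Qed.

Lemma modular_setE (S : set 'rV[R]_n) f :
  (\int[mu]_(x in S) (`|f x| `^ p x * th x)%:E = rho (fun x => f x * \1_S x))%E.
Proof.
rewrite integral_mkcond; apply: eq_integral => x _; rewrite patchE indicE.
case: ifPn => _; first by rewrite mulr1.
by rewrite mulr0 normr0 powR0 ?mul0r// gt_eqF// (lt_le_trans ltr01 (p1 x)).
Qed.

Lemma measurable_enorm_gt (ga : R) : measurable [set y : 'rV[R]_n | ga < enorm y].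
Proof.
rewrite [X in measurable X](_ : _ = @enorm R n @^-1` `]ga, +oo[%classic); last first.
  by apply/seteqP; split => x /=; rewrite in_itv/= andbT.
by rewrite -[X in measurable X]setTI; exact: measurable_enorm.
Qed.

Lemma measurable_tail (ga : R) f : measurable_fun setT f ->
  measurable_fun setT (fun x => f x * \1_[set y : 'rV[R]_n | ga < enorm y] x).
Proof.
move=> mf; apply: measurable_funM => //.
exact: (measurable_indic (measurable_enorm_gt ga)).
Qed.

Lemma tail_eq_ae f g (ga : R) : f = g %[ae mu] ->
  (fun x => f x * \1_[set y | ga < enorm y] x) =
  (fun x => g x * \1_[set y | ga < enorm y] x) %[ae mu].
Proof. by apply: filterS => x h _; rewrite h. Qed.

Lemma norm_tailsP F : F `<=` sobolev k p th ->
  norm_tails k p th F <-> forall e : R, 0 < e -> exists2 ga : R, 0 < ga &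
    forall f a, F f -> (multi_order a <= k)%N ->
      (rho (fun x => borel_weakD a f x * \1_[set y | ga < enorm y] x) < e%:E)%E.
Proof.
move=> FS; split=> H e e0.
- have [d d0 hd] := modular_lt_of_wnorm e0.
  have [ga ga0 hga] := H d d0; exists ga => // f a Ff ak.
  have [_ mb Eb _] := sobolev_weakD (FS _ Ff) ak.
  apply: hd; first exact: measurable_tail.
  by rewrite -(eq_ae_wnorm hw (tail_eq_ae ga Eb)); exact: hga.
- have [d d0 hd] := wnorm_lt_of_modular e0.
  have [ga ga0 hga] := H d d0; exists ga => // f a Ff ak.
  have [_ mb Eb _] := sobolev_weakD (FS _ Ff) ak.
  rewrite (eq_ae_wnorm hw (tail_eq_ae ga Eb)).
  by apply: hd; [exact: measurable_tail|apply: ltW; exact: hga].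
Qed.

Lemma norm_modular_tails F : F `<=` sobolev k p th ->
  norm_tails k p th F <-> modular_tails k p th F.
Proof.
move=> FS; have E f a (ga : R) : F f -> (multi_order a <= k)%N ->
    (\int[mu]_(x in [set y | (ga < enorm y)%R]) (`|weakD a f x| `^ p x * th x)%:E =
    rho (fun x => borel_weakD a f x * \1_[set y | ga < enorm y] x))%E.
  move=> Ff ak; have [_ _ Eb _] := sobolev_weakD (FS _ Ff) ak.
  by rewrite modular_setE; exact: (eq_ae_modular hw (tail_eq_ae ga Eb)).
split=> [/(norm_tailsP FS) H e e0|H].
  have [ga ga0 hga] := H e e0; exists ga; first exact: ga0.
  by move=> f a Ff ak; rewrite (E f a ga Ff ak); exact: (hga f a Ff ak).
apply/(norm_tailsP FS) => e e0; have [ga ga0 hga] := H e e0.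
exists ga; first exact: ga0.
by move=> f a Ff ak; rewrite -(E f a ga Ff ak); exact: (hga f a Ff ak).
Qed.

Lemma mollified_uniformlyP F : F `<=` sobolev k p th ->
  mollified_uniformly k p th phi F <-> forall e : R, 0 < e -> exists2 d : R, 0 < d &
    forall s, 0 < s < d -> forall f a, F f -> (multi_order a <= k)%N ->
      (rho (mollify s (borel_weakD a f) \- borel_weakD a f) <= e%:E)%E.
Proof.
move=> FS.
have mm f a s : F f -> (multi_order a <= k)%N -> 0 < s ->
    measurable_fun setT (mollify s (borel_weakD a f) \- borel_weakD a f).
  move=> Ff ak s0; have [_ mb _ _] := sobolev_weakD (FS _ Ff) ak.
  by apply: measurable_funB => //; exact: (measurable_convolution (kern s0)).
split=> H e e0.
- have [d d0 hd] := modular_lt_of_wnorm e0.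
  have [t t0 ht] := H d d0; exists t => // s st f a Ff ak; have /andP[s0 _] := st.
  apply/ltW/hd; first exact: mm.
  by rewrite -(eq_ae_wnorm hw (weakD_mollify (FS _ Ff) ak s0)); exact: ht.
- have [d d0 hd] := wnorm_lt_of_modular e0.
  have [t t0 ht] := H d d0; exists t => // s st f a Ff ak; have /andP[s0 _] := st.
  rewrite (eq_ae_wnorm hw (weakD_mollify (FS _ Ff) ak s0)).
  by apply: hd; [exact: mm|exact: ht].
Qed.

Lemma sobolev_boundedP F : F `<=` sobolev k p th ->
  sobolev_bounded k p th F <-> exists C : R, forall f a, F f -> (multi_order a <= k)%N ->
    (rho (borel_weakD a f) <= C%:E)%E.
Proof.
move=> FS; have E f a : F f -> (multi_order a <= k)%N ->
    (\int[mu]_x (`|weakD a f x| `^ p x * th x)%:E = rho (borel_weakD a f))%E.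
  by move=> Ff ak; have [_ _ Eb _] := sobolev_weakD (FS _ Ff) ak; exact: (eq_ae_modular hw Eb).
split=> [[C C0 hC]|[C hC]].
  by exists C => f a Ff ak; rewrite -E//; apply: ltW; exact: hC.
exists (`|C| + 1) => [|f a Ff ak]; first by rewrite ltr_wpDl.
rewrite E//; apply: le_lt_trans (hC f a Ff ak) _; rewrite lte_fin.
by rewrite (le_lt_trans (ler_norm C))// ltrDl.
Qed.

Lemma sobolev_totally_boundedP F : F `<=` sobolev k p th ->
  sobolev_totally_bounded k p th F -> forall e : R, 0 < e ->
  exists N : set ('rV[R]_n -> R), [/\ finite_set N, N `<=` sobolev k p th &
    forall f, F f -> exists2 g, N g & forall a, (multi_order a <= k)%N ->
      (rho (borel_weakD a f \- borel_weakD a g) <= e%:E)%E].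
Proof.
move=> FS H e e0; have [d d0 hd] := modular_lt_of_wnorm e0.
have [N [finN NS hN]] := H d d0; exists N; split => // f Ff.
have [g Ng fg] := hN f Ff; exists g => // a ak.
have [_ mf _ _] := sobolev_weakD (FS _ Ff) ak.
have [_ mg _ _] := sobolev_weakD (NS _ Ng) ak.
apply: ltW; apply: hd; first exact: (measurable_funB mf mg).
rewrite -(eq_ae_wnorm hw (weakD_sub (FS _ Ff) (NS _ Ng) ak)).
exact: (sobolev_norm_lt_wnorm fg ak).
Qed.

End sobolev_nets.

(** * Necessity and sufficiency of the three conditions *)

Section characterization.
Context {R : realType} {n : nat} (p th : 'rV[R]_n -> R) (pm pp K0 : R).
Local Notation mu := (lebesgue_rV n : {measure set 'rV[R]_n -> \bar R}).
Hypothesis hw : regular_weight p th pm pp K0.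
Let pm1 := rw_pm1 hw.
Let p_ge := rw_p_ge hw.
Let p_le := rw_p_le hw.
Let mp := rw_mp hw.
Let mth := rw_mth hw.
Let th0 := rw_th0 hw.
Let hA := rw_hA hw.
Variables (k : nat) (phi : 'rV[R]_n -> R) (F : set ('rV[R]_n -> R)).
Hypothesis hphi : mollifier phi.
Hypothesis FS : F `<=` sobolev k p th.
Implicit Types (f g h : 'rV[R]_n -> R) (a : 'I_n -> nat).
Local Notation rho f := (modular p th f%R).
Local Notation mollify e := (convolution (dilation e phi)).
Local Notation D := borel_weakD.
Let K : R := 2 `^ pp.
Let K0' : 0 < K. Proof. by rewrite powR_gt0. Qed.
Let p1 x : 1 <= p x. Proof. by rewrite ltW// (lt_le_trans pm1). Qed.

Lemma multi_index_ffun a : (multi_order a <= k)%N ->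
  exists j : {ffun 'I_n -> 'I_k.+1}, (fun i => j i : nat) = a.
Proof.
move=> ak; exists [ffun i => inord (a i)]; apply/funext => i; rewrite ffunE inordK//.
by rewrite ltnS (leq_trans _ ak)// /multi_order (bigD1 i)//= leq_addr.
Qed.

(** Makes a constant, a radius or a scale uniform over the derivatives of the
    members of a finite net. *)
Lemma net_uniform (N : set ('rV[R]_n -> R)) (Q : ('rV[R]_n -> R) -> ('I_n -> nat) -> R -> Prop) :
  finite_set N -> (forall g a c c', Q g a c -> c <= c' -> Q g a c') ->
  (forall g a, N g -> (multi_order a <= k)%N -> exists c, Q g a c) ->
  exists c, forall g a, N g -> (multi_order a <= k)%N -> Q g a c.
Proof.
move=> finN mono H.
have [||c hc] := @finite_uniform R _ N (fun g c => forall a, (multi_order a <= k)%N -> Q g a c) finN.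
- by move=> g c c' h cc a ak; apply: mono (h a ak) cc.
- move=> g Ng.
  have [||c hc] := @finite_uniform R _ [set: {ffun 'I_n -> 'I_k.+1}]
    (fun j c => (multi_order (fun i => j i) <= k)%N -> Q g (fun i => j i) c) finite_finset.
  + by move=> j c c' h cc jk; apply: mono (h jk) cc.
  + move=> j _; have [jk|jk] := boolP (multi_order (fun i => j i) <= k)%N.
      by have [c hc] := H g _ Ng jk; exists c.
    by exists 0.
  exists c => a ak; have [j ja] := multi_index_ffun ak.
  by have := hc j I; rewrite ja; exact.
by exists c => g a Ng ak; exact: hc.
Qed.

Lemma modular_tail_small f (e : R) : measurable_fun setT f -> (rho f < +oo)%E -> 0 < e ->
  exists c : R, (rho (fun x => f x * \1_[set y | c < enorm y] x) <= e%:E)%E.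
Proof.
move=> mf foo e0.
pose G x := `|f x| `^ p x * th x.
pose H (m : nat) x := `|f x * \1_[set y | m%:R < enorm y] x| `^ p x * th x.
have mG : measurable_fun setT G by exact: (measurable_modular_integrand hw mf).
have mH m : measurable_fun setT (H m).
  exact: (measurable_modular_integrand hw (measurable_tail m%:R mf)).
have iG : mu.-integrable setT (EFin \o G).
  apply/integrableP; split; first exact/measurable_EFinP.
  apply: le_lt_trans foo; apply: ge0_le_integral_nomeas => x _; first exact: abse_ge0.
  by rewrite /= lee_fin (ger0_norm (modular_integrand_ge0 hw f x)).
have HG m x : 0 <= H m x <= G x.
  rewrite (modular_integrand_ge0 hw (fun x => f x * \1_[set y | m%:R < enorm y] x))/=.
  rewrite /H /G ler_wpM2r ?(ltW (th0 x))//.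
  apply: ge0_ler_powR; rewrite ?nnegrE ?(le_trans ler01 (p1 x))//.
  by rewrite normrM ler_piMr// indic_bounded.
have H0 : {ae mu, forall x, forall eta, 0 < eta -> exists M, forall m, (M <= m)%N -> H m x <= eta}.
  apply: aeW => x eta eta0; exists (Num.truncn (enorm x)).+1 => m Mm.
  rewrite /H indicE memNset ?mulr0 ?normr0 ?powR0 ?mul0r ?(ltW eta0)//.
    by rewrite gt_eqF// (lt_le_trans ltr01 (p1 x)).
  apply/negP; rewrite -leNgt; apply/ltW; apply: lt_le_trans (truncnS_gt _) _.
  by rewrite ler_nat.
have [M hM] := dominated_small mH iG HG H0 e0.
by exists M%:R; exact: (hM M (leqnn M)).
Qed.

Lemma totally_bounded_bounded : sobolev_totally_bounded k p th F -> sobolev_bounded k p th F.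
Proof.
move=> tb; apply/(sobolev_boundedP hw hphi FS).
have [N [finN NS hN]] := sobolev_totally_boundedP hw hphi FS tb ltr01.
have [||C hC] := @net_uniform N (fun g a c => rho (D a g) <= c%:E)%E finN.
- by move=> g a c c' h cc; apply: (le_trans h); rewrite lee_fin.
- move=> g a Ng ak; have [_ mg _ goo] := sobolev_weakD hw hphi (NS _ Ng) ak.
  by exists (fine (rho (D a g))); rewrite fineK// ge0_fin_numE// (modular_ge0 hw).
exists (K * (1 + C)) => f a Ff ak; have [g Ng fg] := hN f Ff.
have [_ mf _ _] := sobolev_weakD hw hphi (FS Ff) ak.
have [_ mg _ _] := sobolev_weakD hw hphi (NS _ Ng) ak.
have -> : D a f = (D a f \- D a g) \+ D a g by apply/funext => x /=; rewrite subrK.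
exact: (modularD_le hw (measurable_funB mf mg) mg (fg a ak) (hC g a Ng ak)).
Qed.

Lemma totally_bounded_tails : sobolev_totally_bounded k p th F -> norm_tails k p th F.
Proof.
move=> tb; apply/(norm_tailsP hw hphi FS) => e e0.
pose e' := e / (4 * K).
have e'0 : 0 < e' by rewrite divr_gt0// mulr_gt0.
have [N [finN NS hN]] := sobolev_totally_boundedP hw hphi FS tb e'0.
pose tl c f := fun x => f x * \1_[set y : 'rV[R]_n | c < enorm y] x.
have [||C hC] := @net_uniform N (fun g a c => rho (tl c (D a g)) <= e'%:E)%E finN.
- move=> g a c c' h cc; apply: le_trans h; apply: (le_modular hw) => x.
  rewrite /tl !normrM ler_wpM2l// !indicE !ger0_norm ?ler0n// ler_nat.
  by case: (boolP (_ \in [set y | c' < _])) => // /set_mem /= xc; rewrite mem_set//= (le_lt_trans cc).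
- move=> g a Ng ak; have [_ mg _ goo] := sobolev_weakD hw hphi (NS _ Ng) ak.
  exact: modular_tail_small.
exists (Num.max C 1) => [|f a Ff ak]; first by rewrite lt_max ltr01 orbT.
have [g Ng fg] := hN f Ff.
have [_ mf _ _] := sobolev_weakD hw hphi (FS Ff) ak.
have [_ mg _ _] := sobolev_weakD hw hphi (NS _ Ng) ak.
have mb : measurable_fun setT (D a f \- D a g) by exact: (measurable_funB mf mg).
apply: (@le_lt_trans _ _ (rho (tl C (D a f)))).
  apply: (le_modular hw) => x; rewrite !normrM ler_wpM2l// !indicE !ger0_norm ?ler0n// ler_nat.
  case: (boolP (_ \in [set y | Num.max C 1 < _])) => // /set_mem /=.
  by rewrite gt_max => /andP[xc _]; rewrite mem_set.
have -> : tl C (D a f) = tl C (D a f \- D a g) \+ tl C (D a g).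
  by apply/funext => x; rewrite /tl /= -mulrDl subrK.
have r1 : (rho (tl C (D a f \- D a g)) <= e'%:E)%E.
  apply: le_trans (fg a ak); apply: (le_modular hw) => x.
  by rewrite normrM ler_piMr// indic_bounded.
apply: (le_lt_trans (modularD_le hw (measurable_tail C mb) (measurable_tail C mg) r1 (hC g a Ng ak))).
rewrite lte_fin -/K (_ : K * (e' + e') = e / 2); last by rewrite /e'; field; rewrite gt_eqF.
by rewrite ltr_pdivrMr// ltr_pMr// ltr1n.
Qed.

(** On the net the errors are small from some scale on, and the transfer lemma
    extends this to the functions near the net. *)
Lemma totally_bounded_mollified : sobolev_totally_bounded k p th F ->
  mollified_uniformly k p th phi F.
Proof.
move=> tb; apply/(mollified_uniformlyP hw hphi FS) => e e0.
have [d d0 tr] := mollify_error_transfer hw hphi e0.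
have [N [finN NS hN]] := sobolev_totally_boundedP hw hphi FS tb d0.
have [||C hC] := @net_uniform N (fun g a c => forall s, 0 < s -> c <= s^-1 ->
    (rho (mollify s (D a g) \- D a g) <= d%:E)%E) finN.
- by move=> g a c c' h cc s s0 cs; apply: h => //; exact: le_trans cs.
- move=> g a Ng ak; have [_ mg _ goo] := sobolev_weakD hw hphi (NS _ Ng) ak.
  have [t t0 ht] := mollify_converges hw hphi mg goo d0.
  exists (t / 2)^-1 => s s0 st; apply: ht => //.
  apply: (@le_lt_trans _ _ (t / 2)); last by rewrite ltr_pdivrMr// ltr_pMr// ltr1n.
  by rewrite -lef_pV2 ?posrE ?divr_gt0.
have M0 : 0 < Num.max C 1 by rewrite lt_max ltr01 orbT.
exists (Num.max C 1)^-1 => [|s /andP[s0 sM] f a Ff ak]; first by rewrite invr_gt0.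
have Ms : Num.max C 1 <= s^-1 by rewrite -[leLHS]invrK lef_pV2 ?posrE ?invr_gt0// ltW.
have s1 : s <= 1.
  by rewrite -invf_ge1//; apply: le_trans Ms; rewrite le_max lexx orbT.
have [g Ng fg] := hN f Ff.
have [_ mf _ foo] := sobolev_weakD hw hphi (FS Ff) ak.
have [_ mg _ goo] := sobolev_weakD hw hphi (NS _ Ng) ak.
apply: (tr _ _ s mf mg foo goo s0 s1 (fg a ak)); apply: hC => //.
by apply: le_trans Ms; rewrite le_max lexx.
Qed.

Lemma bounded_tails_mollified_totally_bounded : sobolev_bounded k p th F ->
  norm_tails k p th F -> mollified_uniformly k p th phi F ->
  sobolev_totally_bounded k p th F.
Proof.
move=> /(sobolev_boundedP hw hphi FS)[C hC] /(norm_tailsP hw hphi FS) tails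
  /(mollified_uniformlyP hw hphi FS) moll e e0.
pose J := {j : {ffun 'I_n -> 'I_k.+1} | (multi_order (fun i => j i) <= k)%N}.
pose DJ f (j : J) := D (fun i => val j i : nat) f.
have [s [s0 s1] hs] := sobolev_norm_lt p th k e0.
have [d d0 hd] := wnorm_lt_of_modular hw s0.
have [||||N [finN NF hN]] := @family_finite_net R n p th pm pp K0 hw phi hphi _ F J DJ _ _ _ _ d d0.
- by move=> f j Ff; have [] := sobolev_weakD hw hphi (FS Ff) (valP j).
- by exists C => f j Ff; exact: hC _ _ Ff (valP j).
- move=> eta eta0; have [ga ga0 hga] := tails eta eta0; exists (ga + 1) => f j Ff.
  apply: le_trans (ltW (hga f _ Ff (valP j))); apply: (le_modular hw) => x.
  rewrite !normrM ler_wpM2l// !indicE !ger0_norm ?ler0n// ler_nat.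
  case: (boolP (_ \in ~` _)) => // /set_mem /= xr; rewrite mem_set//=.
  apply: (lt_le_trans _ (norm_le_enorm x)); rewrite ltNge; apply/negP => xg; apply: xr.
  by apply/ball_rV; rewrite sub0r normrN (le_lt_trans xg)// ltrDl.
- move=> eta eta0; have [t t0 ht] := moll eta eta0.
  have m0 : 0 < Num.min 1 (t / 2) by rewrite lt_min ltr01 divr_gt0.
  exists (Num.min 1 (t / 2)); split=> [//||f j Ff]; first by rewrite ge_min lexx.
  apply: ht Ff (valP j); rewrite m0/= gt_min orbC ltr_pdivrMr// ltr_pMr// ltr1n//.
exists N; split => // [|f Ff]; first exact: subset_trans NF FS.
have [g Ng fg] := hN f Ff; exists g => //; apply: hs => a ak.
have [_ mf _ _] := sobolev_weakD hw hphi (FS Ff) ak.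
have [_ mg _ _] := sobolev_weakD hw hphi (FS (NF _ Ng)) ak.
rewrite (eq_ae_wnorm hw (weakD_sub hw hphi (FS Ff) (FS (NF _ Ng)) ak)).
apply: ltW; apply: hd; first exact: (measurable_funB mf mg).
have [j ja] := multi_index_ffun ak; rewrite -ja in ak *.
exact: (fg (exist _ j ak)).
Qed.

Theorem regular_totally_bounded :
  (sobolev_totally_bounded k p th F <->
    [/\ sobolev_bounded k p th F, norm_tails k p th F &
        mollified_uniformly k p th phi F]) /\
  (norm_tails k p th F <-> modular_tails k p th F).
Proof.
split; last exact: (norm_modular_tails hw hphi FS).
split=> [tb|[h1 h2 h3]]; last exact: bounded_tails_mollified_totally_bounded.
split; [exact: totally_bounded_bounded|exact: totally_bounded_tails|].
exact: totally_bounded_mollified.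
Qed.

End characterization.

Theorem theorem11 (R : realType) (n k : nat) (hn : (0 < n)%N) (hk : (0 < k)%N)
    (p th phi : 'rV[R]_n -> R)
    (hp : P_log p)
    (hp_inf : (1 < ess_inf (lebesgue_rV n) (EFin \o p))%E)
    (hp_sup : (ess_sup (lebesgue_rV n) (EFin \o p) < +oo)%E)
    (hth : weight th) (hA : muckenhoupt p th)
    (hloc : locally_integrable_rV (fun x => th x `^ (- (p x - 1)^-1)))
    (hphi : mollifier phi)
    (F : set ('rV[R]_n -> R)) (hF : F `<=` sobolev k p th) :
  (sobolev_totally_bounded k p th F <->
    [/\ sobolev_bounded k p th F,
        norm_tails k p th F &
        mollified_uniformly k p th phi F]) /\
  (norm_tails k p th F <-> modular_tails k p th F).
Proof.
(* All notions in the statement are insensitive to a change of [th] on a null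
   set: those defined by the norm because of [W], the modular ones because of
   [M]. *)
have [th' [pm [pp [K0 [E hw]]]]] := regularize hn hp hp_inf hth hA hloc.
have W := wnorm_eq_ae_weight p E.
have M D f := modular_eq_ae_weight p D f E (fun x => ltW (hth.2 x)) (fun x => ltW (rw_th0 hw x)).
have Ls : weighted_Lp p th = weighted_Lp p th' by rewrite /weighted_Lp W.
have S : sobolev k p th = sobolev k p th' by rewrite /sobolev Ls.
have FS : F `<=` sobolev k p th' by rewrite -S.
have Sn : sobolev_norm k p th = sobolev_norm k p th' by rewrite /sobolev_norm W.
have -> : sobolev_totally_bounded k p th F = sobolev_totally_bounded k p th' F.
  by rewrite /sobolev_totally_bounded S Sn.
have -> : norm_tails k p th F = norm_tails k p th' F by rewrite /norm_tails W.
have -> : mollified_uniformly k p th phi F = mollified_uniformly k p th' phi F.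
  by rewrite /mollified_uniformly W.
have -> : sobolev_bounded k p th F = sobolev_bounded k p th' F.
  apply/propext; split=> -[C C0 hC]; (exists C; first exact: C0) => f a Ff ak.
    by rewrite -(M setT (weakD a f)); exact: (hC f a Ff ak).
  by rewrite (M setT (weakD a f)); exact: (hC f a Ff ak).
have -> : modular_tails k p th F = modular_tails k p th' F.
  apply/propext; split=> H e e0; have [ga ga0 hga] := H e e0;
    (exists ga; first exact: ga0) => f a Ff ak.
    by rewrite -(M _ (weakD a f)); exact: (hga f a Ff ak).
  by rewrite (M _ (weakD a f)); exact: (hga f a Ff ak).
exact: (regular_totally_bounded hw hphi FS).
Qed.
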